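(* Let $x>0$ be fixed, let $K_{i\nu}(x)=\frac{\pi i}{2\sinh \pi\nu}\{I_{i\nu}(x)-I_{-i\nu}(x)\}$ be the modified Bessel function of the second kind of order $i\nu$, and let $\nu_n$ ($n=1,2,\ldots$) denote its $n$th positive $\nu$-zero, the positive zeros being listed in increasing order. Put $\lambda=2/(ex)$, $m_-=(n-\frac14)\pi$ and $\xi_n=m_-/W(\lambda m_-)$. Then $$\nu_n\sim \frac{m_-}{W(\lambda m_-)}+\frac{B_0}{m_-}+\frac{B_1}{m_-^3}+\frac{B_2}{m_-^5}+\cdots\qquad (n\to\infty),$$ where the coefficients $B_0,B_1,B_2$ (which depend on $x$ and $n$) are those defined in the context with $m=m_-$. Here $\sim$ means that for each $K\in\{0,1,2\}$, $$\nu_n=\xi_n+\sum_{k=0}^{K}\frac{B_k}{m_-^{2k+1}}+O\bigl(\xi_n^{-(2K+3)}\bigr)\qquad (n\to\infty).$$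
   Context: $I_{\pm i\nu}(x)$ is the modified Bessel function of the first kind of order $\pm i\nu$, with $I_{i\nu}(x)=\frac{(x/2)^{i\nu}}{\Gamma(1+i\nu)}\sum_{k\ge0}\frac{(x/2)^{2k}}{k!\,(1+i\nu)_k}$, where $(a)_k=\Gamma(a+k)/\Gamma(a)$. For $z>0$, $W(z)$ is the Lambert function: the positive solution of $W(z)e^{W(z)}=z$. A $\nu$-zero is a zero of the function regarded as a function of the real variable $\nu>0$ with $x>0$ fixed. It is known that $K_{i\nu}(x)$ has, for fixed $x>0$, a countably infinite number of simple real $\nu$-zeros, and $K_{-i\nu}(x)=K_{i\nu}(x)$, so only $\nu>0$ is considered. In terms of the phase $\Phi(\nu)=\nu\log(\lambda\nu)+\frac{\pi}{4}$, the labelling of large zeros corresponds to $\Phi(\nu_n)=n\pi-\epsilon_n$ with $\epsilon_n$ small. Stirling coefficients: $\gamma_0=1$, $\gamma_1=-\frac1{12}$, $\gamma_2=\frac1{288}$, $\gamma_3=\frac{139}{51840}$, $\gamma_4=-\frac{571}{2488320}$, $\gamma_5=-\frac{163879}{209018880}$. Polynomials: $C_0(c)=1$, $C_1(c)=c$, $C_2(c)=\frac c2(-2+c)$, $C_3(c)=\frac c6(6-9c+c^2)$, $C_4(c)=\frac c{24}(-24+84c-24c^2+c^3)$, $C_5(c)=\frac c{120}(120-900c+500c^2-50c^3+c^4)$. With $c=x^2/4$ set $a_0=1$ and $a_k=C_k(c)+\sum_{r=1}^k\gamma_rC_{k-r}(c)$ for $1\le k\le5$. Then $A_0=a_1$,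 $A_1=a_1a_2-a_3-\frac13a_1^3$, $A_2=a_1a_2^2+a_1^2a_3-a_1^3a_2-a_2a_3-a_1a_4+a_5+\frac15a_1^5$. For $m>0$ put $\xi=m/W(\lambda m)$ (so that $\xi\log(\lambda\xi)=m$) and $\rho=\xi/m$ (so that $1+\log(\lambda\xi)=(1+\rho)/\rho$). Define $b_0=\dfrac{-A_0}{1+\log(\lambda\xi)}$, $\quad b_1=\dfrac{A_0b_0-A_1-\frac12b_0^2}{1+\log(\lambda\xi)}$, and $$B_0=\frac{-A_0}{1+\rho},\qquad B_1=\frac{A_0b_0-A_1-\frac12b_0^2}{\rho^2(1+\rho)},\qquad B_2=\frac{3A_1b_0-A_0(b_0^2-b_1)-A_2-b_0b_1+\frac16b_0^3}{\rho^4(1+\rho)}.$$ *)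

(* Defs.v *)
From Stdlib Require Import Reals Factorial.
From Coquelicot Require Import Coquelicot.
Open Scope R_scope.

Definition Cexp (z : C) : C :=
  (exp (Re z) * cos (Im z), exp (Re z) * sin (Im z)).

(* Principal value of t^w; used for t > 0 only. *)
Definition Rcpow (t : R) (w : C) : C := Cexp (w * RtoC (ln t))%C.

(* Euler's integral, improper at both ends; meaningful for Re z > 0, which
   covers every argument 1 +- i nu + k occurring below. *)
Definition CGamma (z : C) : C :=
  RInt_gen (V := C_R_CompleteNormedModule)
    (fun t : R => (Rcpow t (z - 1) * RtoC (exp (- t)))%C)
    (at_right 0) (Rbar_locally p_infty).

Definition pochhammer (a : C) (k : nat) : C :=
  (CGamma (a + RtoC (INR k)) / CGamma a)%C.

Definition CSeries (a : nat -> C) : C :=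
  (Series (fun k => Re (a k)), Series (fun k => Im (a k))).

Definition BesselI (mu : C) (x : R) : C :=
  (Rcpow (x / 2) mu / CGamma (1 + mu)
   * CSeries (fun k => RtoC ((x / 2) ^ (2 * k))
                       / (RtoC (INR (fact k)) * pochhammer (1 + mu) k)))%C.

(* K_{i nu}(x) for real nu <> 0. *)
Definition BesselKi (nu x : R) : C :=
  (RtoC PI * Ci / RtoC (2 * sinh (PI * nu))
   * (BesselI (Ci * RtoC nu) x - BesselI (- (Ci * RtoC nu)) x))%C.

(* nu 1 < nu 2 < ... lists all positive zeros of nu |-> K_{i nu}(x);
   the value nu 0 is irrelevant. *)
Definition positive_nu_zeros (x : R) (nu : nat -> R) : Prop :=
  (forall n, (1 <= n)%nat -> 0 < nu n /\ BesselKi (nu n) x = RtoC 0)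
  /\ (forall n, (1 <= n)%nat -> nu n < nu (S n))
  /\ (forall v, 0 < v -> BesselKi v x = RtoC 0 ->
        exists n, (1 <= n)%nat /\ nu n = v).

(* The unique positive solution w of w e^w = z, for z > 0. *)
Definition LambertW (z : R) : R :=
  iota (T := R_CompleteSpace) (fun w : R => 0 < w /\ w * exp w = z).

(* Stirling coefficients. Here and in polyC only the indices 0..5 are used. *)
Definition gam (r : nat) : R :=
  match r with
  | 0%nat => 1
  | 1%nat => - (1 / 12)
  | 2%nat => 1 / 288
  | 3%nat => 139 / 51840
  | 4%nat => - (571 / 2488320)
  | 5%nat => - (163879 / 209018880)
  | _ => 0
  end.

Definition polyC (k : nat) (c : R) : R :=
  match k with
  | 0%nat => 1
  | 1%nat => c
  | 2%nat => c / 2 * (- 2 + c)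
  | 3%nat => c / 6 * (6 - 9 * c + c ^ 2)
  | 4%nat => c / 24 * (- 24 + 84 * c - 24 * c ^ 2 + c ^ 3)
  | 5%nat => c / 120 * (120 - 900 * c + 500 * c ^ 2 - 50 * c ^ 3 + c ^ 4)
  | _ => 0
  end.

(* For k = 0 the sum is empty, so that a_coef x 0 = 1. *)
Definition a_coef (x : R) (k : nat) : R :=
  let c := x ^ 2 / 4 in
  polyC k c + sum_n_m (fun r => gam r * polyC (k - r) c) 1 k.

Definition A0 (x : R) : R := a_coef x 1.

Definition A1 (x : R) : R := a_coef x 1 * a_coef x 2 - a_coef x 3 - 1 / 3 * a_coef x 1 ^ 3.

Definition A2 (x : R) : R :=
  a_coef x 1 * a_coef x 2 ^ 2 + a_coef x 1 ^ 2 * a_coef x 3 - a_coef x 1 ^ 3 * a_coef x 2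
  - a_coef x 2 * a_coef x 3 - a_coef x 1 * a_coef x 4 + a_coef x 5 + 1 / 5 * a_coef x 1 ^ 5.

Definition lambda (x : R) : R := 2 / (exp 1 * x).

Definition xi (x m : R) : R := m / LambertW (lambda x * m).

Definition rho (x m : R) : R := xi x m / m.

Definition b0 (x m : R) : R := - A0 x / (1 + ln (lambda x * xi x m)).

Definition b1 (x m : R) : R :=
  (A0 x * b0 x m - A1 x - 1 / 2 * b0 x m ^ 2)
  / (1 + ln (lambda x * xi x m)).

Definition B0 (x m : R) : R := - A0 x / (1 + rho x m).

Definition B1 (x m : R) : R :=
  (A0 x * b0 x m - A1 x - 1 / 2 * b0 x m ^ 2)
  / (rho x m ^ 2 * (1 + rho x m)).

Definition B2 (x m : R) : R :=
  (3 * A1 x * b0 x m - A0 x * (b0 x m ^ 2 - b1 x m) - A2 x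
   - b0 x m * b1 x m + 1 / 6 * b0 x m ^ 3)
  / (rho x m ^ 4 * (1 + rho x m)).

(* Only k = 0, 1, 2 are used. *)
Definition B (k : nat) (x m : R) : R :=
  match k with
  | 0%nat => B0 x m
  | 1%nat => B1 x m
  | 2%nat => B2 x m
  | _ => 0
  end.

Definition m_minus (n : nat) : R := (INR n - 1 / 4) * PI.

(* u n = O(v n) as n -> infinity. *)
Definition bigO (u v : nat -> R) : Prop :=
  exists M : R, eventually (fun n => Rabs (u n) <= M * Rabs (v n)).

(* Main.v *)
Require Import Defs.
From Stdlib Require Import Reals Lra Lia ZArith Factorial Ranalysis5.
From Coquelicot Require Import Coquelicot.
Open Scope R_scope.

(** The zeros in nu of K_{i nu}(x) are read off from a phase. With c = x^2/4 and F the sum of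
    c^k / (k! (1 + i nu)_k), one has I_{i nu}(x) = (x/2)^(i nu) F / Gamma(1 + i nu), and
    K_{i nu}(x) is a nonzero real multiple of the imaginary part of I_{i nu}(x). So it vanishes
    exactly when sin theta = 0 for
    theta = arg Gamma(1 + i nu) - nu ln (x/2) - arg F
    (BesselKi_zero_iff_sin_theta). Both arguments are honest continuous functions: the first is
    the limit of nu ln n minus the sum of atan (nu/j) for j <= n, by Euler's product
    (gamma_polar); the second is an integral in c of Im (F'/F), where F does not vanish
    because of a Wronskian identity (wronskian).

    The zero number n satisfies theta = n pi exactly (theta_at_zeros); this is what fixes the
    label in the expansion. In s = 2 ln (x/2) the function |F| sin theta solves
    u'' = (e^s - nu^2/4) u, and theta decreases in s. As s tends to infinity, theta tends to 0:
    the terms of the series of I_{i nu} concentrate near the index sqrt c, where their phases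
    cancel (cos_theta_lower), and the branch is that of nu = 0, by continuity in nu. So the
    solution is the decaying one, and Sturm comparison applies up to infinity (sturm): once
    theta has reached j pi at some nu, it stays above j pi for all larger nu. As theta = 0 at
    nu = 0, each multiple of pi is attained once, in order.

    For large nu, Stirling's formula along the imaginary axis (gamma_arg_asymptotic) and the
    expansion of F in powers of 1/(i nu) (F_expansion) give
    theta = nu ln (lambda nu) + pi/4 + A0/nu + A1/nu^3 + A2/nu^5 + O(nu^-7)
    (phase_expansion). Stirling's formula is obtained by summing the increments of its
    right side along t + i nu, t = 0, 1, 2, ..., where each increment is log (z + 1) up to
    O(|z|^-8).

    It remains to solve theta = n pi. The leading part xi ln (lambda xi) = m_minus is Lambert's
    equation. One checks that xi + b0/xi + b1/xi^3 + b2/xi^5 satisfies the equation up to O(xi^-7)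
    (approximate_root). As the phase has derivative at least 1/2, it is that close to the zero
    (inversion_expansion), and b_k / xi^(2k+1) = B_k / m_minus^(2k+1) (B_over_m). The cases of
    fewer terms follow, because the b_k are bounded. *)

(** * Euler's product and the argument of Gamma(1 + i nu) *)

Lemma exp_mono (x y : R) : x <= y -> exp x <= exp y.
Proof. intros [H| ->]; [left; now apply exp_increasing|lra]. Qed.

Lemma lipschitz_of_derive (f df : R -> R) (a b L : R) :
  (forall x, Rmin a b <= x <= Rmax a b -> is_derive f x (df x)) ->
  (forall x, Rmin a b <= x <= Rmax a b -> Rabs (df x) <= L) ->
  Rabs (f b - f a) <= L * Rabs (b - a).
Proof.
  intros Hd HL.
  destruct (MVT_gen f a b df) as [c [Hc E]].
  - intros x Hx; apply Hd; lra.
  - intros x Hx. apply derivable_continuous_pt.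
    exists (df x). apply is_derive_Reals, Hd; lra.
  - rewrite E, Rabs_mult. apply Rmult_le_compat_r; [apply Rabs_pos|auto].
Qed.

Lemma is_derive_atan_lin (x : R) : is_derive atan x (/ (1 + x ^ 2)).
Proof.
  apply is_derive_Reals.
  apply derivable_pt_lim_atan.
Qed.

Lemma atan_lipschitz (a b : R) : Rabs (atan b - atan a) <= Rabs (b - a).
Proof.
  rewrite <- (Rmult_1_l (Rabs (b - a))).
  apply lipschitz_of_derive with (df := fun x => / (1 + x ^ 2)).
  - intros x _; apply is_derive_atan_lin.
  - intros x _. assert (0 <= x ^ 2) by apply pow2_ge_0.
    rewrite Rabs_pos_eq; [|left; apply Rinv_0_lt_compat; lra].
    rewrite <- Rinv_1. apply Rinv_le_contravar; lra.
Qed.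

Lemma cos_lipschitz (a b : R) : Rabs (cos b - cos a) <= Rabs (b - a).
Proof.
  rewrite <- (Rmult_1_l (Rabs (b - a))).
  apply lipschitz_of_derive with (df := fun x => - sin x).
  - intros x _; auto_derive; trivial; ring.
  - intros x _. rewrite Rabs_Ropp. apply Rabs_le, SIN_bound.
Qed.

Lemma sin_lipschitz (a b : R) : Rabs (sin b - sin a) <= Rabs (b - a).
Proof.
  rewrite <- (Rmult_1_l (Rabs (b - a))).
  apply lipschitz_of_derive with (df := fun x => cos x).
  - intros x _; auto_derive; trivial; ring.
  - intros x _. apply Rabs_le, COS_bound.
Qed.

(** The derivative t^2 / (1 + t^2) is small near 0. This is what makes the increments of
    the sequence below summable, with Lipschitz constants in nu that are summable too. *)
Lemma atan_defect_lipschitz (V a b : R) :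
  Rabs a <= V -> Rabs b <= V ->
  Rabs ((b - atan b) - (a - atan a)) <= V ^ 2 * Rabs (b - a).
Proof.
  intros Ha Hb.
  apply (lipschitz_of_derive (fun x => x - atan x) (fun x => 1 - / (1 + x ^ 2))).
  - intros x _. apply (is_derive_minus (fun x => x) atan x 1 (/ (1 + x ^ 2))).
    apply (is_derive_id (K := R_AbsRing)). apply is_derive_atan_lin.
  - intros x Hx.
    assert (H : Rabs x <= V).
    { apply Rabs_le_between in Ha; apply Rabs_le_between in Hb. apply Rabs_le.
      unfold Rmin, Rmax in Hx; destruct (Rle_dec a b); lra. }
    assert (0 <= x ^ 2) by apply pow2_ge_0.
    assert (x ^ 2 <= V ^ 2) by (rewrite <- (pow2_abs x); apply pow_incr; split; [apply Rabs_pos|auto]).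
    replace (1 - / (1 + x ^ 2)) with (x ^ 2 * / (1 + x ^ 2)) by (field; lra).
    rewrite Rabs_pos_eq.
    + rewrite <- (Rmult_1_r (V ^ 2)). apply Rmult_le_compat; trivial.
      * left; apply Rinv_0_lt_compat; lra.
      * rewrite <- Rinv_1. apply Rinv_le_contravar; lra.
    + apply Rmult_le_pos; trivial. left; apply Rinv_0_lt_compat; lra.
Qed.

Lemma ln_le_minus1 (x : R) : 0 < x -> ln x <= x - 1.
Proof.
  intros H. destruct (Rtotal_order x 1) as [H1|[->|H1]].
  - left. rewrite <- (exp_ln x) at 2 by trivial.
    assert (ln x < 0) by (rewrite <- ln_1; apply ln_increasing; lra).
    generalize (exp_ineq1 (ln x)); lra.
  - rewrite ln_1; lra.
  - left. rewrite <- (exp_ln x) at 2 by trivial.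
    assert (0 < ln x) by (rewrite <- ln_1; apply ln_increasing; lra).
    generalize (exp_ineq1 (ln x)); lra.
Qed.

Lemma INR_S_pos (n : nat) : 0 < INR (S n).
Proof. apply lt_0_INR; lia. Qed.

Lemma ln_step_defect (n : nat) :
  Rabs (ln (INR (S (S n))) - ln (INR (S n)) - / INR (S (S n)))
  <= / INR (S n) - / INR (S (S n)).
Proof.
  assert (H := INR_S_pos n). rewrite (S_INR (S n)).
  set (t := INR (S n)) in *.
  rewrite <- ln_div by lra.
  assert (H1 := ln_le_minus1 ((t + 1) / t) ltac:(apply Rdiv_lt_0_compat; lra)).
  assert (H2 := ln_le_minus1 (t / (t + 1)) ltac:(apply Rdiv_lt_0_compat; lra)).
  replace (t / (t + 1)) with (/ ((t + 1) / t)) in H2 at 1 by (field; lra).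
  rewrite ln_Rinv in H2 by (apply Rdiv_lt_0_compat; lra).
  replace ((t + 1) / t - 1) with (/ t) in H1 by (field; lra).
  replace (t / (t + 1) - 1) with (- / (t + 1)) in H2 by (field; lra).
  rewrite Rabs_pos_eq; lra.
Qed.

(** Argument, and below inverse modulus, of the product of the factors 1 + i nu/j for j <= k;
    the latter uses cos (atan y) = 1 / |1 + i y|. *)
Fixpoint euler_arg (k : nat) (nu : R) : R :=
  match k with
  | O => 0
  | S k' => euler_arg k' nu + atan (nu / INR k)
  end.

Fixpoint euler_mod (k : nat) (nu : R) : R :=
  match k with
  | O => 1
  | S k' => euler_mod k' nu * cos (atan (nu / INR k))
  end.

Lemma euler_arg_S (k : nat) (nu : R) :
  euler_arg (S k) nu = euler_arg k nu + atan (nu / INR (S k)).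
Proof. reflexivity. Qed.

Lemma euler_mod_S (k : nat) (nu : R) :
  euler_mod (S k) nu = euler_mod k nu * cos (atan (nu / INR (S k))).
Proof. reflexivity. Qed.

(** Argument of N^(i nu) divided by the product of the factors 1 + i nu/j for j <= N, with
    N = n + 1: Euler's product for Gamma(1 + i nu). The sum of arctangents is the branch that
    is continuous in nu and vanishes at nu = 0; it is never reduced modulo 2 pi. *)
Definition gamma_arg_seq (n : nat) (nu : R) : R :=
  nu * ln (INR (S n)) - euler_arg (S n) nu.

Definition gamma_arg (nu : R) : R := real (Lim_seq (fun n => gamma_arg_seq n nu)).

(** The logarithm in an increment is close to 1/(n+2) and the arctangent to nu/(n+2), so
    that the increment is O(1/n^2); the bound is written as a difference in order to telescope. *)
Lemma gamma_arg_seq_step (V nu mu : R) (n : nat) :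
  Rabs nu <= V -> Rabs mu <= V ->
  Rabs ((gamma_arg_seq (S n) nu - gamma_arg_seq n nu)
        - (gamma_arg_seq (S n) mu - gamma_arg_seq n mu))
  <= (1 + V ^ 2) * Rabs (nu - mu) * (/ INR (S n) - / INR (S (S n))).
Proof.
  intros Hnu Hmu. unfold gamma_arg_seq.
  rewrite (euler_arg_S (S n) nu), (euler_arg_S (S n) mu).
  assert (Hn := INR_S_pos n). assert (Hl := ln_step_defect n).
  assert (H1 : 1 <= INR (S n)) by (apply (le_INR 1); lia).
  rewrite (S_INR (S n)) in *. set (t := INR (S n)) in *.
  replace (nu * ln (t + 1) - (euler_arg (S n) nu + atan (nu / (t + 1))) -
    (nu * ln t - euler_arg (S n) nu) -
    (mu * ln (t + 1) - (euler_arg (S n) mu + atan (mu / (t + 1))) -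
     (mu * ln t - euler_arg (S n) mu)))
   with ((nu - mu) * (ln (t + 1) - ln t - / (t + 1))
     + ((nu / (t + 1) - atan (nu / (t + 1))) - (mu / (t + 1) - atan (mu / (t + 1)))))
   by (field; lra).
  eapply Rle_trans; [apply Rabs_triang|].
  rewrite Rabs_mult.
  assert (Hw : forall w, Rabs w <= V -> Rabs (w / (t + 1)) <= V / (t + 1)).
  { intros w Hw. unfold Rdiv. rewrite Rabs_mult, (Rabs_pos_eq (/ (t + 1))).
    apply Rmult_le_compat_r; trivial. left; apply Rinv_0_lt_compat; lra.
    left; apply Rinv_0_lt_compat; lra. }
  assert (H2 := atan_defect_lipschitz (V / (t + 1)) (mu / (t + 1)) (nu / (t + 1))
                 (Hw _ Hmu) (Hw _ Hnu)).
  replace (nu / (t + 1) - mu / (t + 1)) with ((nu - mu) * / (t + 1)) in H2 by (field; lra).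
  rewrite Rabs_mult, (Rabs_pos_eq (/ (t + 1))) in H2 by (left; apply Rinv_0_lt_compat; lra).
  assert (H3 := Rabs_pos (nu - mu)). set (D := Rabs (nu - mu)) in *.
  assert (H4 : D * Rabs (ln (t + 1) - ln t - / (t + 1)) <= D * (/ t - / (t + 1)))
    by (apply Rmult_le_compat_l; trivial).
  assert (H5 : (V / (t + 1)) ^ 2 * (D * / (t + 1)) <= V ^ 2 * D * (/ t - / (t + 1))).
  { replace ((V / (t + 1)) ^ 2 * (D * / (t + 1))) with (V ^ 2 * D * / (t + 1) ^ 3)
      by (field; lra).
    apply Rmult_le_compat_l. apply Rmult_le_pos; trivial; apply pow2_ge_0.
    replace (/ t - / (t + 1)) with (/ (t * (t + 1))) by (field; lra).
    apply Rinv_le_contravar; nra. }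
  lra.
Qed.

Lemma gamma_arg_seq_diff (V nu mu : R) (n p : nat) :
  Rabs nu <= V -> Rabs mu <= V ->
  Rabs ((gamma_arg_seq (n + p) nu - gamma_arg_seq n nu)
        - (gamma_arg_seq (n + p) mu - gamma_arg_seq n mu))
  <= (1 + V ^ 2) * Rabs (nu - mu) * (/ INR (S n) - / INR (S (n + p))).
Proof.
  intros Hnu Hmu. induction p as [|p IH].
  - rewrite Nat.add_0_r. replace (_ - _ - _) with 0 by ring. rewrite Rabs_R0; lra.
  - rewrite Nat.add_succ_r.
    assert (H := gamma_arg_seq_step V nu mu (n + p) Hnu Hmu).
    eapply Rle_trans; [|eapply Rle_trans; [apply (Rplus_le_compat _ _ _ _ IH H)|]].
    + eapply Rle_trans; [|apply Rabs_triang]. right. f_equal. ring.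
    + right; ring.
Qed.

Lemma euler_arg_0 (k : nat) : euler_arg k 0 = 0.
Proof.
  induction k as [|k IH]; [easy|]. rewrite !euler_arg_S, IH.
  replace (0 / _) with 0 by (unfold Rdiv; ring). rewrite atan_0; ring.
Qed.

Lemma euler_arg_opp (k : nat) (nu : R) : euler_arg k (- nu) = - euler_arg k nu.
Proof.
  induction k as [|k IH]; [simpl; ring|]. rewrite !euler_arg_S, IH.
  unfold Rdiv. rewrite Ropp_mult_distr_l_reverse, atan_opp. ring.
Qed.

Lemma euler_mod_opp (k : nat) (nu : R) : euler_mod k (- nu) = euler_mod k nu.
Proof.
  induction k as [|k IH]; [easy|]. rewrite !euler_mod_S, IH.
  unfold Rdiv. rewrite Ropp_mult_distr_l_reverse, atan_opp, cos_neg. easy.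
Qed.

Lemma gamma_arg_seq_0 (n : nat) : gamma_arg_seq n 0 = 0.
Proof. unfold gamma_arg_seq. rewrite euler_arg_0; ring. Qed.

Lemma gamma_arg_seq_tail (nu : R) (n p : nat) :
  Rabs (gamma_arg_seq (n + p) nu - gamma_arg_seq n nu)
  <= (1 + nu ^ 2) * Rabs nu * (/ INR (S n) - / INR (S (n + p))).
Proof.
  assert (H := gamma_arg_seq_diff (Rabs nu) nu 0 n p (Rle_refl _)).
  rewrite Rabs_R0 in H. specialize (H (Rabs_pos _)).
  rewrite !gamma_arg_seq_0, !Rminus_0_r, pow2_abs in H. exact H.
Qed.

Lemma is_lim_seq_inv_S : is_lim_seq (fun n => / INR (S n)) 0.
Proof.
  apply (is_lim_seq_incr_1 (fun n => / INR n)).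
  replace (Finite 0) with (Rbar_inv p_infty) by easy.
  apply is_lim_seq_inv; [apply is_lim_seq_INR|easy].
Qed.

Lemma is_lim_gamma_arg_seq (nu : R) :
  is_lim_seq (fun n => gamma_arg_seq n nu) (gamma_arg nu).
Proof.
  apply Lim_seq_correct'.
  apply ex_lim_seq_cauchy_corr. intros eps.
  set (C := (1 + nu ^ 2) * Rabs nu).
  assert (HC : 0 <= C)
    by (apply Rmult_le_pos; [generalize (pow2_ge_0 nu); lra|apply Rabs_pos]).
  assert (HL : is_lim_seq (fun n => C * / INR (S n)) (C * 0))
    by (apply (is_lim_seq_scal_l _ C 0), is_lim_seq_inv_S).
  rewrite Rmult_0_r in HL.
  apply is_lim_seq_spec in HL.
  destruct (HL (pos_div_2 eps)) as [N HN].
  exists N. intros n m Hn Hm.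
  assert (K : forall q, (N <= q)%nat ->
              Rabs (gamma_arg_seq q nu - gamma_arg_seq N nu) < eps / 2).
  { intros q Hq. replace q with (N + (q - N))%nat by lia.
    eapply Rle_lt_trans; [apply gamma_arg_seq_tail|].
    specialize (HN N (Nat.le_refl _)). rewrite Rminus_0_r in HN.
    eapply Rle_lt_trans; [|apply (Rle_lt_trans _ _ _ (Rle_abs _) HN)].
    fold C. apply Rmult_le_compat_l; trivial.
    assert (0 < / INR (S (N + (q - N)))) by (apply Rinv_0_lt_compat, INR_S_pos). lra. }
  replace (gamma_arg_seq n nu - gamma_arg_seq m nu) with
    ((gamma_arg_seq n nu - gamma_arg_seq N nu) - (gamma_arg_seq m nu - gamma_arg_seq N nu))
    by ring.
  eapply Rle_lt_trans; [apply Rabs_triang|]. rewrite Rabs_Ropp.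
  generalize (K n Hn) (K m Hm). lra.
Qed.

Lemma gamma_arg_tail (nu : R) (n : nat) :
  Rabs (gamma_arg nu - gamma_arg_seq n nu) <= (1 + nu ^ 2) * Rabs nu * / INR (S n).
Proof.
  apply (is_lim_seq_le (fun p => Rabs (gamma_arg_seq (p + n) nu - gamma_arg_seq n nu))
           (fun _ => (1 + nu ^ 2) * Rabs nu * / INR (S n))
           (Rabs (gamma_arg nu - gamma_arg_seq n nu)) (Finite ((1 + nu ^ 2) * Rabs nu * / INR (S n)))).
  - intros p. rewrite Nat.add_comm. eapply Rle_trans; [apply gamma_arg_seq_tail|].
    apply Rmult_le_compat_l.
    + apply Rmult_le_pos; [generalize (pow2_ge_0 nu); lra|apply Rabs_pos].
    + assert (0 < / INR (S (n + p))) by (apply Rinv_0_lt_compat, INR_S_pos). lra.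
  - apply (is_lim_seq_abs _ (gamma_arg nu - gamma_arg_seq n nu)).
    apply (is_lim_seq_minus' _ (fun _ => gamma_arg_seq n nu) (gamma_arg nu) (gamma_arg_seq n nu)).
    + apply (is_lim_seq_incr_n (fun p => gamma_arg_seq p nu)), is_lim_gamma_arg_seq.
    + apply is_lim_seq_const.
  - apply is_lim_seq_const.
Qed.

Lemma gamma_arg_lipschitz (V nu mu : R) :
  Rabs nu <= V -> Rabs mu <= V ->
  Rabs (gamma_arg nu - gamma_arg mu) <= (2 + V ^ 2) * Rabs (nu - mu).
Proof.
  intros Hnu Hmu.
  apply (is_lim_seq_le (fun p => Rabs (gamma_arg_seq p nu - gamma_arg_seq p mu))
           (fun _ => (2 + V ^ 2) * Rabs (nu - mu))
           (Rabs (gamma_arg nu - gamma_arg mu)) (Finite ((2 + V ^ 2) * Rabs (nu - mu)))).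
  - intros p.
    assert (H := gamma_arg_seq_diff V nu mu 0 p Hnu Hmu). simpl plus in H.
    assert (H0 : Rabs (gamma_arg_seq 0 nu - gamma_arg_seq 0 mu) <= Rabs (nu - mu)).
    { unfold gamma_arg_seq, euler_arg. simpl INR. rewrite ln_1, !Rdiv_1_r.
      replace (_ - _ - _) with (- (atan nu - atan mu)) by ring.
      rewrite Rabs_Ropp. apply atan_lipschitz. }
    replace (gamma_arg_seq p nu - gamma_arg_seq p mu) with
      (gamma_arg_seq p nu - gamma_arg_seq 0 nu - (gamma_arg_seq p mu - gamma_arg_seq 0 mu)
       + (gamma_arg_seq 0 nu - gamma_arg_seq 0 mu)) by ring.
    eapply Rle_trans; [apply Rabs_triang|].
    assert (/ INR 1 - / INR (S p) <= 1).
    { assert (0 < / INR (S p)) by (apply Rinv_0_lt_compat, INR_S_pos).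
      simpl (INR 1). rewrite Rinv_1. lra. }
    assert (H2 : (1 + V ^ 2) * Rabs (nu - mu) * (/ INR 1 - / INR (S p))
             <= (1 + V ^ 2) * Rabs (nu - mu) * 1).
    { apply Rmult_le_compat_l; trivial.
      apply Rmult_le_pos; [generalize (pow2_ge_0 V); lra|apply Rabs_pos]. }
    change (0 + p)%nat with p in H. lra.
  - apply (is_lim_seq_abs _ (gamma_arg nu - gamma_arg mu)).
    apply (is_lim_seq_minus' _ _ (gamma_arg nu) (gamma_arg mu)); apply is_lim_gamma_arg_seq.
  - apply is_lim_seq_const.
Qed.

Lemma gamma_arg_0 : gamma_arg 0 = 0.
Proof.
  unfold gamma_arg.
  rewrite (Lim_seq_ext _ (fun _ => 0)) by (intros; apply gamma_arg_seq_0).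
  now rewrite Lim_seq_const.
Qed.

Lemma cos_atan_pos (x : R) : 0 < cos (atan x).
Proof. destruct (atan_bound x). apply cos_gt_0; lra. Qed.

Lemma euler_mod_pos (k : nat) (nu : R) : 0 < euler_mod k nu.
Proof.
  induction k as [|k IH]; [simpl; lra|]. rewrite euler_mod_S.
  apply Rmult_lt_0_compat; trivial; apply cos_atan_pos.
Qed.

Lemma euler_mod_le_1 (k : nat) (nu : R) : euler_mod k nu <= 1.
Proof.
  induction k as [|k IH]; [simpl; lra|]. rewrite euler_mod_S.
  rewrite <- (Rmult_1_r 1). apply Rmult_le_compat; trivial.
  left; apply euler_mod_pos. left; apply cos_atan_pos. apply COS_bound.
Qed.

Lemma cos_atan_ge_exp (x : R) : exp (- (x ^ 2)) <= cos (atan x).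
Proof.
  rewrite cos_atan. unfold Rdiv; rewrite Rmult_1_l, exp_Ropp.
  assert (0 <= x²) by apply Rle_0_sqr.
  apply Rinv_le_contravar; [apply sqrt_lt_R0; lra|].
  apply Rle_trans with (1 + x²).
  - rewrite <- (sqrt_square (1 + x²)) at 2 by lra. apply sqrt_le_1_alt. nra.
  - replace (x ^ 2) with (x²) by (unfold Rsqr; ring). apply exp_ineq1_le.
Qed.

(** Each factor is at least exp (- nu^2 / j^2), and the sum of the 1/j^2 is at most 2. *)
Lemma euler_mod_lower (k : nat) (nu : R) : exp (- (2 * nu ^ 2)) <= euler_mod k nu.
Proof.
  assert (H : exp (- (nu ^ 2 * (2 * (1 - / INR (S k))))) <= euler_mod k nu).
  { induction k as [|k IH].
    - simpl INR. rewrite Rinv_1. change (euler_mod 0 nu) with 1. rewrite <- exp_0. apply exp_mono. lra.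
    - rewrite euler_mod_S.
      eapply Rle_trans; [|apply Rmult_le_compat;
        [left; apply exp_pos|left; apply exp_pos|apply IH|apply cos_atan_ge_exp]].
      rewrite <- exp_plus. apply exp_mono.
      assert (Hk := INR_S_pos k). assert (1 <= INR (S k)) by (apply (le_INR 1); lia).
      rewrite (S_INR (S k)). set (t := INR (S k)) in *.
      replace ((nu / t) ^ 2) with (nu ^ 2 * (/ t ^ 2)) by (field; lra).
      assert (0 <= 2 * (/ t - / (t + 1)) - / t ^ 2).
      { replace (2 * (/ t - / (t + 1)) - / t ^ 2) with ((t - 1) / (t ^ 2 * (t + 1)))
          by (field; lra).
        apply Rmult_le_pos; [lra|left; apply Rinv_0_lt_compat; nra]. }
      assert (H2 := Rmult_le_pos _ _ (pow2_ge_0 nu) H0). lra. }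
  eapply Rle_trans; [|exact H].
  apply exp_mono.
  assert (0 < / INR (S k)) by (apply Rinv_0_lt_compat, INR_S_pos).
  generalize (pow2_ge_0 nu). nra.
Qed.

Lemma ex_lim_euler_mod (nu : R) :
  exists r, 0 < r /\ is_lim_seq (fun n => euler_mod n nu) r.
Proof.
  destruct (ex_finite_lim_seq_decr (fun n => euler_mod n nu) (exp (- (2 * nu ^ 2)))) as [r Hr].
  - intros n. rewrite euler_mod_S. rewrite <- (Rmult_1_r (euler_mod n nu)) at 2.
    apply Rmult_le_compat_l. left; apply euler_mod_pos. apply COS_bound.
  - intros n; apply euler_mod_lower.
  - exists r; split; trivial.
    apply Rlt_le_trans with (exp (- (2 * nu ^ 2))); [apply exp_pos|].
    apply (is_lim_seq_le (fun _ => exp (- (2 * nu ^ 2))) (fun n => euler_mod n nu)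
             (exp (- (2 * nu ^ 2))) r); trivial.
    + intros n; apply euler_mod_lower.
    + apply is_lim_seq_const.
Qed.

Lemma euler_arg_lipschitz (k : nat) (nu mu : R) :
  Rabs (euler_arg k nu - euler_arg k mu) <= INR k * Rabs (nu - mu).
Proof.
  induction k as [|k IH].
  - simpl. rewrite Rminus_0_r, Rabs_R0; lra.
  - rewrite !euler_arg_S.
    replace (_ - _) with ((euler_arg k nu - euler_arg k mu)
      + (atan (nu / INR (S k)) - atan (mu / INR (S k)))) by ring.
    eapply Rle_trans; [apply Rabs_triang|].
    assert (H := atan_lipschitz (mu / INR (S k)) (nu / INR (S k))).
    replace (nu / INR (S k) - mu / INR (S k)) with ((nu - mu) * / INR (S k)) in H
      by (field; generalize (INR_S_pos k); lra).
    rewrite Rabs_mult, (Rabs_pos_eq (/ _)) in H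
      by (left; apply Rinv_0_lt_compat, INR_S_pos).
    assert (H1 : Rabs (nu - mu) * / INR (S k) <= Rabs (nu - mu) * 1).
    { apply Rmult_le_compat_l; [apply Rabs_pos|]. rewrite <- Rinv_1.
      apply Rinv_le_contravar; [lra|apply (le_INR 1); lia]. }
    rewrite (S_INR k) at 3. lra.
Qed.

Lemma euler_mod_lipschitz (k : nat) (nu mu : R) :
  Rabs (euler_mod k nu - euler_mod k mu) <= INR k * Rabs (nu - mu).
Proof.
  induction k as [|k IH].
  - simpl. rewrite Rminus_diag, Rabs_R0; lra.
  - rewrite !euler_mod_S.
    set (a := nu / INR (S k)). set (b := mu / INR (S k)).
    assert (H : Rabs (cos (atan a) - cos (atan b)) <= Rabs (nu - mu)).
    { eapply Rle_trans; [apply cos_lipschitz|]. eapply Rle_trans; [apply atan_lipschitz|].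
      unfold a, b. replace (nu / INR (S k) - mu / INR (S k)) with ((nu - mu) * / INR (S k))
        by (field; generalize (INR_S_pos k); lra).
      rewrite Rabs_mult, (Rabs_pos_eq (/ _)) by (left; apply Rinv_0_lt_compat, INR_S_pos).
      rewrite <- (Rmult_1_r (Rabs (nu - mu))) at 2.
      apply Rmult_le_compat_l; [apply Rabs_pos|]. rewrite <- Rinv_1.
      apply Rinv_le_contravar; [lra|apply (le_INR 1); lia]. }
    replace (_ - _) with ((euler_mod k nu - euler_mod k mu) * cos (atan a)
      + euler_mod k mu * (cos (atan a) - cos (atan b))) by ring.
    eapply Rle_trans; [apply Rabs_triang|]. rewrite !Rabs_mult.
    rewrite (Rabs_pos_eq (cos _)) by (left; apply cos_atan_pos).
    rewrite (Rabs_pos_eq (euler_mod k mu)) by (left; apply euler_mod_pos).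
    rewrite S_INR, Rmult_plus_distr_r, Rmult_1_l. apply Rplus_le_compat.
    + rewrite <- (Rmult_1_r (INR k * _)).
      apply Rmult_le_compat; trivial. apply Rabs_pos. left; apply cos_atan_pos. apply COS_bound.
    + rewrite <- (Rmult_1_l (Rabs (nu - mu))).
      apply Rmult_le_compat; trivial. left; apply euler_mod_pos. apply Rabs_pos. apply euler_mod_le_1.
Qed.

Lemma euler_mod_0 (k : nat) : euler_mod k 0 = 1.
Proof.
  induction k as [|k IH]; [easy|]. rewrite !euler_mod_S, IH.
  replace (0 / _) with 0 by (unfold Rdiv; ring). rewrite atan_0, cos_0; ring.
Qed.

(** * Elementary inequalities and integrals over the half-line *)

Lemma Rabs_sin_le (x : R) : Rabs (sin x) <= Rabs x.
Proof.
  assert (H := sin_lipschitz 0 x). rewrite sin_0, !Rminus_0_r in H. exact H.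
Qed.

Lemma cos_ge_quadratic (x : R) : 1 - x ^ 2 / 2 <= cos x.
Proof.
  replace x with (2 * (x / 2)) at 2 by field.
  rewrite cos_2a_sin.
  assert (H := Rabs_sin_le (x / 2)).
  assert (H1 : Rabs (sin (x / 2)) ^ 2 <= Rabs (x / 2) ^ 2)
    by (apply pow_incr; split; [apply Rabs_pos|trivial]).
  rewrite !pow2_abs in H1. nra.
Qed.

Lemma exp_sub_exp_opp (v : R) : 0 <= v -> 2 * v <= exp v - exp (- v).
Proof.
  intros Hv.
  destruct (MVT_gen (fun x => exp x - exp (- x) - 2 * x) 0 v
              (fun x => exp x + exp (- x) - 2)) as [c [Hc E]].
  - intros x _. auto_derive; trivial. ring.
  - intros x _. apply derivable_continuous_pt.
    exists (exp x + exp (- x) - 2). apply is_derive_Reals. auto_derive; trivial. ring.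
  - rewrite Ropp_0, exp_0 in E.
    assert (0 <= exp c + exp (- c) - 2).
    { replace (exp c + exp (- c) - 2) with ((exp (c / 2) - exp (- (c / 2))) ^ 2).
      apply pow2_ge_0.
      replace ((exp (c / 2) - exp (- (c / 2))) ^ 2) with
        (exp (c / 2) * exp (c / 2) + exp (- (c / 2)) * exp (- (c / 2))
         - 2 * (exp (c / 2) * exp (- (c / 2)))) by ring.
      rewrite <- !exp_plus. replace (c / 2 + - (c / 2)) with 0 by ring. rewrite exp_0.
      replace (c / 2 + c / 2) with c by field.
      replace (- (c / 2) + - (c / 2)) with (- c) by field. ring. }
    nra.
Qed.

(** With x = e^(2v) this says (2v)^2 <= (e^v - e^-v)^2. It bounds the mean square of a
    logarithm by first moments, without any singularity at 0 to be cut off. *)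
Lemma ln_sq_le (x : R) : 0 < x -> ln x ^ 2 <= x + / x - 2.
Proof.
  intros Hx.
  assert (H : forall v, 0 <= v -> (2 * v) ^ 2 <= exp (2 * v) + exp (- (2 * v)) - 2).
  { intros v Hv. apply Rle_trans with ((exp v - exp (- v)) ^ 2).
    apply pow_incr. split; [lra|now apply exp_sub_exp_opp].
    right. replace (2 * v) with (v + v) by ring. rewrite Ropp_plus_distr, !exp_plus.
    assert (E : exp v * exp (- v) = 1) by (rewrite <- exp_plus, Rplus_opp_r; apply exp_0).
    nra. }
  assert (E : exp (ln x) = x) by now apply exp_ln.
  assert (E' : exp (- ln x) = / x) by (rewrite exp_Ropp, E; trivial).
  destruct (Rle_dec 0 (ln x)) as [Hl|Hl].
  - specialize (H (ln x / 2) ltac:(lra)). replace (2 * (ln x / 2)) with (ln x) in H by field.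
    rewrite E, E' in H. lra.
  - specialize (H (- ln x / 2) ltac:(lra)). replace (2 * (- ln x / 2)) with (- ln x) in H by field.
    rewrite Ropp_involutive, E, E' in H. nra.
Qed.

Lemma Rabs_sin_le_amgm (eta x : R) : 0 < eta -> Rabs (sin x) <= (eta + x ^ 2 / eta) / 2.
Proof.
  intros He. eapply Rle_trans; [apply Rabs_sin_le|].
  assert (H : 0 <= (eta - Rabs x) ^ 2 / eta).
  { apply Rmult_le_pos; [apply pow2_ge_0|left; now apply Rinv_0_lt_compat]. }
  replace ((eta - Rabs x) ^ 2 / eta) with (eta + Rabs x ^ 2 / eta - 2 * Rabs x) in H
    by (field; lra).
  rewrite pow2_abs in H. lra.
Qed.

Definition improper_int (f : R -> R) (l : R) : Prop :=
  is_RInt_gen f (at_right 0) (Rbar_locally p_infty) l.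

Lemma near_zero_infty (P : R * R -> Prop) :
  (forall a b, 0 < a -> a <= b -> P (a, b)) ->
  filter_prod (at_right 0) (Rbar_locally p_infty) P.
Proof.
  intros H. exists (fun a => 0 < a < 1) (fun b => 1 < b).
  - exists (mkposreal 1 Rlt_0_1). intros y Hy Hy0. split; trivial.
    change (Rabs (y - 0) < 1) in Hy.
    apply Rabs_lt_between in Hy. lra.
  - exists 1. easy.
  - intros a b Ha Hb. apply H; lra.
Qed.

Lemma improper_int_ext (f g : R -> R) (l : R) :
  (forall t, 0 < t -> f t = g t) -> improper_int f l -> improper_int g l.
Proof.
  intros H. apply (is_RInt_gen_ext (Fa := at_right 0) (Fb := Rbar_locally p_infty) f g l).
  apply near_zero_infty.
  intros a b Ha Hab t Ht. simpl in Ht. rewrite Rmin_left in Ht by trivial. apply H; lra.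
Qed.

Lemma improper_int_le (f g : R -> R) (lf lg : R) :
  (forall t, 0 < t -> f t <= g t) ->
  improper_int f lf -> improper_int g lg -> lf <= lg.
Proof.
  intros H Hf Hg.
  assert (Hd := is_RInt_gen_minus (V := R_NormedModule) _ _ _ _ Hg Hf).
  assert (K := RInt_gen_norm (V := R_CompleteNormedModule) (Fa := at_right 0)
    (Fb := Rbar_locally p_infty) (fun y => minus (g y) (f y))
    (fun y => minus (g y) (f y)) (minus lg lf) (minus lg lf)).
  enough (Rabs (lg - lf) <= lg - lf) by (generalize (Rabs_pos (lg - lf)); lra).
  refine (K _ _ Hd Hd).
  - apply near_zero_infty; intros a b Ha Hab; exact Hab.
  - apply near_zero_infty; intros a b Ha Hab t Ht; simpl in *.
    change (Rabs (g t - f t) <= g t - f t). rewrite Rabs_pos_eq; [lra|].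
    generalize (H t ltac:(lra)); lra.
Qed.

Lemma improper_int_lin (a b : R) (f g : R -> R) (lf lg : R) :
  improper_int f lf -> improper_int g lg ->
  improper_int (fun t => a * f t + b * g t) (a * lf + b * lg).
Proof.
  intros Hf Hg.
  apply (is_RInt_gen_plus (V := R_NormedModule) (fun t => a * f t) (fun t => b * g t)).
  - apply (is_RInt_gen_scal (V := R_NormedModule) f a lf Hf).
  - apply (is_RInt_gen_scal (V := R_NormedModule) g b lg Hg).
Qed.

Lemma improper_int_derive (f df : R -> R) (la lb : R) :
  (forall t, 0 < t -> is_derive f t (df t)) ->
  (forall t, 0 < t -> continuous df t) ->
  filterlim f (at_right 0) (locally la) ->
  filterlim f (Rbar_locally p_infty) (locally lb) ->
  improper_int df (lb - la).
Proof.
  intros Hd Hc Hla Hlb.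
  apply improper_int_ext with (Derive f).
  { intros t Ht. now apply is_derive_unique, Hd. }
  apply (is_RInt_gen_Derive (Fa := at_right 0) (Fb := Rbar_locally p_infty) f la lb);
    trivial; apply near_zero_infty;
    intros a b Ha Hab t Ht; simpl in Ht; rewrite Rmin_left in Ht by trivial.
  - exists (df t). apply Hd; lra.
  - assert (Ht0 : 0 < t) by lra.
    apply continuous_ext_loc with df; [|now apply Hc].
    exists (mkposreal t Ht0). intros y Hy. symmetry. apply is_derive_unique, Hd.
    change (Rabs (y - t) < t) in Hy.
    apply Rabs_lt_between in Hy. lra.
Qed.

(** Both ends follow from Cauchy's criterion for the antiderivative, since its increments are
    dominated by those of e^-t. *)
Lemma improper_int_ex (f : R -> R) :
  (forall t, 0 < t -> continuous f t) ->
  (forall t, 0 < t -> Rabs (f t) <= exp (- t)) ->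
  exists l, improper_int f l.
Proof.
  intros Hc Hb. set (F := fun b : R => RInt f 1 b : R).
  assert (Hex : forall a b, 0 < a -> 0 < b -> ex_RInt f a b).
  { intros a b Ha Hb'. apply (ex_RInt_continuous (V := R_CompleteNormedModule)).
    intros t Ht. apply Hc. unfold Rmin in Ht; destruct (Rle_dec a b); lra. }
  assert (HF : forall u v, 0 < u -> u <= v -> Rabs (F v - F u) <= exp (- u) - exp (- v)).
  { intros u v Hu Huv. unfold F.
    assert (E : RInt f 1 u + RInt f u v = RInt f 1 v)
      by (apply (RInt_Chasles (V := R_CompleteNormedModule)); apply Hex; lra).
    replace (RInt f 1 v - RInt f 1 u) with (RInt f u v : R) by (rewrite <- E; simpl; lra).
    apply (norm_RInt_le (V := R_NormedModule) f (fun t => exp (- t)) u v); trivial.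
    - intros t Ht. apply Hb; lra.
    - apply (RInt_correct (V := R_CompleteNormedModule)). apply Hex; lra.
    - replace (exp (- u) - exp (- v)) with (- exp (- v) - - exp (- u)) by ring.
      apply (is_RInt_derive (V := R_CompleteNormedModule) (fun t => - exp (- t)) (fun t => exp (- t))).
      + intros t _. auto_derive; trivial; ring.
      + intros t _. apply (ex_derive_continuous (V := R_NormedModule)). auto_derive; trivial. }
  assert (Hsym : forall (D : R) u v, 0 < u -> 0 < v ->
     Rabs (exp (- u) - exp (- v)) < D -> Rabs (F v - F u) < D).
  { intros D u v Hu Hv H. destruct (Rle_dec u v) as [Huv|Huv].
    - eapply Rle_lt_trans; [now apply HF|]. eapply Rle_lt_trans; [apply Rle_abs|trivial].
    - rewrite Rabs_minus_sym in H |- *.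
      eapply Rle_lt_trans; [apply HF; lra|]. eapply Rle_lt_trans; [apply Rle_abs|trivial]. }
  assert (H0 : exists l, filterlim F (at_right 0) (locally l)).
  { apply (filterlim_locally_cauchy (U := R_CompleteSpace) F). intros eps.
    exists (fun u => 0 < u /\ Rabs (exp (- u) - 1) < eps / 2). split.
    - assert (Hcont : continuous (fun u => exp (- u)) 0)
        by (apply (ex_derive_continuous (V := R_NormedModule)); auto_derive; trivial).
      assert (Hl := proj1 (filterlim_locally _ _) Hcont (pos_div_2 eps)).
      destruct Hl as [d Hd]. exists d. intros y Hy Hy0. split; trivial.
      specialize (Hd y Hy). rewrite Ropp_0, exp_0 in Hd. exact Hd.
    - intros u v [Hu Hu'] [Hv Hv']. apply Hsym; trivial.
      replace (_ - _) with ((exp (- u) - 1) - (exp (- v) - 1)) by ring.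
      eapply Rle_lt_trans; [apply Rabs_triang|]. rewrite Rabs_Ropp. lra. }
  assert (H1 : exists l, filterlim F (Rbar_locally p_infty) (locally l)).
  { apply (filterlim_locally_cauchy (U := R_CompleteSpace) F). intros eps.
    exists (fun u => 0 < u /\ exp (- u) < eps). split.
    - exists (Rmax 0 (- ln eps)). intros u Hu.
      assert (Hu0 := Rle_lt_trans _ _ _ (Rmax_l _ _) Hu).
      assert (Hu1 := Rle_lt_trans _ _ _ (Rmax_r _ _) Hu). split; trivial.
      rewrite <- (exp_ln eps) by apply cond_pos. apply exp_increasing; lra.
    - intros u v [Hu Hu'] [Hv Hv']. apply Hsym; trivial.
      assert (A := exp_pos (- u)). assert (B := exp_pos (- v)).
      apply Rabs_lt_between; lra. }
  destruct H0 as [l0 H0], H1 as [l1 H1]. exists (l1 - l0).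
  apply improper_int_derive with F; trivial.
  intros t Ht. apply (is_derive_RInt (V := R_NormedModule) f F 1 t).
  - exists (mkposreal t Ht). intros y Hy.
    apply (RInt_correct (V := R_CompleteNormedModule)), Hex; [lra|].
    change (Rabs (y - t) < t) in Hy.
    apply Rabs_lt_between in Hy. lra.
  - now apply Hc.
Qed.

Lemma exp_pow_nat (x : R) (n : nat) : exp x ^ n = exp (INR n * x).
Proof.
  induction n as [|n IH].
  - simpl. now rewrite Rmult_0_l, exp_0.
  - simpl pow. rewrite IH, <- exp_plus, S_INR. f_equal. ring.
Qed.

(** Because e^t = (e^(t/(n+1)))^(n+1) >= (t/(n+1))^(n+1). *)
Lemma pow_exp_le (n : nat) (t : R) : 0 < t -> t ^ n * exp (- t) <= INR (S n) ^ S n / t.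
Proof.
  intros Ht.
  assert (E : exp t = exp (t / INR (S n)) ^ S n).
  { rewrite exp_pow_nat. f_equal. field. apply not_0_INR; lia. }
  assert (H : (t / INR (S n)) ^ S n <= exp t).
  { rewrite E. apply pow_incr. split.
    - apply Rmult_le_pos; [lra|left; apply Rinv_0_lt_compat, INR_S_pos].
    - generalize (exp_ineq1_le (t / INR (S n))). lra. }
  assert (Hp : 0 < INR (S n) ^ S n) by (apply pow_lt, INR_S_pos).
  rewrite exp_Ropp. unfold Rdiv in H. rewrite Rpow_mult_distr, pow_inv in H.
  assert (He := exp_pos t).
  apply Rmult_le_reg_r with (t * exp t * / INR (S n) ^ S n).
  { apply Rmult_lt_0_compat; [apply Rmult_lt_0_compat; lra|now apply Rinv_0_lt_compat]. }
  replace (t ^ n * / exp t * (t * exp t * / INR (S n) ^ S n))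
    with (t ^ S n * / INR (S n) ^ S n) by (simpl (t ^ S n); field; split; lra).
  replace (INR (S n) ^ S n / t * (t * exp t * / INR (S n) ^ S n)) with (exp t)
    by (field; split; lra).
  exact H.
Qed.

Lemma boundary_terms (n : nat) (phi : R -> R) :
  (forall t, Rabs (phi t) <= 1) ->
  filterlim (fun t => t ^ S n * phi t * exp (- t)) (at_right 0) (locally 0)
  /\ filterlim (fun t => t ^ S n * phi t * exp (- t)) (Rbar_locally p_infty) (locally 0).
Proof.
  intros Hphi.
  assert (Hb : forall t, 0 < t -> Rabs (t ^ S n * phi t * exp (- t)) <= t ^ S n * exp (- t)).
  { intros t Ht. rewrite !Rabs_mult, (Rabs_pos_eq (exp _)) by (left; apply exp_pos).
    apply Rmult_le_compat_r; [left; apply exp_pos|].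
    rewrite Rabs_pos_eq by (apply pow_le; lra).
    rewrite <- (Rmult_1_r (t ^ S n)) at 2. apply Rmult_le_compat_l; [apply pow_le; lra|trivial]. }
  split; apply filterlim_locally; intros eps.
  - assert (H : 0 < Rmin 1 eps) by (apply Rmin_pos; [lra|apply cond_pos]).
    exists (mkposreal _ H). intros t Ht Ht0.
    change (Rabs (t - 0) < Rmin 1 eps) in Ht.
    change (Rabs (t ^ S n * phi t * exp (- t) - 0) < eps).
    rewrite Rminus_0_r in *.
    rewrite Rabs_pos_eq in Ht by lra.
    assert (t < 1) by (eapply Rlt_le_trans; [apply Ht|apply Rmin_l]).
    assert (t < eps) by (eapply Rlt_le_trans; [apply Ht|apply Rmin_r]).
    eapply Rle_lt_trans; [apply (Hb t Ht0)|].
    assert (t ^ n <= 1) by (rewrite <- (pow1 n); apply pow_incr; lra).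
    assert (0 <= t ^ n) by (apply pow_le; lra).
    assert (exp (- t) <= 1) by (rewrite <- exp_0; apply exp_mono; lra).
    assert (0 < exp (- t)) by apply exp_pos.
    simpl. assert (t ^ n * exp (- t) <= 1) by nra. nra.
  - exists (INR (S (S n)) ^ S (S n) / eps). intros t Ht.
    assert (Hp : 0 < INR (S (S n)) ^ S (S n)) by (apply pow_lt, INR_S_pos).
    assert (He := cond_pos eps).
    assert (Ht0 : 0 < t).
    { eapply Rlt_trans; [|apply Ht]. now apply Rdiv_lt_0_compat. }
    change (Rabs (t ^ S n * phi t * exp (- t) - 0) < eps). rewrite Rminus_0_r.
    eapply Rle_lt_trans; [apply (Hb t Ht0)|].
    eapply Rle_lt_trans; [apply (pow_exp_le (S n) t Ht0)|].
    apply Rmult_lt_reg_r with (t / eps); [now apply Rdiv_lt_0_compat|].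
    replace (INR (S (S n)) ^ S (S n) / t * (t / eps)) with (INR (S (S n)) ^ S (S n) / eps)
      by (field; lra).
    replace (eps * (t / eps)) with t by (field; lra). exact Ht.
Qed.

(** * Gamma(1 + i nu) in polar form *)

Definition gamma_re (k : nat) (nu t : R) : R := t ^ k * cos (nu * ln t) * exp (- t).
Definition gamma_im (k : nat) (nu t : R) : R := t ^ k * sin (nu * ln t) * exp (- t).

(** Integrate the derivative of t^(k+1) phi(t) e^-t, whose boundary values vanish. *)
Lemma gamma_by_parts (phi psi : R -> R) (k : nat) (X Y : R) :
  (forall t, Rabs (phi t) <= 1) ->
  (forall t, 0 < t -> is_derive phi t (psi t / t)) ->
  (forall t, 0 < t -> continuous psi t) ->
  improper_int (fun t => t ^ k * phi t * exp (- t)) X ->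
  improper_int (fun t => t ^ k * psi t * exp (- t)) Y ->
  improper_int (fun t => t ^ S k * phi t * exp (- t)) ((INR k + 1) * X + Y).
Proof.
  intros Hb Hphi Hpsi HX HY.
  assert (Hlin := improper_int_lin (INR k + 1) 1 _ _ _ _ HX HY).
  destruct (boundary_terms k phi Hb) as [B0 B1].
  assert (HD : improper_int (fun t => (INR k + 1) * (t ^ k * phi t * exp (- t))
      + 1 * (t ^ k * psi t * exp (- t)) - t ^ S k * phi t * exp (- t)) (0 - 0)).
  { apply improper_int_derive with (fun t => t ^ S k * phi t * exp (- t)); trivial.
    - intros t Ht. specialize (Hphi t Ht). auto_derive; [eexists; exact Hphi|].
      replace (Derive (fun y => phi y) t) with (psi t / t)
        by (symmetry; now apply is_derive_unique).
      change (match k with O => 1 | S _ => INR k + 1 end) with (INR (S k)).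
      rewrite S_INR. simpl pow. field. lra.
    - intros t Ht. specialize (Hpsi t Ht).
      assert (Hp : forall j, continuous (fun y => y ^ j * exp (- y)) t)
        by (intros j; apply (ex_derive_continuous (V := R_NormedModule)); auto_derive; trivial).
      assert (Hc : continuous phi t)
        by (apply (ex_derive_continuous (V := R_NormedModule)); eexists; now apply Hphi).
      assert (E : forall y, (y ^ k * exp (- y)) * ((INR k + 1) * phi y + psi y)
         - (y ^ S k * exp (- y)) * phi y = (INR k + 1) * (y ^ k * phi y * exp (- y))
      + 1 * (y ^ k * psi y * exp (- y)) - y ^ S k * phi y * exp (- y)) by (intros y; ring).
      apply (continuous_ext _ _ t E).
      apply (continuous_minus (V := R_NormedModule)); apply (continuous_mult (K := R_AbsRing)); trivial.
      apply (continuous_plus (V := R_NormedModule)); trivial.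
      apply (continuous_mult (K := R_AbsRing)); trivial. apply continuous_const. }
  assert (H := improper_int_lin 1 (-1) _ _ _ _ Hlin HD).
  replace ((INR k + 1) * X + Y) with (1 * ((INR k + 1) * X + 1 * Y) + -1 * (0 - 0)) by ring.
  revert H. apply improper_int_ext. intros t _. ring.
Qed.

Lemma gamma_step (nu X Y : R) (k : nat) :
  improper_int (gamma_re k nu) X -> improper_int (gamma_im k nu) Y ->
  improper_int (gamma_re (S k) nu) ((INR k + 1) * X - nu * Y) /\
  improper_int (gamma_im (S k) nu) ((INR k + 1) * Y + nu * X).
Proof.
  intros HX HY.
  assert (Hc : forall trig : R -> R, (forall y, ex_derive trig y) ->
     forall t, 0 < t -> continuous (fun t => trig (nu * ln t)) t).
  { intros trig Htrig t Ht. apply (ex_derive_continuous (V := R_NormedModule)).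
    auto_derive. repeat split; trivial. }
  split.
  - unfold Rminus. apply gamma_by_parts with (psi := fun t => - nu * sin (nu * ln t)); trivial.
    + intros t; apply Rabs_le, COS_bound.
    + intros t Ht. auto_derive; trivial. field. lra.
    + intros t Ht. apply (continuous_mult (K := R_AbsRing)); [apply continuous_const|].
      apply Hc; trivial. intros y; auto_derive; trivial.
    + assert (H := improper_int_lin (- nu) 0 _ _ _ _ HY HY).
      replace (- (nu * Y)) with (- nu * Y + 0 * Y) by ring.
      revert H. apply improper_int_ext. intros t _. unfold gamma_im. ring.
  - apply gamma_by_parts with (psi := fun t => nu * cos (nu * ln t)); trivial.
    + intros t; apply Rabs_le, SIN_bound.
    + intros t Ht. auto_derive; trivial. field. lra.
    + intros t Ht. apply (continuous_mult (K := R_AbsRing)); [apply continuous_const|].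
      apply Hc; trivial. intros y; auto_derive; trivial.
    + assert (H := improper_int_lin nu 0 _ _ _ _ HX HX).
      replace (nu * X) with (nu * X + 0 * X) by ring.
      revert H. apply improper_int_ext. intros t _. unfold gamma_re. ring.
Qed.

(** The product (1 + i nu) ... (k + i nu) in polar form. *)
Definition rising_re (k : nat) (nu : R) : R :=
  INR (fact k) / euler_mod k nu * cos (euler_arg k nu).
Definition rising_im (k : nat) (nu : R) : R :=
  INR (fact k) / euler_mod k nu * sin (euler_arg k nu).

Lemma sin_atan_eq (x : R) : sin (atan x) = x * cos (atan x).
Proof.
  assert (H := cos_atan_pos x).
  assert (E := tan_atan x). unfold tan in E.
  rewrite <- E at 2. field. lra.
Qed.

Lemma rising_step (k : nat) (nu : R) :
  rising_re (S k) nu = (INR k + 1) * rising_re k nu - nu * rising_im k nu /\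
  rising_im (S k) nu = (INR k + 1) * rising_im k nu + nu * rising_re k nu.
Proof.
  unfold rising_re, rising_im. rewrite euler_mod_S, euler_arg_S.
  assert (Hk := INR_S_pos k).
  set (a := atan (nu / INR (S k))).
  assert (Ha : 0 < cos a) by apply cos_atan_pos.
  assert (Es : sin a = nu / INR (S k) * cos a) by apply sin_atan_eq.
  assert (Hm := euler_mod_pos k nu).
  rewrite cos_plus, sin_plus, Es.
  replace (fact (S k)) with (S k * fact k)%nat by reflexivity.
  rewrite mult_INR, <- S_INR. split; field; lra.
Qed.

Lemma gamma_moments (nu C0 S0 : R) (k : nat) :
  improper_int (gamma_re 0 nu) C0 -> improper_int (gamma_im 0 nu) S0 ->
  improper_int (gamma_re k nu) (rising_re k nu * C0 - rising_im k nu * S0) /\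
  improper_int (gamma_im k nu) (rising_re k nu * S0 + rising_im k nu * C0).
Proof.
  intros HC HS. induction k as [|k [IH1 IH2]].
  - unfold rising_re, rising_im. simpl. rewrite cos_0, sin_0.
    replace (1 / 1 * 1 * C0 - 1 / 1 * 0 * S0) with C0 by field.
    replace (1 / 1 * 1 * S0 + 1 / 1 * 0 * C0) with S0 by field. split; trivial.
  - destruct (gamma_step _ _ _ _ IH1 IH2) as [H1 H2].
    destruct (rising_step k nu) as [E1 E2]. rewrite E1, E2. split.
    + replace (_ - _) with ((INR k + 1) * (rising_re k nu * C0 - rising_im k nu * S0) -
        nu * (rising_re k nu * S0 + rising_im k nu * C0)) by ring. exact H1.
    + replace (_ + _) with ((INR k + 1) * (rising_re k nu * S0 + rising_im k nu * C0) +
        nu * (rising_re k nu * C0 - rising_im k nu * S0)) by ring. exact H2.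
Qed.

Lemma ex_gamma_integrals (nu : R) :
  (exists C0, improper_int (gamma_re 0 nu) C0) /\ (exists S0, improper_int (gamma_im 0 nu) S0).
Proof.
  split; apply improper_int_ex; intros t Ht; unfold gamma_re, gamma_im.
  - apply (ex_derive_continuous (V := R_NormedModule)). auto_derive. repeat split; trivial.
  - simpl. rewrite Rmult_1_l, Rabs_mult, (Rabs_pos_eq (exp _)) by (left; apply exp_pos).
    rewrite <- (Rmult_1_l (exp (- t))) at 2.
    apply Rmult_le_compat_r; [left; apply exp_pos|apply Rabs_le, COS_bound].
  - apply (ex_derive_continuous (V := R_NormedModule)). auto_derive. repeat split; trivial.
  - simpl. rewrite Rmult_1_l, Rabs_mult, (Rabs_pos_eq (exp _)) by (left; apply exp_pos).
    rewrite <- (Rmult_1_l (exp (- t))) at 2.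
    apply Rmult_le_compat_r; [left; apply exp_pos|apply Rabs_le, SIN_bound].
Qed.

Lemma gamma_factorial (k : nat) :
  improper_int (fun t => t ^ k * exp (- t)) (INR (fact k)).
Proof.
  assert (H1 : improper_int (gamma_re 0 0) 1).
  { apply improper_int_ext with (fun t => exp (- t)).
    { intros t _. unfold gamma_re. rewrite Rmult_0_l, cos_0. simpl; ring. }
    replace 1 with (0 - - (1)) by ring.
    apply improper_int_derive with (fun t => - exp (- t)).
    - intros t _. auto_derive; trivial; ring.
    - intros t _. apply (ex_derive_continuous (V := R_NormedModule)). auto_derive; trivial.
    - assert (Hc : continuous (fun t => - exp (- t)) 0)
        by (apply (ex_derive_continuous (V := R_NormedModule)); auto_derive; trivial).
      unfold continuous in Hc. rewrite Ropp_0, exp_0 in Hc.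
      revert Hc. apply filterlim_filter_le_1. intros P [d Hd]. exists d. auto.
    - apply filterlim_locally. intros eps. exists (Rmax 0 (- ln eps)). intros u Hu.
      assert (Hu1 := Rle_lt_trans _ _ _ (Rmax_r _ _) Hu).
      change (Rabs (- exp (- u) - 0) < eps). rewrite Rminus_0_r, Rabs_Ropp, Rabs_pos_eq by (left; apply exp_pos).
      rewrite <- (exp_ln eps) by apply cond_pos. apply exp_increasing; lra. }
  assert (H0 : improper_int (gamma_im 0 0) 0).
  { assert (H := improper_int_lin 0 0 _ _ _ _ H1 H1).
    replace (0 * 1 + 0 * 1) with 0 in H by ring. revert H. apply improper_int_ext.
    intros t _. unfold gamma_im. replace (0 * ln t) with 0 by ring. rewrite sin_0. ring. }
  destruct (gamma_moments 0 1 0 k H1 H0) as [H _].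
  unfold rising_re, rising_im in H.
  rewrite euler_mod_0, euler_arg_0, cos_0, sin_0 in H.
  replace (INR (fact k) / 1 * 1 * 1 - INR (fact k) / 1 * 0 * 0) with (INR (fact k)) in H by field.
  revert H. apply improper_int_ext. intros t _. unfold gamma_re.
  rewrite Rmult_0_l, cos_0. ring.
Qed.

(** Under the probability density t^k e^-t / k! with k >= 1, the mean of t/k + k/t - 2 is 1/k:
    it only involves the Gamma integrals of orders k - 1, k and k + 1. *)
Lemma gamma_log_variance (k : nat) (A B : R) :
  improper_int (fun t => t ^ S k * exp (- t)
      * (A + B * (t / INR (S k) + INR (S k) / t - 2)))
    (INR (fact (S k)) * (A + B / INR (S k))).
Proof.
  assert (H0 := gamma_factorial k). assert (H1 := gamma_factorial (S k)).
  assert (H2 := gamma_factorial (S (S k))).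
  assert (Hk := INR_S_pos k).
  assert (H01 := improper_int_lin (B * INR (S k)) (A - 2 * B) _ _ _ _ H0 H1).
  assert (H := improper_int_lin 1 (B / INR (S k)) _ _ _ _ H01 H2).
  replace (INR (fact (S k)) * (A + B / INR (S k))) with
   (1 * (B * INR (S k) * INR (fact k) + (A - 2 * B) * INR (fact (S k))) +
      B / INR (S k) * INR (fact (S (S k)))).
  - revert H. apply improper_int_ext. intros t Ht. simpl pow. field. lra.
  - replace (fact (S (S k))) with (S (S k) * (S k * fact k))%nat by reflexivity.
    replace (fact (S k)) with (S k * fact k)%nat by reflexivity.
    rewrite !mult_INR, (S_INR (S k)). field. lra.
Qed.

(** By the preceding lemma and ln_sq_le, the mean square of ln t - ln k under the density
    t^k e^-t / k! is at most 1/k, hence t^(i nu) may be replaced by k^(i nu) in the integral. *)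
Lemma gamma_concentration (nu X Y eta : R) (k : nat) :
  0 < eta ->
  improper_int (gamma_re (S k) nu) X -> improper_int (gamma_im (S k) nu) Y ->
  let w := nu * ln (INR (S k)) in
  let f := INR (fact (S k)) in
  f * (1 - nu ^ 2 / 2 / INR (S k)) <= cos w * X + sin w * Y <= f /\
  Rabs (cos w * Y - sin w * X) <= f * ((eta + nu ^ 2 / eta / INR (S k)) / 2).
Proof.
  intros Heta HC HS w f. simpl (S k)%nat in *.
  assert (Hk := INR_S_pos k).
  assert (Hln : forall t, 0 < t ->
     (nu * ln t - w) ^ 2 <= nu ^ 2 * (t / INR (S k) + INR (S k) / t - 2)).
  { intros t Ht. unfold w.
    replace (nu * ln t - nu * ln (INR (S k))) with (nu * ln (t / INR (S k)))
      by (rewrite ln_div by trivial; ring).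
    rewrite Rpow_mult_distr. apply Rmult_le_compat_l; [apply pow2_ge_0|].
    assert (H := ln_sq_le (t / INR (S k)) ltac:(now apply Rdiv_lt_0_compat)).
    replace (/ (t / INR (S k))) with (INR (S k) / t) in H by (field; lra).
    exact H. }
  assert (Hw : forall t, 0 < t -> 0 < t ^ S k * exp (- t)).
  { intros t Ht. apply Rmult_lt_0_compat; [now apply pow_lt|apply exp_pos]. }
  assert (Hc := improper_int_lin (cos w) (sin w) _ _ _ _ HC HS).
  assert (Hs := improper_int_lin (cos w) (- sin w) _ _ _ _ HS HC).
  assert (Ec : forall t, cos w * gamma_re (S k) nu t + sin w * gamma_im (S k) nu t
     = t ^ S k * exp (- t) * cos (nu * ln t - w)).
  { intros t. unfold gamma_re, gamma_im. rewrite cos_minus. ring. }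
  assert (Es : forall t, cos w * gamma_im (S k) nu t + - sin w * gamma_re (S k) nu t
     = t ^ S k * exp (- t) * sin (nu * ln t - w)).
  { intros t. unfold gamma_re, gamma_im. rewrite sin_minus. ring. }
  assert (V := gamma_log_variance k).
  split; [split|].
  - replace (f * _) with (f * (1 + - (nu ^ 2 / 2) / INR (S k))) by (field; lra).
    refine (improper_int_le _ _ _ _ _ (V 1 (- (nu ^ 2 / 2))) Hc).
    intros t Ht. rewrite Ec. apply Rmult_le_compat_l; [left; now apply Hw|].
    generalize (cos_ge_quadratic (nu * ln t - w)) (Hln t Ht). lra.
  - replace f with (f * (1 + 0 / INR (S k))) by (field; lra).
    refine (improper_int_le _ _ _ _ _ Hc (V 1 0)).
    intros t Ht. rewrite Ec. apply Rmult_le_compat_l; [left; now apply Hw|].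
    generalize (COS_bound (nu * ln t - w)). lra.
  - replace (f * _) with (f * (eta / 2 + nu ^ 2 / eta / 2 / INR (S k)))
      by (field; lra).
    assert (Hb : forall t, 0 < t -> Rabs (sin (nu * ln t - w)) <=
       eta / 2 + nu ^ 2 / eta / 2 * (t / INR (S k) + INR (S k) / t - 2)).
    { intros t Ht. eapply Rle_trans; [exact (Rabs_sin_le_amgm eta _ Heta)|].
      assert (H := Hln t Ht).
      assert (H1 := Rmult_le_compat_r (/ eta / 2) _ _
         ltac:(left; apply Rdiv_lt_0_compat; [now apply Rinv_0_lt_compat|lra]) H). lra. }
    apply Rabs_le. split.
    + replace (- (f * _)) with (f * (- (eta / 2) + - (nu ^ 2 / eta / 2) / INR (S k)))
        by (field; lra).
      replace (cos w * Y - sin w * X) with (cos w * Y + - sin w * X) by ring.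
      refine (improper_int_le _ _ _ _ _ (V _ _) Hs).
      intros t Ht. rewrite Es. apply Rmult_le_compat_l; [left; now apply Hw|].
      generalize (proj1 (Rabs_le_between _ _) (Hb t Ht)). lra.
    + replace (cos w * Y - sin w * X) with (cos w * Y + - sin w * X) by ring.
      refine (improper_int_le _ _ _ _ _ Hs (V _ _)).
      intros t Ht. rewrite Es. apply Rmult_le_compat_l; [left; now apply Hw|].
      generalize (proj1 (Rabs_le_between _ _) (Hb t Ht)). lra.
Qed.

Lemma div_mul_cancel (a b : R) : 0 < b -> a / b * b = a.
Proof. intros H. field. lra. Qed.

(** Gamma(k + 1 + i nu) equals (1 + i nu) ... (k + i nu) Gamma(1 + i nu) by parts, and it is
    k! k^(i nu) (1 + o(1)) by concentration. Comparing the two identifies Gamma(1 + i nu) with the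
    limit of Euler's product, which gives its argument and shows that it does not vanish. *)
Lemma gamma_polar (nu : R) :
  exists r, 0 < r /\
    improper_int (gamma_re 0 nu) (r * cos (gamma_arg nu)) /\
    improper_int (gamma_im 0 nu) (r * sin (gamma_arg nu)).
Proof.
  destruct (ex_gamma_integrals nu) as [[C0 HC] [S0 HS]].
  destruct (ex_lim_euler_mod nu) as [r [Hr Hlim]].
  set (w := fun n => nu * ln (INR (S n))).
  set (f := fun n => INR (fact (S n))).
  set (C := fun n => rising_re (S n) nu * C0 - rising_im (S n) nu * S0).
  set (T := fun n => rising_re (S n) nu * S0 + rising_im (S n) nu * C0).
  set (D := fun n => (cos (w n) * C n + sin (w n) * T n) / f n).
  set (E := fun n => (cos (w n) * T n - sin (w n) * C n) / f n).
  assert (Hf : forall n, 0 < f n) by (intros; apply INR_fact_lt_0).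
  assert (Hcon : forall n eta, 0 < eta ->
     1 - nu ^ 2 / 2 * / INR (S n) <= D n <= 1 /\
     Rabs (E n) <= (eta + nu ^ 2 / eta * / INR (S n)) / 2).
  { intros n eta Heta. destruct (gamma_moments nu C0 S0 (S n) HC HS) as [H1 H2].
    assert (Hn := INR_S_pos n). specialize (Hf n).
    destruct (gamma_concentration nu _ _ eta n Heta H1 H2) as [[A1 A2] A3].
    fold (f n) (C n) (T n) (w n) in A1, A2, A3.
    unfold D, E. split; [split|].
    - apply Rmult_le_reg_r with (f n); trivial. rewrite div_mul_cancel by trivial. lra.
    - apply Rmult_le_reg_r with (f n); trivial. rewrite div_mul_cancel by trivial. lra.
    - rewrite Rabs_div, (Rabs_pos_eq (f n)) by lra.
      apply Rmult_le_reg_r with (f n); trivial. rewrite div_mul_cancel by trivial. lra. }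
  assert (HD : is_lim_seq D 1).
  { apply (is_lim_seq_le_le (fun n => 1 - nu ^ 2 / 2 * / INR (S n)) D (fun _ => 1)).
    - intros n. apply (Hcon n 1). lra.
    - replace (Finite 1) with (Finite (1 - nu ^ 2 / 2 * 0)) by (f_equal; ring).
      apply is_lim_seq_minus'. apply is_lim_seq_const.
      apply (is_lim_seq_scal_l _ (nu ^ 2 / 2) 0), is_lim_seq_inv_S.
    - apply is_lim_seq_const. }
  assert (HE : is_lim_seq E 0).
  { apply is_lim_seq_spec. intros eps.
    assert (HL : is_lim_seq (fun n => nu ^ 2 / eps * / INR (S n)) 0).
    { replace (Finite 0) with (Finite (nu ^ 2 / eps * 0)) by (f_equal; ring).
      apply (is_lim_seq_scal_l _ (nu ^ 2 / eps) 0), is_lim_seq_inv_S. }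
    apply is_lim_seq_spec in HL. destruct (HL eps) as [N HN]. exists N. intros n Hn.
    rewrite Rminus_0_r. specialize (HN n Hn). rewrite Rminus_0_r in HN.
    eapply Rle_lt_trans; [apply (Hcon n eps), cond_pos|].
    generalize (Rle_abs (nu ^ 2 / eps * / INR (S n))). lra. }
  assert (Hcos : is_lim_seq (fun n => cos (gamma_arg_seq n nu)) (cos (gamma_arg nu))).
  { apply (is_lim_seq_continuous cos). apply continuity_pt_filterlim, continuous_cos.
    apply is_lim_gamma_arg_seq. }
  assert (Hsin : is_lim_seq (fun n => sin (gamma_arg_seq n nu)) (sin (gamma_arg nu))).
  { apply (is_lim_seq_continuous sin). apply continuity_pt_filterlim, continuous_sin.
    apply is_lim_gamma_arg_seq. }
  apply is_lim_seq_incr_1 in Hlim.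
  assert (Hinv : forall n,
    C0 = euler_mod (S n) nu * (D n * cos (gamma_arg_seq n nu) - E n * sin (gamma_arg_seq n nu)) /\
    S0 = euler_mod (S n) nu * (D n * sin (gamma_arg_seq n nu) + E n * cos (gamma_arg_seq n nu))).
  { intros n. unfold gamma_arg_seq. fold (w n). rewrite cos_minus, sin_minus.
    unfold D, E, C, T, rising_re, rising_im. fold (f n).
    set (a := euler_arg (S n) nu). specialize (Hf n).
    assert (Hm := euler_mod_pos (S n) nu).
    set (m := euler_mod (S n) nu) in *.
    assert (P1 := sin2_cos2 (w n)). assert (P2 := sin2_cos2 a). unfold Rsqr in P1, P2.
    set (cw := cos (w n)) in *. set (sw := sin (w n)) in *.
    set (ca := cos a) in *. set (sa := sin a) in *.
    split.
    - transitivity (C0 * ((sw * sw + cw * cw) * (sa * sa + ca * ca))).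
      rewrite P1, P2; ring. field. lra.
    - transitivity (S0 * ((sw * sw + cw * cw) * (sa * sa + ca * ca))).
      rewrite P1, P2; ring. field. lra. }
  assert (EC : C0 = r * cos (gamma_arg nu)).
  { assert (H1 : is_lim_seq (fun _ => C0) (r * (1 * cos (gamma_arg nu) - 0 * sin (gamma_arg nu)))).
    { apply (is_lim_seq_ext (fun n => euler_mod (S n) nu *
         (D n * cos (gamma_arg_seq n nu) - E n * sin (gamma_arg_seq n nu)))).
      { intros n; symmetry; apply Hinv. }
      apply is_lim_seq_mult'; trivial. apply is_lim_seq_minus'; apply is_lim_seq_mult'; trivial. }
    apply is_lim_seq_unique in H1. rewrite Lim_seq_const in H1. injection H1. lra. }
  assert (ES : S0 = r * sin (gamma_arg nu)).
  { assert (H1 : is_lim_seq (fun _ => S0) (r * (1 * sin (gamma_arg nu) + 0 * cos (gamma_arg nu)))).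
    { apply (is_lim_seq_ext (fun n => euler_mod (S n) nu *
         (D n * sin (gamma_arg_seq n nu) + E n * cos (gamma_arg_seq n nu)))).
      { intros n; symmetry; apply Hinv. }
      apply is_lim_seq_mult'; trivial. apply is_lim_seq_plus'; apply is_lim_seq_mult'; trivial. }
    apply is_lim_seq_unique in H1. rewrite Lim_seq_const in H1. injection H1. lra. }
  exists r. rewrite <- EC, <- ES. auto.
Qed.

(** * Zeros of K in terms of a hypergeometric series *)

Lemma is_RInt_gen_pair {U V : NormedModule R_AbsRing} (f : R -> U) (g : R -> V)
  (Fa Fb : (R -> Prop) -> Prop) (lf : U) (lg : V) :
  Filter Fa -> Filter Fb ->
  is_RInt_gen f Fa Fb lf -> is_RInt_gen g Fa Fb lg ->
  is_RInt_gen (V := prod_NormedModule R_AbsRing U V)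
    (fun t => (f t, g t)) Fa Fb (lf, lg).
Proof.
  intros FFa FFb Hf Hg P [eps HP].
  specialize (Hf (ball lf eps) (locally_ball lf eps)).
  specialize (Hg (ball lg eps) (locally_ball lg eps)).
  unfold filtermapi in *.
  generalize (filter_and _ _ Hf Hg). apply filter_imp.
  intros ab [[y [Hy Hby]] [z [Hz Hbz]]].
  exists (y, z). split.
  - apply (is_RInt_fct_extend_pair (fun t => (f t, g t)) (fst ab) (snd ab) y z); trivial.
  - apply HP. split; trivial.
Qed.

Lemma Cmult_cancel_r (c a b : C) : c <> (0, 0) -> (a * c)%C = (b * c)%C -> a = b.
Proof.
  intros Hc E.
  rewrite <- (Cmult_1_r a), <- (Cmult_1_r b), <- (Cinv_r c) by exact Hc.
  now rewrite !Cmult_assoc, E.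
Qed.

Lemma CGamma_eq (z : C) (k : nat) (nu X Y : R) :
  Re z = 1 + INR k -> Im z = nu ->
  improper_int (gamma_re k nu) X -> improper_int (gamma_im k nu) Y ->
  CGamma z = (X, Y).
Proof.
  intros Hre Him HX HY. unfold CGamma.
  apply (is_RInt_gen_unique (V := C_R_CompleteNormedModule)).
  assert (H := is_RInt_gen_pair (U := R_NormedModule) (V := R_NormedModule)
     _ _ _ _ _ _ _ _ HX HY).
  revert H. apply is_RInt_gen_ext. apply near_zero_infty.
  intros a b Ha Hab t Ht. simpl in Ht. rewrite Rmin_left in Ht by trivial.
  assert (Ht0 : 0 < t) by lra.
  destruct z as [z1 z2]; simpl in Hre, Him. subst.
  unfold gamma_re, gamma_im, Rcpow, Cexp, Cminus, Cplus, Copp, Cmult, RtoC, Re, Im; simpl.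
  replace ((1 + INR k + - (1)) * ln t - (nu + - 0) * 0) with (INR k * ln t) by ring.
  replace ((1 + INR k + - (1)) * 0 + (nu + - 0) * ln t) with (nu * ln t) by ring.
  rewrite <- exp_pow_nat, exp_ln by trivial.
  f_equal; ring.
Qed.

(** The quotient is meaningful because Gamma(1 + i nu) is not 0. *)
Lemma pochhammer_eq (nu : R) (k : nat) :
  pochhammer (1 + (0, nu))%C k = (rising_re k nu, rising_im k nu).
Proof.
  destruct (gamma_polar nu) as [r [Hr [HX HY]]].
  destruct (gamma_moments nu _ _ k HX HY) as [HXk HYk].
  unfold pochhammer.
  rewrite (CGamma_eq (1 + (0, nu))%C 0 nu _ _ ltac:(simpl; ring) ltac:(simpl; ring) HX HY).
  rewrite (CGamma_eq (1 + (0, nu) + RtoC (INR k))%C k nu _ _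
             ltac:(simpl; ring) ltac:(simpl; ring) HXk HYk).
  set (a := rising_re k nu). set (b := rising_im k nu).
  assert (H1 := sin2_cos2 (gamma_arg nu)). unfold Rsqr in H1.
  set (c := cos (gamma_arg nu)) in *. set (s := sin (gamma_arg nu)) in *.
  assert (Hn : (r * c, r * s) <> (0, 0)).
  { intros E. injection E. intros E1 E2.
    assert (s = 0) by nra. assert (c = 0) by nra. nra. }
  apply (Cmult_cancel_r (r * c, r * s)); trivial.
  unfold Cdiv. rewrite <- Cmult_assoc, Cinv_l by exact Hn.
  unfold Cmult, RtoC; simpl. f_equal; ring.
Qed.

(** Real and imaginary part of 1 / (k! (1 + i nu)_k). The power series F with these
    coefficients satisfies I_{i nu}(x) = (x/2)^(i nu) F / Gamma(1 + i nu) at c = x^2/4. *)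
Definition hyp_re (nu : R) (k : nat) : R :=
  euler_mod k nu * cos (euler_arg k nu) / INR (fact k) ^ 2.
Definition hyp_im (nu : R) (k : nat) : R :=
  - (euler_mod k nu * sin (euler_arg k nu) / INR (fact k) ^ 2).

Definition F_re (nu c : R) : R := PSeries (hyp_re nu) c.
Definition F_im (nu c : R) : R := PSeries (hyp_im nu) c.

Lemma hyp_series_eq (nu x : R) :
  CSeries (fun k => RtoC ((x / 2) ^ (2 * k))
                    / (RtoC (INR (fact k)) * pochhammer (1 + (0, nu)) k))%C
  = (F_re nu ((x / 2) ^ 2), F_im nu ((x / 2) ^ 2)).
Proof.
  assert (H : forall k, (RtoC ((x / 2) ^ (2 * k))
                    / (RtoC (INR (fact k)) * pochhammer (1 + (0, nu)) k))%C
     = (hyp_re nu k * ((x / 2) ^ 2) ^ k, hyp_im nu k * ((x / 2) ^ 2) ^ k)).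
  { intros k. rewrite pochhammer_eq, pow_mult. unfold hyp_re, hyp_im, rising_re, rising_im.
    set (y := ((x / 2) ^ 2) ^ k).
    assert (Hm := euler_mod_pos k nu). set (m := euler_mod k nu) in *.
    assert (Hf := INR_fact_lt_0 k). set (f := INR (fact k)) in *.
    assert (H1 := sin2_cos2 (euler_arg k nu)). unfold Rsqr in H1.
    set (c := cos (euler_arg k nu)) in *. set (s := sin (euler_arg k nu)) in *.
    assert (Hn : (RtoC f * ((f / m * c)%R, (f / m * s)%R))%C <> (0, 0)).
    { unfold Cmult, RtoC; simpl. intros E. injection E. intros E1 E2.
      assert (Hp : 0 < f * (f / m))
        by (apply Rmult_lt_0_compat; trivial; now apply Rdiv_lt_0_compat).
      assert (s = 0) by nra. assert (c = 0) by nra. nra. }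
    apply (Cmult_cancel_r (RtoC f * ((f / m * c)%R, (f / m * s)%R))%C); trivial.
    unfold Cdiv. rewrite <- Cmult_assoc, Cinv_l by exact Hn.
    unfold Cmult, RtoC; simpl. f_equal.
    - transitivity (y * (s * s + c * c)). rewrite H1; ring. field. lra.
    - field. lra. }
  unfold CSeries, F_re, F_im, PSeries.
  f_equal; apply Series_ext; intros k; rewrite H; reflexivity.
Qed.

Lemma BesselI_polar (nu x r g : R) :
  0 < x -> 0 < r ->
  improper_int (gamma_re 0 nu) (r * cos g) -> improper_int (gamma_im 0 nu) (r * sin g) ->
  let c := (x / 2) ^ 2 in
  let phi := nu * ln (x / 2) - g in
  BesselI (0, nu) x
  = ((F_re nu c * cos phi - F_im nu c * sin phi) / r,
     (F_re nu c * sin phi + F_im nu c * cos phi) / r).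
Proof.
  intros Hx Hr HX HY c phi. unfold BesselI.
  rewrite hyp_series_eq.
  rewrite (CGamma_eq (1 + (0, nu))%C 0 nu _ _ ltac:(simpl; ring) ltac:(simpl; ring) HX HY).
  fold c. set (P := F_re nu c). set (Q := F_im nu c).
  unfold phi. rewrite cos_minus, sin_minus.
  unfold Rcpow, Cexp.
  set (t := ln (x / 2)).
  replace (Re ((0, nu) * RtoC t)%C) with 0 by (unfold Cmult, RtoC; simpl; ring).
  replace (Im ((0, nu) * RtoC t)%C) with (nu * t) by (unfold Cmult, RtoC; simpl; ring).
  rewrite exp_0.
  assert (H1 := sin2_cos2 g). unfold Rsqr in H1.
  set (cg := cos g) in *. set (sg := sin g) in *.
  set (a := cos (nu * t)). set (b := sin (nu * t)).
  assert (Hn : (r * cg, r * sg) <> (0, 0)).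
  { intros E. injection E. intros E1 E2.
    assert (sg = 0) by nra. assert (cg = 0) by nra. nra. }
  apply (Cmult_cancel_r (r * cg, r * sg)); trivial.
  unfold Cdiv. rewrite (Cmult_comm (_ * _) (P, Q)), <- !Cmult_assoc, Cinv_l by exact Hn.
  unfold Cmult, RtoC; simpl. f_equal.
  - transitivity ((P * a - Q * b) * (sg * sg + cg * cg)). rewrite H1; ring. field. lra.
  - transitivity ((P * b + Q * a) * (sg * sg + cg * cg)). rewrite H1; ring. field. lra.
Qed.

Lemma F_re_opp (nu c : R) : F_re (- nu) c = F_re nu c.
Proof.
  apply PSeries_ext. intros k. unfold hyp_re.
  rewrite euler_mod_opp, euler_arg_opp, cos_neg. reflexivity.
Qed.

Lemma F_im_opp (nu c : R) : F_im (- nu) c = - F_im nu c.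
Proof.
  unfold F_im. rewrite <- PSeries_opp. apply PSeries_ext. intros k. unfold hyp_im, PS_opp.
  rewrite euler_mod_opp, euler_arg_opp, sin_neg. change opp with Ropp. simpl.
  unfold Rdiv. ring.
Qed.

(** I_{-i nu}(x) is the complex conjugate of I_{i nu}(x), so that K is a nonzero real multiple
    of the imaginary part of I_{i nu}(x). *)
Lemma BesselKi_zero_iff (nu x : R) :
  0 < x -> 0 < nu ->
  let c := (x / 2) ^ 2 in
  let phi := nu * ln (x / 2) - gamma_arg nu in
  BesselKi nu x = RtoC 0 <-> F_re nu c * sin phi + F_im nu c * cos phi = 0.
Proof.
  intros Hx Hnu c phi.
  destruct (gamma_polar nu) as [r [Hr [HX HY]]].
  assert (HX' : improper_int (gamma_re 0 (- nu)) (r * cos (- gamma_arg nu))).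
  { rewrite cos_neg. revert HX. apply improper_int_ext. intros t _. unfold gamma_re.
    rewrite <- (cos_neg (nu * ln t)). do 2 f_equal. f_equal. ring. }
  assert (HY' : improper_int (gamma_im 0 (- nu)) (r * sin (- gamma_arg nu))).
  { rewrite sin_neg. apply improper_int_ext with (fun t => 0 * gamma_im 0 nu t + (-1) * gamma_im 0 nu t).
    - intros t _. unfold gamma_im. replace (- nu * ln t) with (- (nu * ln t)) by ring.
      rewrite sin_neg. ring.
    - replace (r * - sin (gamma_arg nu)) with
       (0 * (r * sin (gamma_arg nu)) + -1 * (r * sin (gamma_arg nu))) by ring.
      now apply improper_int_lin. }
  assert (E1 := BesselI_polar nu x r _ Hx Hr HX HY).
  assert (E2 := BesselI_polar (- nu) x r _ Hx Hr HX' HY').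
  simpl in E1, E2. change ((x / 2) * ((x / 2) * 1)) with c in E1, E2.
  unfold BesselKi.
  replace (Ci * RtoC nu)%C with ((0, nu) : C) by (unfold Ci, Cmult, RtoC; simpl; f_equal; ring).
  replace (- (0, nu))%C with ((0, - nu) : C) by (unfold Copp; simpl; f_equal; ring).
  rewrite E1, E2, F_re_opp, F_im_opp.
  replace (- nu * ln (x / 2) - - gamma_arg nu) with (- phi) by (unfold phi; ring).
  fold phi. rewrite cos_neg, sin_neg.
  set (P := F_re nu c). set (Q := F_im nu c).
  assert (Hs : 0 < sinh (PI * nu)).
  { unfold sinh. assert (HP := PI_RGT_0).
    assert (H : exp (- (PI * nu)) < exp (PI * nu)) by (apply exp_increasing; nra). lra. }
  set (sh := sinh (PI * nu)) in *.
  assert (E : (RtoC PI * Ci / RtoC (2 * sh) *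
     ((((P * cos phi - Q * sin phi) / r)%R, ((P * sin phi + Q * cos phi) / r)%R) -
      (((P * cos phi - - Q * - sin phi) / r)%R, ((P * - sin phi + - Q * cos phi) / r)%R)))%C
     = RtoC (- (PI / (sh * r)) * (P * sin phi + Q * cos phi))).
  { unfold Cdiv. rewrite <- RtoC_inv by lra.
    unfold Cminus, Cmult, Cplus, Copp, RtoC, Ci; simpl. f_equal; field; lra. }
  rewrite E. split.
  - intros H. apply RtoC_inj in H. apply Rmult_integral in H. destruct H as [H|H]; trivial.
    assert (0 < PI / (sh * r)) by (apply Rdiv_lt_0_compat; [apply PI_RGT_0|nra]). lra.
  - intros H. rewrite H. f_equal. ring.
Qed.

(** * The hypergeometric series: differential equation and Wronskian *)

Lemma inv_fact_le (k : nat) : 0 < / INR (fact k) <= 1.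
Proof.
  split; [apply Rinv_0_lt_compat, INR_fact_lt_0|].
  rewrite <- Rinv_1. apply Rinv_le_contravar; [lra|]. apply (le_INR 1). apply lt_O_fact.
Qed.

Lemma ex_series_exp_dominated (a : nat -> R) (x : R) :
  (forall k, Rabs (a k) <= / INR (fact k)) -> ex_series (fun k => Rabs (a k * x ^ k)).
Proof.
  intros H.
  apply (ex_series_le (V := R_CompleteNormedModule) _ (fun k => / INR (fact k) * Rabs x ^ k)).
  - intros k. change (Rabs (Rabs (a k * x ^ k)) <= / INR (fact k) * Rabs x ^ k).
    rewrite Rabs_Rabsolu, Rabs_mult, <- RPow_abs.
    apply Rmult_le_compat_r; [apply pow_le, Rabs_pos|apply H].
  - exists (exp (Rabs x)). generalize (is_exp_Reals (Rabs x)). unfold is_pseries.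
    apply is_series_ext. intros n. rewrite pow_n_pow. unfold scal; simpl; unfold mult; simpl. ring.
Qed.

Lemma CV_radius_exp_dominated (a : nat -> R) (x : R) :
  (forall k, Rabs (a k) <= / INR (fact k)) -> Rbar_lt (Rabs x) (CV_radius a).
Proof.
  intros H.
  apply Rbar_lt_le_trans with (Finite (Rabs (Rabs x + 1))).
  - simpl. rewrite (Rabs_pos_eq (Rabs x + 1)); generalize (Rabs_pos x); lra.
  - apply (proj1 (Lub_Rbar_correct (CV_disk a))).
    now apply ex_series_exp_dominated.
Qed.

Lemma is_series_PSeries (a : nat -> R) (x : R) :
  Rbar_lt (Rabs x) (CV_radius a) -> is_series (fun k => a k * x ^ k) (PSeries a x).
Proof.
  intros H. apply Series_correct. apply (proj1 (ex_pseries_R a x)).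
  now apply CV_radius_inside.
Qed.

Lemma hyp_coef_bound (nu t : R) (k : nat) :
  Rabs t <= 1 -> Rabs (euler_mod k nu * t / INR (fact k) ^ 2) <= / INR (fact k) ^ 2.
Proof.
  intros Ht. assert (Hf := INR_fact_lt_0 k).
  assert (Hf2 : 0 < / INR (fact k) ^ 2) by (apply Rinv_0_lt_compat, pow_lt; trivial).
  unfold Rdiv. rewrite !Rabs_mult, (Rabs_pos_eq (/ _)) by lra.
  rewrite <- (Rmult_1_l (/ _)) at 2. apply Rmult_le_compat_r; [lra|].
  rewrite (Rabs_pos_eq (euler_mod _ _)) by (left; apply euler_mod_pos).
  rewrite <- (Rmult_1_l 1).
  apply Rmult_le_compat; trivial; [left; apply euler_mod_pos|apply Rabs_pos|apply euler_mod_le_1].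
Qed.

Lemma hyp_re_bound (nu : R) (k : nat) : Rabs (hyp_re nu k) <= / INR (fact k) ^ 2.
Proof. apply hyp_coef_bound, Rabs_le, COS_bound. Qed.

Lemma hyp_im_bound (nu : R) (k : nat) : Rabs (hyp_im nu k) <= / INR (fact k) ^ 2.
Proof. unfold hyp_im. rewrite Rabs_Ropp. apply hyp_coef_bound, Rabs_le, SIN_bound. Qed.

Lemma inv_fact_sqr_le (k : nat) : / INR (fact k) ^ 2 <= / INR (fact k).
Proof.
  destruct (inv_fact_le k). rewrite <- pow_inv. simpl. nra.
Qed.

Lemma hyp_re_radius (nu x : R) : Rbar_lt (Rabs x) (CV_radius (hyp_re nu)).
Proof.
  apply CV_radius_exp_dominated. intros k.
  eapply Rle_trans; [apply hyp_re_bound|apply inv_fact_sqr_le].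
Qed.

Lemma hyp_im_radius (nu x : R) : Rbar_lt (Rabs x) (CV_radius (hyp_im nu)).
Proof.
  apply CV_radius_exp_dominated. intros k.
  eapply Rle_trans; [apply hyp_im_bound|apply inv_fact_sqr_le].
Qed.

Definition F_re' (nu c : R) : R := PSeries (PS_derive (hyp_re nu)) c.
Definition F_im' (nu c : R) : R := PSeries (PS_derive (hyp_im nu)) c.
Definition F_re'' (nu c : R) : R := PSeries (PS_derive (PS_derive (hyp_re nu))) c.
Definition F_im'' (nu c : R) : R := PSeries (PS_derive (PS_derive (hyp_im nu))) c.

Lemma F_re_derive (nu c : R) : is_derive (F_re nu) c (F_re' nu c).
Proof. apply is_derive_PSeries, hyp_re_radius. Qed.
Lemma F_im_derive (nu c : R) : is_derive (F_im nu) c (F_im' nu c).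
Proof. apply is_derive_PSeries, hyp_im_radius. Qed.
Lemma F_re'_derive (nu c : R) : is_derive (F_re' nu) c (F_re'' nu c).
Proof. apply is_derive_PSeries. rewrite CV_radius_derive. apply hyp_re_radius. Qed.
Lemma F_im'_derive (nu c : R) : is_derive (F_im' nu) c (F_im'' nu c).
Proof. apply is_derive_PSeries. rewrite CV_radius_derive. apply hyp_im_radius. Qed.

(** The coefficient of index k + 1 times (k + 1)(k + 1 + i nu) is the one of index k. *)
Lemma hyp_recurrence (nu : R) (k : nat) :
  INR (S k) ^ 2 * hyp_re nu (S k) - nu * INR (S k) * hyp_im nu (S k) = hyp_re nu k /\
  INR (S k) ^ 2 * hyp_im nu (S k) + nu * INR (S k) * hyp_re nu (S k) = hyp_im nu k.
Proof.
  unfold hyp_re, hyp_im. rewrite euler_mod_S, euler_arg_S.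
  assert (Hk := INR_S_pos k).
  set (d := atan (nu / INR (S k))).
  assert (Es : sin d = nu / INR (S k) * cos d) by apply sin_atan_eq.
  assert (H1 := sin2_cos2 d). unfold Rsqr in H1. rewrite Es in H1.
  assert (Hf := INR_fact_lt_0 k).
  replace (fact (S k)) with (S k * fact k)%nat by reflexivity. rewrite mult_INR.
  rewrite cos_plus, sin_plus, Es.
  set (t := INR (S k)) in *. set (f := INR (fact k)) in *.
  set (a := euler_arg k nu). set (m := euler_mod k nu). set (z := cos d) in *.
  split.
  - transitivity (m * cos a / f ^ 2 * (nu / t * z * (nu / t * z) + z * z)); [|rewrite H1; ring].
    field. lra.
  - transitivity (- (m * sin a / f ^ 2) * (nu / t * z * (nu / t * z) + z * z)); [|rewrite H1; ring].
    field. lra.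
Qed.

Lemma PSeries_hypergeom (a b d : nat -> R) (nu c : R) :
  (forall x, Rbar_lt (Rabs x) (CV_radius a)) ->
  (forall x, Rbar_lt (Rabs x) (CV_radius b)) ->
  (forall k, INR (S k) ^ 2 * a (S k) + nu * INR (S k) * b (S k) = d k) ->
  c * PSeries (PS_derive (PS_derive a)) c + PSeries (PS_derive a) c
  + nu * PSeries (PS_derive b) c = PSeries d c.
Proof.
  intros Ha Hb Hrec.
  assert (Ea' : ex_pseries (PS_derive a) c) by (apply ex_pseries_derive, Ha).
  assert (Eb' : ex_pseries (PS_derive b) c) by (apply ex_pseries_derive, Hb).
  assert (Ea'' : ex_pseries (PS_derive (PS_derive a)) c)
    by (apply ex_pseries_derive; rewrite CV_radius_derive; apply Ha).
  rewrite <- PSeries_incr_1.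
  rewrite <- PSeries_plus; [|now apply ex_pseries_incr_1|trivial].
  rewrite <- PSeries_scal.
  rewrite <- PSeries_plus.
  - apply PSeries_ext. intros k. rewrite <- Hrec.
    unfold PS_plus, PS_scal, PS_incr_1, PS_derive. change plus with Rplus. change scal with Rmult.
    destruct k as [|k].
    + simpl. change zero with 0. ring.
    + rewrite (S_INR (S k)). simpl plus. ring.
  - apply ex_pseries_plus; trivial. now apply ex_pseries_incr_1.
  - apply ex_pseries_scal; trivial. apply Rmult_comm.
Qed.

(** The two parts of c F'' + (1 + i nu) F' = F. *)
Lemma F_ode (nu c : R) :
  c * F_re'' nu c + F_re' nu c - nu * F_im' nu c = F_re nu c /\
  c * F_im'' nu c + F_im' nu c + nu * F_re' nu c = F_im nu c.
Proof.
  split.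
  - transitivity (PSeries (hyp_re nu) c); [|reflexivity].
    rewrite <- (PSeries_hypergeom (hyp_re nu) (hyp_im nu) (hyp_re nu) (- nu) c).
    + unfold F_re'', F_re', F_im'. ring.
    + apply hyp_re_radius.
    + apply hyp_im_radius.
    + intros k. rewrite <- (proj1 (hyp_recurrence nu k)). ring.
  - transitivity (PSeries (hyp_im nu) c); [|reflexivity].
    rewrite <- (PSeries_hypergeom (hyp_im nu) (hyp_re nu) (hyp_im nu) nu c).
    + unfold F_im'', F_im', F_re'. ring.
    + apply hyp_im_radius.
    + apply hyp_re_radius.
    + intros k. rewrite <- (proj2 (hyp_recurrence nu k)). ring.
Qed.

Lemma F_re_at_0 (nu : R) : F_re nu 0 = 1.
Proof.
  unfold F_re. rewrite PSeries_0. unfold hyp_re. simpl. rewrite cos_0. field.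
Qed.

Lemma F_im_at_0 (nu : R) : F_im nu 0 = 0.
Proof.
  unfold F_im. rewrite PSeries_0. unfold hyp_im. simpl. rewrite sin_0. field.
Qed.

(** The squared modulus of F, and below the imaginary part of F' times the conjugate of F. *)
Definition F_norm2 (nu c : R) : R := F_re nu c ^ 2 + F_im nu c ^ 2.
Definition F_cross (nu c : R) : R := F_re nu c * F_im' nu c - F_im nu c * F_re' nu c.

Lemma constant_of_derive_0 (f : R -> R) (a b : R) :
  (forall x, Rmin a b <= x <= Rmax a b -> is_derive f x 0) -> f b = f a.
Proof.
  intros H.
  assert (H1 := lipschitz_of_derive f (fun _ => 0) a b 0 H).
  rewrite Rmult_0_l in H1. specialize (H1 ltac:(intros; rewrite Rabs_R0; lra)).
  assert (H2 := Rabs_pos (f b - f a)).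
  assert (H3 : Rabs (f b - f a) = 0) by lra.
  destruct (Req_dec (f b - f a) 0) as [E|E]; [lra|].
  now apply Rabs_no_R0 in E.
Qed.

Ltac rewrite_F_derivatives nu x :=
  repeat first
   [ progress replace (Derive (fun y : R => F_re nu y) x) with (F_re' nu x)
      by (symmetry; apply is_derive_unique, F_re_derive)
   | progress replace (Derive (fun y : R => F_im nu y) x) with (F_im' nu x)
      by (symmetry; apply is_derive_unique, F_im_derive)
   | progress replace (Derive (fun y : R => F_re' nu y) x) with (F_re'' nu x)
      by (symmetry; apply is_derive_unique, F_re'_derive)
   | progress replace (Derive (fun y : R => F_im' nu y) x) with (F_im'' nu x)
      by (symmetry; apply is_derive_unique, F_im'_derive) ].

(** Up to powers of c and constants this is the Wronskian of I_{i nu} and I_{-i nu}: by the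
    differential equation, nu/2 |F|^2 + c Im (F' conj F) does not depend on c, and it is nu/2
    at c = 0. In particular F has no zero when nu <> 0. *)
Lemma wronskian (nu c : R) :
  c * F_cross nu c = nu / 2 * (1 - F_norm2 nu c).
Proof.
  enough (H : nu / 2 * F_norm2 nu c + c * F_cross nu c = nu / 2 * F_norm2 nu 0 + 0 * F_cross nu 0).
  { unfold F_norm2 at 2 in H. rewrite F_re_at_0, F_im_at_0 in H. lra. }
  apply (constant_of_derive_0 (fun c => nu / 2 * F_norm2 nu c + c * F_cross nu c) 0 c).
  intros x _. unfold F_norm2, F_cross.
  assert (H1 : is_derive (fun y => F_re nu y) x (F_re' nu x)) by apply F_re_derive.
  assert (H2 : is_derive (fun y => F_im nu y) x (F_im' nu x)) by apply F_im_derive.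
  assert (H3 : is_derive (fun y => F_re' nu y) x (F_re'' nu x)) by apply F_re'_derive.
  assert (H4 : is_derive (fun y => F_im' nu y) x (F_im'' nu x)) by apply F_im'_derive.
  destruct (F_ode nu x) as [O1 O2].
  auto_derive.
  - repeat split; eexists; eassumption.
  - rewrite_F_derivatives nu x.
    set (P := F_re nu x) in *. set (Q := F_im nu x) in *.
    set (P' := F_re' nu x) in *. set (Q' := F_im' nu x) in *.
    set (P'' := F_re'' nu x) in *. set (Q'' := F_im'' nu x) in *.
    replace (_ + _) with (P * (x * Q'' + Q' + nu * P') - Q * (x * P'' + P' - nu * Q'))
      by field.
    rewrite O1, O2. ring.
Qed.

Lemma F_norm2_pos (nu c : R) : nu <> 0 -> 0 < F_norm2 nu c.
Proof.
  intros Hnu. assert (H := wronskian nu c).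
  assert (H1 : 0 <= F_norm2 nu c)
    by (unfold F_norm2; generalize (pow2_ge_0 (F_re nu c)) (pow2_ge_0 (F_im nu c)); lra).
  destruct H1 as [H1|H1]; trivial. exfalso.
  assert (E : F_re nu c = 0 /\ F_im nu c = 0).
  { unfold F_norm2 in H1. split; nra. }
  destruct E as [E1 E2]. unfold F_cross in H. rewrite <- H1, E1, E2 in H. lra.
Qed.

(** * The continuous phase of the Bessel function *)

(** The integral of Im (F'/F), which is the argument of F continued from F = 1 at c = 0. *)
Definition F_arg (nu c : R) : R := RInt (fun t => F_cross nu t / F_norm2 nu t) 0 c.

Lemma F_cross_continuous (nu c : R) : continuous (F_cross nu) c.
Proof.
  apply (ex_derive_continuous (V := R_NormedModule)). unfold F_cross. auto_derive.
  assert (H1 := F_re_derive nu c). assert (H2 := F_im_derive nu c).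
  assert (H3 := F_re'_derive nu c). assert (H4 := F_im'_derive nu c).
  repeat split; eexists; eassumption.
Qed.

Lemma F_norm2_continuous (nu c : R) : continuous (F_norm2 nu) c.
Proof.
  apply (ex_derive_continuous (V := R_NormedModule)). unfold F_norm2. auto_derive.
  assert (H1 := F_re_derive nu c). assert (H2 := F_im_derive nu c).
  repeat split; eexists; eassumption.
Qed.

Lemma continuous_div_R (f g : R -> R) (x : R) :
  continuous f x -> continuous g x -> g x <> 0 -> continuous (fun t => f t / g t) x.
Proof.
  intros Hf Hg Hx.
  apply (continuous_mult (K := R_AbsRing) f (fun t => / g t)); trivial.
  now apply continuous_Rinv_comp.
Qed.

Lemma F_rate_continuous (nu c : R) :
  0 < F_norm2 nu c -> continuous (fun t => F_cross nu t / F_norm2 nu t) c.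
Proof.
  intros Hnu. apply continuous_div_R.
  apply F_cross_continuous. apply F_norm2_continuous. lra.
Qed.

Lemma F_arg_derive (nu c : R) :
  nu <> 0 -> is_derive (F_arg nu) c (F_cross nu c / F_norm2 nu c).
Proof.
  intros Hnu. unfold F_arg.
  apply (is_derive_RInt (V := R_NormedModule) (fun t => F_cross nu t / F_norm2 nu t)
          (fun x => RInt (fun t => F_cross nu t / F_norm2 nu t) 0 x) 0 c).
  - exists (mkposreal 1 Rlt_0_1). intros y _.
    apply (RInt_correct (V := R_CompleteNormedModule)).
    apply (ex_RInt_continuous (V := R_CompleteNormedModule)).
    intros z _. now apply F_rate_continuous, F_norm2_pos.
  - now apply F_rate_continuous, F_norm2_pos.
Qed.

Lemma F_arg_at_0 (nu : R) : F_arg nu 0 = 0.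
Proof. apply (RInt_point (V := R_CompleteNormedModule)). Qed.

(** The left side is the real part of F e^(-i (F_arg - w)). The logarithmic derivative of
    F e^(-i F_arg) is real and equal to that of |F|, so the quotient by |F| is constant, and it
    is e^(iw) at c = 0. *)
Lemma F_rotated_constant (nu c w : R) : nu <> 0 ->
  F_re nu c * cos (F_arg nu c - w) + F_im nu c * sin (F_arg nu c - w)
  = sqrt (F_norm2 nu c) * cos w.
Proof.
  intros Hnu.
  set (A := fun t => (F_re nu t * cos (F_arg nu t - w) + F_im nu t * sin (F_arg nu t - w))
                      / sqrt (F_norm2 nu t)).
  assert (HA : A c = A 0).
  { apply constant_of_derive_0. intros x _. unfold A.
    assert (HM := F_norm2_pos nu x Hnu). assert (Hs := sqrt_lt_R0 _ HM).
    assert (Hsq := sqrt_sqrt _ (Rlt_le _ _ HM)).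
    assert (Harg := F_arg_derive nu x Hnu).
    unfold F_norm2 in HM, Hs, Hsq |- *. auto_derive.
    - assert (H1 := F_re_derive nu x). assert (H2 := F_im_derive nu x).
      repeat split; try (eexists; eassumption); simpl in *; lra.
    - rewrite_F_derivatives nu x.
      replace (Derive (fun y : R => F_arg nu y) x) with (F_cross nu x / F_norm2 nu x)
        by (symmetry; apply is_derive_unique, Harg).
      unfold F_cross, F_norm2.
      replace (F_re nu x * (F_re nu x * 1) + F_im nu x * (F_im nu x * 1))
        with (F_re nu x ^ 2 + F_im nu x ^ 2) by ring.
      set (s := sqrt (F_re nu x ^ 2 + F_im nu x ^ 2)) in *.
      rewrite <- Hsq.
      set (P := F_re nu x) in *. set (Q := F_im nu x) in *.
      set (P' := F_re' nu x) in *. set (Q' := F_im' nu x) in *.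
      change (F_arg nu x + - w) with (F_arg nu x - w).
      set (a := cos (F_arg nu x - w)). set (b := sin (F_arg nu x - w)).
      transitivity ((s * s * (P' * a + Q' * b) + (P * Q' - Q * P') * (Q * a - P * b)
                     - (P * a + Q * b) * (P * P' + Q * Q')) / (s * s * s)); [field; lra|].
      rewrite Hsq. unfold Rdiv. apply Rmult_eq_0_compat_r. ring. }
  assert (Hs := sqrt_lt_R0 _ (F_norm2_pos nu c Hnu)).
  assert (E0 : F_norm2 nu 0 = 1) by (unfold F_norm2; rewrite F_re_at_0, F_im_at_0; ring).
  unfold A in HA. rewrite E0, sqrt_1, F_re_at_0, F_im_at_0, F_arg_at_0 in HA.
  apply Rmult_eq_reg_r with (/ sqrt (F_norm2 nu c)); [|apply Rinv_neq_0_compat; lra].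
  transitivity (cos (0 - w)); [rewrite <- (Rdiv_1_r (cos (0 - w))); unfold Rdiv in *; lra|].
  rewrite Rminus_0_l, cos_neg. field. lra.
Qed.

Lemma F_polar (nu c : R) : nu <> 0 ->
  F_re nu c = sqrt (F_norm2 nu c) * cos (F_arg nu c) /\
  F_im nu c = sqrt (F_norm2 nu c) * sin (F_arg nu c).
Proof.
  intros Hnu. split.
  - rewrite <- F_rotated_constant by trivial. rewrite Rminus_diag, cos_0, sin_0. ring.
  - replace (sin (F_arg nu c)) with (cos (F_arg nu c - PI / 2))
      by (rewrite <- cos_shift, <- cos_neg; f_equal; ring).
    rewrite <- F_rotated_constant by trivial.
    replace (F_arg nu c - (F_arg nu c - PI / 2)) with (PI / 2) by ring.
    rewrite cos_PI2, sin_PI2. ring.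
Qed.

(** Minus the argument of I_{i nu}(x), as a function of s = 2 ln (x/2), so that exp s = x^2/4.
    The variable s turns Bessel's equation into u'' = (e^s - nu^2/4) u. *)
Definition theta (nu s : R) : R := gamma_arg nu - nu * s / 2 - F_arg nu (exp s).

Definition modulus (nu s : R) : R := sqrt (F_norm2 nu (exp s)).

Lemma modulus_pos (nu s : R) : nu <> 0 -> 0 < modulus nu s.
Proof. intros H. apply sqrt_lt_R0. now apply F_norm2_pos. Qed.

(** By the Wronskian identity, c Im (F'/F) = (nu/2) (1/|F|^2 - 1); the terms nu/2 cancel. *)
Lemma theta_derive (nu s : R) : nu <> 0 ->
  is_derive (theta nu) s (- (nu / 2 / modulus nu s ^ 2)).
Proof.
  intros Hnu. unfold theta.
  assert (Ha := F_arg_derive nu (exp s) Hnu).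
  auto_derive.
  - eexists; exact Ha.
  - replace (Derive (fun y : R => F_arg nu y) (exp s))
      with (F_cross nu (exp s) / F_norm2 nu (exp s))
      by (symmetry; apply is_derive_unique, Ha).
    assert (HM := F_norm2_pos nu (exp s) Hnu).
    unfold modulus. rewrite pow2_sqrt by lra.
    assert (W := wronskian nu (exp s)).
    set (M := F_norm2 nu (exp s)) in *.
    transitivity (- (nu / 2) - exp s * F_cross nu (exp s) / M); [field; lra|].
    rewrite W. field. lra.
Qed.

(** A positive multiple of minus the imaginary part of I_{i nu}(x), hence of K_{i nu}(x). The
    factor |Gamma(1 + i nu)| makes its modulus that of F. The derivative osc' is written without theta so
    that it can be differentiated through the equation for F. *)
Definition osc (nu s : R) : R := modulus nu s * sin (theta nu s).
Definition osc' (nu s : R) : R :=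
  - (exp s * (F_re' nu (exp s) * sin (nu * s / 2 - gamma_arg nu)
              + F_im' nu (exp s) * cos (nu * s / 2 - gamma_arg nu))
     + nu / 2 * (F_re nu (exp s) * cos (nu * s / 2 - gamma_arg nu)
              - F_im nu (exp s) * sin (nu * s / 2 - gamma_arg nu))).

Lemma osc_eq (nu s : R) : nu <> 0 ->
  osc nu s = - (F_re nu (exp s) * sin (nu * s / 2 - gamma_arg nu)
                + F_im nu (exp s) * cos (nu * s / 2 - gamma_arg nu)).
Proof.
  intros Hnu. destruct (F_polar nu (exp s) Hnu) as [E1 E2]. rewrite E1, E2.
  unfold osc, theta, modulus.
  replace (gamma_arg nu - nu * s / 2 - F_arg nu (exp s)) with
    (- ((nu * s / 2 - gamma_arg nu) + F_arg nu (exp s))) by ring.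
  rewrite sin_neg, sin_plus. ring.
Qed.

Lemma cos_theta_eq (nu s : R) : nu <> 0 ->
  modulus nu s * cos (theta nu s)
  = F_re nu (exp s) * cos (nu * s / 2 - gamma_arg nu)
    - F_im nu (exp s) * sin (nu * s / 2 - gamma_arg nu).
Proof.
  intros Hnu. destruct (F_polar nu (exp s) Hnu) as [E1 E2]. rewrite E1, E2.
  unfold theta, modulus.
  replace (gamma_arg nu - nu * s / 2 - F_arg nu (exp s)) with
    (- ((nu * s / 2 - gamma_arg nu) + F_arg nu (exp s))) by ring.
  rewrite cos_neg, cos_plus. ring.
Qed.

Lemma osc_derive (nu s : R) : nu <> 0 -> is_derive (osc nu) s (osc' nu s).
Proof.
  intros Hnu.
  apply is_derive_ext with (fun s => - (F_re nu (exp s) * sin (nu * s / 2 - gamma_arg nu)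
                + F_im nu (exp s) * cos (nu * s / 2 - gamma_arg nu))).
  { intros t. symmetry. now apply osc_eq. }
  assert (H1 := F_re_derive nu (exp s)). assert (H2 := F_im_derive nu (exp s)).
  auto_derive.
  - repeat split; eexists; eassumption.
  - rewrite_F_derivatives nu (exp s). unfold osc', Rdiv, Rminus. ring.
Qed.

Lemma osc'_derive (nu s : R) : nu <> 0 ->
  is_derive (osc' nu) s ((exp s - nu ^ 2 / 4) * osc nu s).
Proof.
  intros Hnu. rewrite osc_eq by trivial. unfold osc'.
  assert (H1 := F_re_derive nu (exp s)). assert (H2 := F_im_derive nu (exp s)).
  assert (H3 := F_re'_derive nu (exp s)). assert (H4 := F_im'_derive nu (exp s)).
  destruct (F_ode nu (exp s)) as [O1 O2].
  auto_derive.
  - repeat split; eexists; eassumption.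
  - rewrite_F_derivatives nu (exp s).
    set (c := exp s) in *.
    change (nu * s * / 2 + - gamma_arg nu) with (nu * s / 2 - gamma_arg nu).
    set (a := cos (nu * s / 2 - gamma_arg nu)).
    set (b := sin (nu * s / 2 - gamma_arg nu)).
    set (P'' := F_re'' nu c) in *. set (Q'' := F_im'' nu c) in *.
    set (P' := F_re' nu c) in *. set (Q' := F_im' nu c) in *.
    set (P := F_re nu c) in *. set (Q := F_im nu c) in *.
    transitivity (- (c * ((c * P'' + P' - nu * Q') * b + (c * Q'' + Q' + nu * P') * a)
                     - nu ^ 2 / 4 * (P * b + Q * a))).
    + field.
    + rewrite O1, O2. ring.
Qed.

Lemma BesselKi_zero_iff_sin_theta (nu x : R) :
  0 < x -> 0 < nu ->
  BesselKi nu x = RtoC 0 <-> sin (theta nu (2 * ln (x / 2))) = 0.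
Proof.
  intros Hx Hnu. rewrite BesselKi_zero_iff by trivial.
  assert (Hm := modulus_pos nu (2 * ln (x / 2)) ltac:(lra)).
  assert (E := osc_eq nu (2 * ln (x / 2)) ltac:(lra)). unfold osc in E.
  assert (Ec : exp (2 * ln (x / 2)) = (x / 2) ^ 2).
  { replace (2 * ln (x / 2)) with (ln (x / 2) + ln (x / 2)) by ring.
    rewrite exp_plus, exp_ln by lra. ring. }
  rewrite Ec in E. replace (nu * (2 * ln (x / 2)) / 2) with (nu * ln (x / 2)) in E by field.
  split; intros H.
  - rewrite H, Ropp_0 in E. apply Rmult_integral in E. destruct E; [lra|trivial].
  - rewrite H, Rmult_0_r in E. lra.
Qed.

(** * Continuity of the phase in the order *)

(** Where sin theta = 0 the derivative of osc is modulus * cos theta * theta', and theta' is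
    known; the proof reads the same from the Wronskian identity. *)
Lemma osc'_at_zero (nu s : R) : nu <> 0 -> sin (theta nu s) = 0 ->
  osc' nu s * cos (theta nu s) = - (nu / 2 / modulus nu s).
Proof.
  intros Hnu Hz. assert (Hm := modulus_pos nu s Hnu).
  assert (HU := osc_eq nu s Hnu). unfold osc in HU. rewrite Hz, Rmult_0_r in HU.
  assert (HV := cos_theta_eq nu s Hnu). assert (W := wronskian nu (exp s)).
  assert (HM : modulus nu s * modulus nu s = F_norm2 nu (exp s)).
  { apply sqrt_sqrt. left. now apply F_norm2_pos. }
  apply Rmult_eq_reg_l with (modulus nu s); [|lra].
  replace (modulus nu s * (osc' nu s * cos (theta nu s)))
   with (osc' nu s * (modulus nu s * cos (theta nu s))) by ring.
  assert (HV2 : (modulus nu s * cos (theta nu s)) ^ 2 = F_norm2 nu (exp s)).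
  { assert (H1 := sin2_cos2 (theta nu s)). rewrite Hz in H1. unfold Rsqr in H1.
    rewrite <- HM. replace ((modulus nu s * cos (theta nu s)) ^ 2) with
      (modulus nu s * modulus nu s * (0 * 0 + cos (theta nu s) * cos (theta nu s))) by ring.
    rewrite H1; ring. }
  rewrite HV in HV2 |- *. unfold osc'. unfold F_cross in W.
  assert (H1 := sin2_cos2 (nu * s / 2 - gamma_arg nu)). unfold Rsqr in H1.
  set (a := cos (nu * s / 2 - gamma_arg nu)) in *. set (b := sin (nu * s / 2 - gamma_arg nu)) in *.
  set (c := exp s) in *. set (M := F_norm2 nu c) in *.
  set (P := F_re nu c) in *. set (Q := F_im nu c) in *.
  set (P' := F_re' nu c) in *. set (Q' := F_im' nu c) in *.
  assert (HU' : P * b + Q * a = 0) by lra.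
  transitivity (- (c * (P * Q' - Q * P') * (b * b + a * a)
     + c * (P' * a - Q' * b) * (P * b + Q * a)
     + nu / 2 * (P * a - Q * b) ^ 2)).
  - field.
  - rewrite H1, HU', HV2, Rmult_1_r, W. field. lra.
Qed.

Lemma le_fact (k : nat) : (k <= fact k)%nat.
Proof.
  induction k as [|k IH]; [lia|]. simpl. assert (H := lt_O_fact k). nia.
Qed.

Lemma PSeries_le_exp (a : nat -> R) (K x : R) :
  (forall k, Rabs (a k) <= K * / INR (fact k)) ->
  Rabs (PSeries a x) <= K * exp (Rabs x).
Proof.
  intros H.
  assert (Hs : is_series (fun k => K * (/ INR (fact k) * Rabs x ^ k)) (K * exp (Rabs x))).
  { apply (is_series_scal_l (K := R_AbsRing) (V := R_NormedModule) K). generalize (is_exp_Reals (Rabs x)). unfold is_pseries.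
    apply is_series_ext. intros n. rewrite pow_n_pow.
    unfold scal; simpl; unfold mult; simpl. ring. }
  assert (Hk : forall k, Rabs (a k * x ^ k) <= K * (/ INR (fact k) * Rabs x ^ k)).
  { intros k. rewrite Rabs_mult, <- RPow_abs, <- Rmult_assoc.
    apply Rmult_le_compat_r; [apply pow_le, Rabs_pos|apply H]. }
  unfold PSeries. eapply Rle_trans; [apply Series_Rabs|].
  - apply (ex_series_le (V := R_CompleteNormedModule) _ (fun k => K * (/ INR (fact k) * Rabs x ^ k))).
    + intros k. change (Rabs (Rabs (a k * x ^ k)) <= K * (/ INR (fact k) * Rabs x ^ k)).
      rewrite Rabs_Rabsolu. apply Hk.
    + eexists; exact Hs.
  - rewrite <- (is_series_unique _ _ Hs). apply Series_le.
    + intros k; split; [apply Rabs_pos|apply Hk].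
    + eexists; exact Hs.
Qed.

Lemma PSeries_diff_le_exp (a b : nat -> R) (K x : R) :
  (forall x, Rbar_lt (Rabs x) (CV_radius a)) ->
  (forall x, Rbar_lt (Rabs x) (CV_radius b)) ->
  (forall k, Rabs (a k - b k) <= K * / INR (fact k)) ->
  Rabs (PSeries a x - PSeries b x) <= K * exp (Rabs x).
Proof.
  intros Ha Hb H. rewrite <- PSeries_minus.
  - apply PSeries_le_exp. intros k. apply H.
  - apply CV_radius_inside, Ha.
  - apply CV_radius_inside, Hb.
Qed.

(** Every factor of euler_mod and every term of euler_arg is 1-Lipschitz in nu, whence the
    factor k. *)
Lemma hyp_lipschitz (trig : R -> R) (nu mu : R) (k : nat) :
  (forall a b, Rabs (trig b - trig a) <= Rabs (b - a)) ->
  (forall a, Rabs (trig a) <= 1) ->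
  Rabs (euler_mod k nu * trig (euler_arg k nu) / INR (fact k) ^ 2
        - euler_mod k mu * trig (euler_arg k mu) / INR (fact k) ^ 2)
  <= 2 * Rabs (nu - mu) * (INR k / INR (fact k) ^ 2).
Proof.
  intros Hl Hb. assert (Hf := INR_fact_lt_0 k).
  assert (Hf2 : 0 < / INR (fact k) ^ 2) by (apply Rinv_0_lt_compat, pow_lt; trivial).
  unfold Rdiv. rewrite <- Rmult_minus_distr_r, Rabs_mult, (Rabs_pos_eq (/ _)) by lra.
  rewrite <- Rmult_assoc. apply Rmult_le_compat_r; [lra|].
  replace (_ - _) with ((euler_mod k nu - euler_mod k mu) * trig (euler_arg k nu)
    + euler_mod k mu * (trig (euler_arg k nu) - trig (euler_arg k mu))) by ring.
  eapply Rle_trans; [apply Rabs_triang|]. rewrite !Rabs_mult.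
  rewrite (Rabs_pos_eq (euler_mod k mu)) by (left; apply euler_mod_pos).
  assert (H1 := euler_mod_lipschitz k nu mu). assert (H2 := euler_arg_lipschitz k nu mu).
  assert (H3 := Hl (euler_arg k mu) (euler_arg k nu)).
  assert (H4 := Hb (euler_arg k nu)). assert (H5 := euler_mod_le_1 k mu).
  assert (H6 := euler_mod_pos k mu).
  assert (H7 := Rmult_le_compat _ _ _ _ (Rabs_pos _) (Rabs_pos _) H1 H4).
  assert (H8 := Rmult_le_compat _ _ _ _ (Rlt_le _ _ H6) (Rabs_pos _) H5 (Rle_trans _ _ _ H3 H2)).
  lra.
Qed.

Lemma hyp_re_lipschitz (nu mu : R) (k : nat) :
  Rabs (hyp_re nu k - hyp_re mu k) <= 2 * Rabs (nu - mu) * (INR k / INR (fact k) ^ 2).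
Proof.
  apply (hyp_lipschitz cos). intros; apply cos_lipschitz. intros; apply Rabs_le, COS_bound.
Qed.

Lemma hyp_im_lipschitz (nu mu : R) (k : nat) :
  Rabs (hyp_im nu k - hyp_im mu k) <= 2 * Rabs (nu - mu) * (INR k / INR (fact k) ^ 2).
Proof.
  unfold hyp_im.
  replace (- _ - - _) with
    (- (euler_mod k nu * sin (euler_arg k nu) / INR (fact k) ^ 2
        - euler_mod k mu * sin (euler_arg k mu) / INR (fact k) ^ 2)) by ring.
  rewrite Rabs_Ropp.
  apply (hyp_lipschitz sin). intros; apply sin_lipschitz. intros; apply Rabs_le, SIN_bound.
Qed.

Lemma INR_over_fact_sqr_le (k : nat) : INR k / INR (fact k) ^ 2 <= / INR (fact k).
Proof.
  assert (Hf := INR_fact_lt_0 k). assert (Hk := le_INR _ _ (le_fact k)).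
  apply Rmult_le_reg_r with (INR (fact k) ^ 2); [now apply pow_lt|].
  replace (INR k / INR (fact k) ^ 2 * INR (fact k) ^ 2) with (INR k) by (field; lra).
  replace (/ INR (fact k) * INR (fact k) ^ 2) with (INR (fact k)) by (field; lra). exact Hk.
Qed.

Lemma PS_derive_diff_le (a b : nat -> R) (L : R) (k : nat) : 0 <= L ->
  (forall k, Rabs (a k - b k) <= L * (INR k / INR (fact k) ^ 2)) ->
  Rabs (PS_derive a k - PS_derive b k) <= L * / INR (fact k).
Proof.
  intros HL H. unfold PS_derive. rewrite <- Rmult_minus_distr_l, Rabs_mult.
  rewrite (Rabs_pos_eq (INR _)) by apply pos_INR.
  eapply Rle_trans; [apply Rmult_le_compat_l; [apply pos_INR|apply H]|].
  assert (Hf := INR_fact_lt_0 k).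
  replace (INR (S k) * (L * (INR (S k) / INR (fact (S k)) ^ 2))) with (L * / INR (fact k) ^ 2).
  - apply Rmult_le_compat_l; trivial. apply inv_fact_sqr_le.
  - replace (fact (S k)) with (S k * fact k)%nat by reflexivity. rewrite mult_INR.
    assert (Hk := INR_S_pos k). field. lra.
Qed.

Lemma F_lipschitz (nu mu c : R) :
  let d := 2 * Rabs (nu - mu) * exp (Rabs c) in
  Rabs (F_re nu c - F_re mu c) <= d /\ Rabs (F_im nu c - F_im mu c) <= d /\
  Rabs (F_re' nu c - F_re' mu c) <= d /\ Rabs (F_im' nu c - F_im' mu c) <= d.
Proof.
  assert (HL : 0 <= 2 * Rabs (nu - mu)) by (generalize (Rabs_pos (nu - mu)); lra).
  assert (Hgen : forall a b : nat -> R,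
    (forall x, Rbar_lt (Rabs x) (CV_radius a)) -> (forall x, Rbar_lt (Rabs x) (CV_radius b)) ->
    (forall k, Rabs (a k - b k) <= 2 * Rabs (nu - mu) * (INR k / INR (fact k) ^ 2)) ->
    Rabs (PSeries a c - PSeries b c) <= 2 * Rabs (nu - mu) * exp (Rabs c) /\
    Rabs (PSeries (PS_derive a) c - PSeries (PS_derive b) c) <= 2 * Rabs (nu - mu) * exp (Rabs c)).
  { intros a b Ha Hb H. split; apply PSeries_diff_le_exp; trivial.
    - intros k. eapply Rle_trans; [apply H|].
      apply Rmult_le_compat_l, INR_over_fact_sqr_le; trivial.
    - intros x. rewrite CV_radius_derive. apply Ha.
    - intros x. rewrite CV_radius_derive. apply Hb.
    - intros k. now apply PS_derive_diff_le. }
  destruct (Hgen _ _ (hyp_re_radius nu) (hyp_re_radius mu) (hyp_re_lipschitz nu mu)).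
  destruct (Hgen _ _ (hyp_im_radius nu) (hyp_im_radius mu) (hyp_im_lipschitz nu mu)).
  repeat split; assumption.
Qed.

Lemma PS_derive_bound (a : nat -> R) (k : nat) :
  (forall k, Rabs (a k) <= / INR (fact k) ^ 2) ->
  Rabs (PS_derive a k) <= 1 * / INR (fact k).
Proof.
  intros H. unfold PS_derive. rewrite Rabs_mult, (Rabs_pos_eq (INR _)) by apply pos_INR.
  eapply Rle_trans; [apply Rmult_le_compat_l; [apply pos_INR|apply H]|].
  assert (Hf := INR_fact_lt_0 k). assert (Hk := INR_S_pos k).
  replace (INR (S k) * / INR (fact (S k)) ^ 2) with (/ INR (S k) * / INR (fact k) ^ 2).
  - apply Rmult_le_compat.
    + left; now apply Rinv_0_lt_compat.
    + left; apply Rinv_0_lt_compat, pow_lt; trivial.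
    + rewrite <- Rinv_1. apply Rinv_le_contravar; [lra|apply (le_INR 1); lia].
    + apply inv_fact_sqr_le.
  - replace (fact (S k)) with (S k * fact k)%nat by reflexivity. rewrite mult_INR.
    field. lra.
Qed.

Lemma F_bounds (nu c : R) :
  Rabs (F_re nu c) <= exp (Rabs c) /\ Rabs (F_im nu c) <= exp (Rabs c) /\
  Rabs (F_re' nu c) <= exp (Rabs c) /\ Rabs (F_im' nu c) <= exp (Rabs c).
Proof.
  rewrite <- (Rmult_1_l (exp (Rabs c))). 
  repeat split; apply PSeries_le_exp; intros k.
  - rewrite Rmult_1_l. eapply Rle_trans; [apply hyp_re_bound|apply inv_fact_sqr_le].
  - rewrite Rmult_1_l. eapply Rle_trans; [apply hyp_im_bound|apply inv_fact_sqr_le].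
  - apply PS_derive_bound, hyp_re_bound.
  - apply PS_derive_bound, hyp_im_bound.
Qed.

Lemma Rabs_mul_diff_le (E d a b a' b' : R) :
  Rabs a <= E -> Rabs b' <= E -> Rabs (a - a') <= d -> Rabs (b - b') <= d ->
  Rabs (a * b - a' * b') <= 2 * E * d.
Proof.
  intros Ha Hb Hda Hdb.
  replace (a * b - a' * b') with (a * (b - b') + (a - a') * b') by ring.
  eapply Rle_trans; [apply Rabs_triang|]. rewrite !Rabs_mult.
  assert (H1 := Rmult_le_compat _ _ _ _ (Rabs_pos _) (Rabs_pos _) Ha Hdb).
  assert (H2 := Rmult_le_compat _ _ _ _ (Rabs_pos _) (Rabs_pos _) Hda Hb). lra.
Qed.

Lemma F_quadratic_lipschitz (nu mu c : R) :
  let E := exp (Rabs c) in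
  Rabs (F_cross nu c - F_cross mu c) <= 8 * E ^ 2 * Rabs (nu - mu) /\
  Rabs (F_norm2 nu c - F_norm2 mu c) <= 8 * E ^ 2 * Rabs (nu - mu) /\
  Rabs (F_cross mu c) <= 2 * E ^ 2 /\ Rabs (F_norm2 mu c) <= 2 * E ^ 2.
Proof.
  intros E.
  destruct (F_lipschitz nu mu c) as [L1 [L2 [L3 L4]]]. fold E in L1, L2, L3, L4.
  destruct (F_bounds nu c) as [B1 [B2 [B3 B4]]]. fold E in B1, B2, B3, B4.
  destruct (F_bounds mu c) as [A1 [A2 [A3 A4]]]. fold E in A1, A2, A3, A4.
  unfold F_cross, F_norm2.
  split; [|split; [|split]].
  - replace (_ - _ - _) with ((F_re nu c * F_im' nu c - F_re mu c * F_im' mu c)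
      - (F_im nu c * F_re' nu c - F_im mu c * F_re' mu c)) by ring.
    eapply Rle_trans; [apply Rabs_triang|]. rewrite Rabs_Ropp.
    assert (H1 := Rabs_mul_diff_le _ _ _ _ _ _ B1 A4 L1 L4).
    assert (H2 := Rabs_mul_diff_le _ _ _ _ _ _ B2 A3 L2 L3). nra.
  - replace (_ - _) with ((F_re nu c * F_re nu c - F_re mu c * F_re mu c)
      + (F_im nu c * F_im nu c - F_im mu c * F_im mu c)) by ring.
    eapply Rle_trans; [apply Rabs_triang|].
    assert (H1 := Rabs_mul_diff_le _ _ _ _ _ _ B1 A1 L1 L1).
    assert (H2 := Rabs_mul_diff_le _ _ _ _ _ _ B2 A2 L2 L2). nra.
  - eapply Rle_trans; [apply Rabs_triang|]. rewrite Rabs_Ropp, !Rabs_mult.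
    assert (H1 := Rmult_le_compat _ _ _ _ (Rabs_pos _) (Rabs_pos _) A1 A4).
    assert (H2 := Rmult_le_compat _ _ _ _ (Rabs_pos _) (Rabs_pos _) A2 A3). lra.
  - eapply Rle_trans; [apply Rabs_triang|]. rewrite <- !RPow_abs.
    assert (H1 := pow_incr _ _ 2 (conj (Rabs_pos _) A1)).
    assert (H2 := pow_incr _ _ 2 (conj (Rabs_pos _) A2)). lra.
Qed.

Lemma quotient_diff_le (N N0 M M0 D K m : R) :
  0 < m -> m <= M0 -> m / 2 <= M -> Rabs (N - N0) <= D -> Rabs (M - M0) <= D ->
  Rabs N0 <= K -> Rabs M0 <= K ->
  Rabs (N / M - N0 / M0) <= 4 * K / m ^ 2 * D.
Proof.
  intros Hm H0 H1 HN HM HN0 HM0.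
  assert (HD : 0 <= D) by (generalize (Rabs_pos (N - N0)); lra).
  replace (N / M - N0 / M0) with (((N - N0) * M0 - N0 * (M - M0)) / (M * M0)) by (field; lra).
  assert (Hp : m ^ 2 / 2 <= M * M0) by nra.
  rewrite Rabs_div, (Rabs_pos_eq (M * M0)) by nra.
  apply Rmult_le_reg_r with (M * M0); [nra|].
  unfold Rdiv at 1. rewrite Rmult_assoc, Rinv_l, Rmult_1_r by nra.
  eapply Rle_trans; [apply Rabs_triang|]. rewrite Rabs_Ropp, !Rabs_mult.
  assert (A1 := Rmult_le_compat _ _ _ _ (Rabs_pos _) (Rabs_pos _) HN HM0).
  assert (A2 := Rmult_le_compat _ _ _ _ (Rabs_pos _) (Rabs_pos _) HN0 HM).
  assert (HK : 0 <= K) by (generalize (Rabs_pos N0); lra).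
  assert (A3 : 4 * K / m ^ 2 * D * (m ^ 2 / 2) <= 4 * K / m ^ 2 * D * (M * M0)).
  { apply Rmult_le_compat_l; trivial. apply Rmult_le_pos; trivial.
    apply Rmult_le_pos; [lra|]. left; apply Rinv_0_lt_compat, pow_lt; trivial. }
  replace (4 * K / m ^ 2 * D * (m ^ 2 / 2)) with (2 * K * D) in A3 by (field; lra). lra.
Qed.

Lemma continuity_pt_of_local_lipschitz (f : R -> R) (x L d : R) :
  0 < d -> (forall y, Rabs (y - x) < d -> Rabs (f y - f x) <= L * Rabs (y - x)) ->
  continuity_pt f x.
Proof.
  intros Hd H. apply continuity_pt_filterlim. apply filterlim_locally. intros eps.
  set (K := Rabs L + 1). assert (HK : 0 < K) by (unfold K; generalize (Rabs_pos L); lra).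
  assert (Hr : 0 < Rmin d (eps / K)).
  { apply Rmin_pos; trivial. apply Rdiv_lt_0_compat; trivial. apply cond_pos. }
  exists (mkposreal _ Hr). intros y Hy.
  change (Rabs (y - x) < Rmin d (eps / K)) in Hy. change (Rabs (f y - f x) < eps).
  assert (H1 : Rabs (y - x) < d) by (eapply Rlt_le_trans; [apply Hy|apply Rmin_l]).
  assert (H2 : Rabs (y - x) < eps / K) by (eapply Rlt_le_trans; [apply Hy|apply Rmin_r]).
  eapply Rle_lt_trans; [now apply H|].
  apply Rle_lt_trans with (K * Rabs (y - x)).
  - apply Rmult_le_compat_r; [apply Rabs_pos|]. unfold K. generalize (Rle_abs L); lra.
  - apply Rmult_lt_reg_r with (/ K); [now apply Rinv_0_lt_compat|].
    replace (K * Rabs (y - x) * / K) with (Rabs (y - x)) by (field; lra). exact H2.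
Qed.

(** The integrand is a quotient of Lipschitz functions of nu, uniformly on [0, c], and its
    denominator stays away from 0 there by compactness. *)
Lemma F_arg_continuous (nu c : R) : 0 <= c ->
  (forall t, 0 <= t <= c -> 0 < F_norm2 nu t) ->
  continuity_pt (fun v => F_arg v c) nu.
Proof.
  intros Hc Hpos.
  destruct (continuity_ab_min (F_norm2 nu) 0 c Hc) as [tm [Hmin Htm]].
  { intros t _. apply continuity_pt_filterlim, F_norm2_continuous. }
  set (m := F_norm2 nu tm) in *. assert (Hm : 0 < m) by now apply Hpos.
  set (E := exp c). assert (HE : 0 < E) by apply exp_pos.
  set (K := 4 * (2 * E ^ 2) / m ^ 2 * (8 * E ^ 2)).
  apply continuity_pt_of_local_lipschitz with (L := c * K) (d := m / 2 / (8 * E ^ 2)).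
  { apply Rdiv_lt_0_compat; [lra|]. assert (0 < E ^ 2) by now apply pow_lt. lra. }
  intros v Hv.
  assert (HvE : 8 * E ^ 2 * Rabs (v - nu) <= m / 2).
  { assert (HE2 : 0 < 8 * E ^ 2) by (assert (0 < E ^ 2) by (now apply pow_lt); lra).
    apply Rmult_lt_compat_l with (r := 8 * E ^ 2) in Hv; trivial.
    replace (8 * E ^ 2 * (m / 2 / (8 * E ^ 2))) with (m / 2) in Hv by (field; lra). lra. }
  assert (Hloc : forall t, 0 <= t <= c ->
     Rabs (F_cross v t - F_cross nu t) <= 8 * E ^ 2 * Rabs (v - nu) /\
     Rabs (F_norm2 v t - F_norm2 nu t) <= 8 * E ^ 2 * Rabs (v - nu) /\
     Rabs (F_cross nu t) <= 2 * E ^ 2 /\ Rabs (F_norm2 nu t) <= 2 * E ^ 2 /\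
     m / 2 <= F_norm2 v t).
  { intros t Ht. destruct (F_quadratic_lipschitz v nu t) as [H1 [H2 [H3 H4]]].
    rewrite (Rabs_pos_eq t) in * by lra.
    assert (Het : exp t ^ 2 <= E ^ 2).
    { apply pow_incr. split; [left; apply exp_pos|]. apply exp_mono; lra. }
    assert (Hv0 := Rabs_pos (v - nu)).
    assert (H2' : Rabs (F_norm2 v t - F_norm2 nu t) <= 8 * E ^ 2 * Rabs (v - nu)) by nra.
    repeat split; trivial; try nra.
    apply Rabs_le_between in H2'. specialize (Hmin t Ht). lra. }
  assert (Hex : forall w, (forall t, 0 <= t <= c -> 0 < F_norm2 w t) ->
            ex_RInt (fun t => F_cross w t / F_norm2 w t) 0 c).
  { intros w Hw. apply (ex_RInt_continuous (V := R_CompleteNormedModule)).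
    intros t Ht. rewrite Rmin_left, Rmax_right in Ht by trivial.
    apply F_rate_continuous, Hw; lra. }
  assert (Hexv : ex_RInt (fun t => F_cross v t / F_norm2 v t) 0 c).
  { apply Hex. intros t Ht. destruct (Hloc t Ht) as [_ [_ [_ [_ H]]]]. lra. }
  specialize (Hex nu Hpos). unfold F_arg.
  change (Rabs (minus (RInt (fun t => F_cross v t / F_norm2 v t) 0 c)
                (RInt (fun t => F_cross nu t / F_norm2 nu t) 0 c)) <= c * K * Rabs (v - nu)).
  rewrite <- (RInt_minus (V := R_CompleteNormedModule)) by trivial.
  replace (c * K * Rabs (v - nu)) with ((c - 0) * (K * Rabs (v - nu))) by ring.
  apply (norm_RInt_le_const (V := R_NormedModule) (fun t => minus (F_cross v t / F_norm2 v t)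
           (F_cross nu t / F_norm2 nu t)) 0 c).
  - trivial.
  - intros t Ht. change (Rabs (F_cross v t / F_norm2 v t - F_cross nu t / F_norm2 nu t)
                          <= K * Rabs (v - nu)).
    destruct (Hloc t Ht) as [H1 [H2 [H3 [H4 H5]]]].
    unfold K. rewrite (Rmult_assoc (4 * (2 * E ^ 2) / m ^ 2)).
    apply quotient_diff_le; trivial. now apply Hmin.
  - apply (RInt_correct (V := R_CompleteNormedModule)).
    apply (ex_RInt_minus (V := R_NormedModule)); trivial.
Qed.

Lemma Series_nonneg (a : nat -> R) : (forall n, 0 <= a n) -> ex_series a -> 0 <= Series a.
Proof.
  intros H He. rewrite <- (PSeries_const_0 0). apply Series_le; trivial.
  intros n. rewrite Rmult_0_l. split; [lra|apply H].
Qed.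

Lemma F_re_0_ge_1 (c : R) : 0 <= c -> 1 <= F_re 0 c.
Proof.
  intros Hc. unfold F_re. rewrite PSeries_decr_1 by apply CV_radius_inside, hyp_re_radius.
  replace (hyp_re 0 0) with 1 by (unfold hyp_re; simpl; rewrite cos_0; field).
  assert (0 <= PSeries (PS_decr_1 (hyp_re 0)) c).
  { apply Series_nonneg.
    - intros n. apply Rmult_le_pos; [|now apply pow_le].
      unfold PS_decr_1, hyp_re. rewrite euler_mod_0, euler_arg_0, cos_0.
      apply Rmult_le_pos; [lra|]. left; apply Rinv_0_lt_compat, pow_lt, INR_fact_lt_0.
    - apply (proj1 (ex_pseries_R (PS_decr_1 (hyp_re 0)) c)).
      apply ex_pseries_decr_1; [|apply CV_radius_inside, hyp_re_radius].
      destruct (Req_dec c 0) as [E|E]; [now left|].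
      right. now exists (/ c); apply Rinv_l. }
  nra.
Qed.

Lemma F_im_0 (c : R) : F_im 0 c = 0 /\ F_im' 0 c = 0.
Proof.
  assert (H : forall k, hyp_im 0 k = 0).
  { intros k. unfold hyp_im. rewrite euler_arg_0, sin_0. unfold Rdiv. ring. }
  split.
  - unfold F_im. rewrite (PSeries_ext _ (fun _ => 0)) by trivial. apply PSeries_const_0.
  - unfold F_im'. rewrite (PSeries_ext _ (fun _ => 0)); [apply PSeries_const_0|].
    intros k. unfold PS_derive. rewrite H. ring.
Qed.

Lemma theta_0 (s : R) : theta 0 s = 0.
Proof.
  unfold theta, F_arg. rewrite gamma_arg_0.
  rewrite (RInt_ext _ (fun _ => 0)).
  - rewrite (RInt_const (V := R_CompleteNormedModule)). change scal with Rmult. lra.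
  - intros t _. destruct (F_im_0 t) as [E1 E2].
    assert (E : F_cross 0 t / F_norm2 0 t = 0)
      by (unfold F_cross; rewrite E1, E2; unfold Rdiv; ring).
    exact E.
Qed.

(** At nu = 0 the Wronskian identity says nothing about |F|, but then F >= 1. *)
Lemma theta_continuous (nu s : R) : continuity_pt (fun v => theta v s) nu.
Proof.
  assert (H1 : continuity_pt gamma_arg nu).
  { apply continuity_pt_of_local_lipschitz with (d := 1) (L := 2 + (Rabs nu + 1) ^ 2); [lra|].
    intros v Hv. apply gamma_arg_lipschitz.
    + replace v with (nu + (v - nu)) by ring. eapply Rle_trans; [apply Rabs_triang|]. lra.
    + lra. }
  assert (H2 : continuity_pt (fun v => v * s / 2) nu).
  { apply continuity_pt_filterlim.
    apply (ex_derive_continuous (V := R_NormedModule) (fun v => v * s / 2)).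
    auto_derive; trivial. }
  assert (H3 : continuity_pt (fun v => F_arg v (exp s)) nu).
  { apply F_arg_continuous; [left; apply exp_pos|].
    intros t Ht. destruct (Req_dec nu 0) as [->|Hnu]; [|now apply F_norm2_pos].
    unfold F_norm2. assert (H := F_re_0_ge_1 t (proj1 Ht)).
    generalize (pow2_ge_0 (F_im 0 t)). nra. }
  exact (continuity_pt_minus _ _ _ (continuity_pt_minus _ _ _ H1 H2) H3).
Qed.

(** * Concentration of the series for large argument *)

(** The terms of I_0(x), as weights of a measure on the indices k. The identity
    k^2 a_k = c a_(k-1) gives its moments, which show that it concentrates at k = sqrt c. *)
Definition bessel_weight (c : R) (k : nat) : R := c ^ k / INR (fact k) ^ 2.

Lemma bessel_weight_pos (c : R) (k : nat) : 0 < c -> 0 < bessel_weight c k.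
Proof.
  intros Hc. apply Rdiv_lt_0_compat; [now apply pow_lt|apply pow_lt, INR_fact_lt_0].
Qed.

Lemma bessel_weight_S (c : R) (k : nat) :
  bessel_weight c (S k) * INR (S k) ^ 2 = c * bessel_weight c k.
Proof.
  unfold bessel_weight. replace (fact (S k)) with (S k * fact k)%nat by reflexivity.
  rewrite mult_INR. assert (H1 := INR_S_pos k). assert (H2 := INR_fact_lt_0 k).
  simpl (c ^ S k). field. lra.
Qed.

Lemma is_series_ext_R (a b : nat -> R) (l : R) :
  (forall n, a n = b n) -> is_series a l -> is_series b l.
Proof. exact (is_series_ext a b l). Qed.

Lemma is_series_lin (x y : R) (f g : nat -> R) (lf lg : R) :
  is_series f lf -> is_series g lg ->
  is_series (fun k => x * f k + y * g k) (x * lf + y * lg).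
Proof.
  intros Hf Hg.
  apply (is_series_plus (K := R_AbsRing) (V := R_NormedModule) (fun k => x * f k) (fun k => y * g k)).
  - apply (is_series_scal_l (K := R_AbsRing) (V := R_NormedModule) x f lf Hf).
  - apply (is_series_scal_l (K := R_AbsRing) (V := R_NormedModule) y g lg Hg).
Qed.

Lemma is_series_bessel_weight (c : R) : is_series (bessel_weight c) (F_re 0 c).
Proof.
  apply is_series_ext_R with (fun k => hyp_re 0 k * c ^ k).
  - intros k. unfold hyp_re, bessel_weight. rewrite euler_mod_0, euler_arg_0, cos_0.
    unfold Rdiv. ring_simplify. reflexivity.
  - apply (is_series_PSeries (hyp_re 0)), hyp_re_radius.
Qed.

Lemma is_series_weight_square (c : R) :
  is_series (fun k => INR k ^ 2 * bessel_weight c k) (c * F_re 0 c).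
Proof.
  apply is_series_decr_1.
  change (is_series (fun k => INR (S k) ^ 2 * bessel_weight c (S k))
           (c * F_re 0 c + - (INR 0 ^ 2 * bessel_weight c 0))).
  replace (c * F_re 0 c + - (INR 0 ^ 2 * bessel_weight c 0))
    with (c * F_re 0 c + 0 * F_re 0 c) by (simpl; ring).
  apply is_series_ext_R with (fun k => c * bessel_weight c k + 0 * bessel_weight c k).
  - intros k. rewrite (Rmult_comm (_ ^ 2)), bessel_weight_S. ring.
  - apply is_series_lin; apply is_series_bessel_weight.
Qed.

Lemma is_series_weight_shift (c : R) :
  is_series (fun k => bessel_weight c (S k)) (F_re 0 c - 1).
Proof.
  apply is_series_incr_1.
  change (is_series (bessel_weight c) (F_re 0 c - 1 + bessel_weight c 0)).
  replace (F_re 0 c - 1 + bessel_weight c 0) with (F_re 0 c)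
    by (unfold bessel_weight; simpl; field).
  apply is_series_bessel_weight.
Qed.

(** The real part of F e^(iw), term by term. *)
Lemma F_rotated (nu c w : R) :
  is_series (fun k => bessel_weight c k * euler_mod k nu * cos (w - euler_arg k nu))
    (F_re nu c * cos w - F_im nu c * sin w).
Proof.
  assert (H1 : is_series (fun k => hyp_re nu k * c ^ k) (F_re nu c))
    by (apply (is_series_PSeries (hyp_re nu)), hyp_re_radius).
  assert (H2 : is_series (fun k => hyp_im nu k * c ^ k) (F_im nu c))
    by (apply (is_series_PSeries (hyp_im nu)), hyp_im_radius).
  assert (H := is_series_lin (cos w) (- sin w) _ _ _ _ H1 H2).
  replace (F_re nu c * cos w - F_im nu c * sin w)
    with (cos w * F_re nu c + - sin w * F_im nu c) by ring.
  revert H. apply is_series_ext_R. intros k. rewrite cos_minus.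
  unfold hyp_re, hyp_im, bessel_weight, Rdiv. ring.
Qed.

(** Argument of the term of index k in the series of I_{i nu}(x), up to a positive factor. *)
Definition hyp_phase (nu s : R) (k : nat) : R :=
  nu * s / 2 - gamma_arg nu - euler_arg k nu.

(** gamma_arg nu + euler_arg k nu is nu ln (k + 1) up to O(1/k), by the tail estimate for
    Euler's product. *)
Lemma hyp_phase_error (nu s : R) (k : nat) :
  Rabs (hyp_phase nu s k - nu * (s / 2 - ln (INR (S k))))
  <= (2 + nu ^ 2) * Rabs nu / INR (S k).
Proof.
  assert (H := gamma_arg_tail nu k). unfold gamma_arg_seq in H.
  rewrite euler_arg_S in H.
  assert (Hk := INR_S_pos k).
  assert (H2 := atan_lipschitz 0 (nu / INR (S k))). rewrite atan_0, !Rminus_0_r in H2.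
  rewrite Rabs_div, (Rabs_pos_eq (INR (S k))) in H2 by lra.
  unfold hyp_phase.
  replace (_ - _) with (- ((gamma_arg nu - (nu * ln (INR (S k))
      - (euler_arg k nu + atan (nu / INR (S k)))))) + atan (nu / INR (S k))) by field.
  eapply Rle_trans; [apply Rabs_triang|]. rewrite Rabs_Ropp.
  unfold Rdiv in *. lra.
Qed.

(** s/2 - ln (k+1) is minus half the logarithm of (k+1)^2 / c, to which ln_sq_le applies. The
    square of k + 1, rather than that of k, makes c a_k / (k+1)^2 = a_(k+1) summable as it stands. *)
Lemma hyp_phase_sqr_le (nu s : R) (k : nat) :
  hyp_phase nu s k ^ 2
  <= nu ^ 2 / 2 * (INR (S k) ^ 2 / exp s + exp s / INR (S k) ^ 2 - 2)
     + 2 * ((2 + nu ^ 2) * nu) ^ 2 / INR (S k) ^ 2.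
Proof.
  assert (Hk := INR_S_pos k). assert (Hc := exp_pos s).
  assert (He := hyp_phase_error nu s k).
  set (t := INR (S k)) in *. set (y := nu * (s / 2 - ln t)) in *.
  set (p := hyp_phase nu s k) in *.
  assert (H1 : p ^ 2 <= 2 * y ^ 2 + 2 * (p - y) ^ 2) by (generalize (pow2_ge_0 (p - 2 * y)); lra).
  assert (H2 : (p - y) ^ 2 <= ((2 + nu ^ 2) * nu) ^ 2 / t ^ 2).
  { rewrite <- (pow2_abs (p - y)).
    replace (((2 + nu ^ 2) * nu) ^ 2 / t ^ 2) with (((2 + nu ^ 2) * Rabs nu / t) ^ 2).
    - apply pow_incr. split; [apply Rabs_pos|exact He].
    - unfold Rdiv. rewrite !Rpow_mult_distr, pow2_abs, pow_inv. reflexivity. }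
  assert (H3 : y ^ 2 <= nu ^ 2 / 4 * (t ^ 2 / exp s + exp s / t ^ 2 - 2)).
  { assert (Hl := ln_sq_le (t ^ 2 / exp s) ltac:(apply Rdiv_lt_0_compat; [now apply pow_lt|trivial])).
    rewrite ln_div, ln_exp, ln_pow in Hl by (trivial; now apply pow_lt).
    replace (/ (t ^ 2 / exp s)) with (exp s / t ^ 2) in Hl by (field; lra).
    unfold y. replace ((nu * (s / 2 - ln t)) ^ 2)
      with (nu ^ 2 / 4 * (INR 2 * ln t - s) ^ 2) by (simpl INR; field).
    apply Rmult_le_compat_l; [generalize (pow2_ge_0 nu); lra|exact Hl]. }
  lra.
Qed.

Definition concentration_rate (V : R) : R :=
  (V ^ 2 + ((2 + V ^ 2) * V) ^ 2) * exp (2 * V ^ 2).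

Lemma weighted_phase_bound (nu s : R) (k : nat) : 0 <= s ->
  let c := exp s in let sg := exp (s / 2) in let a := bessel_weight c in
  a k * hyp_phase nu s k ^ 2
  <= nu ^ 2 / 2 * ((1 + / sg) / c * (INR k ^ 2 * a k) + ((sg + 1) / c - 2) * a k + a (S k))
     + 2 * ((2 + nu ^ 2) * nu) ^ 2 / c * a (S k).
Proof.
  intros Hs c sg a.
  assert (Hc : 0 < c) by apply exp_pos. assert (Hsg : 0 < sg) by apply exp_pos.
  assert (Ha : 0 < a k) by now apply bessel_weight_pos.
  assert (Hk := INR_S_pos k).
  assert (HS : a (S k) = c * a k / INR (S k) ^ 2).
  { unfold a at 2. rewrite <- bessel_weight_S. unfold a. field. lra. }
  assert (H := Rmult_le_compat_l (a k) _ _ (Rlt_le _ _ Ha) (hyp_phase_sqr_le nu s k)).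
  eapply Rle_trans; [exact H|]. fold c. rewrite HS.
  set (D := ((2 + nu ^ 2) * nu) ^ 2) in *.
  assert (Hq : INR (S k) ^ 2 <= (1 + / sg) * INR k ^ 2 + (sg + 1)).
  { rewrite S_INR. set (t := INR k).
    assert (0 <= / sg * (t - sg) ^ 2)
      by (apply Rmult_le_pos; [left; now apply Rinv_0_lt_compat|apply pow2_ge_0]).
    replace (/ sg * (t - sg) ^ 2) with (/ sg * t ^ 2 - 2 * t + sg) in H0 by (field; lra). lra. }
  assert (Hq' : nu ^ 2 / 2 * (a k / c) * INR (S k) ^ 2
                <= nu ^ 2 / 2 * (a k / c) * ((1 + / sg) * INR k ^ 2 + (sg + 1))).
  { apply Rmult_le_compat_l; trivial.
    apply Rmult_le_pos; [generalize (pow2_ge_0 nu); lra|].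
    left; now apply Rdiv_lt_0_compat. }
  set (t := INR (S k)) in *. set (q := INR k) in *. set (x := a k) in *.
  replace (x * (nu ^ 2 / 2 * (t ^ 2 / c + c / t ^ 2 - 2) + 2 * D / t ^ 2))
    with (nu ^ 2 / 2 * (x / c) * t ^ 2 + (nu ^ 2 / 2 * x * (c / t ^ 2 - 2) + 2 * D * x / t ^ 2))
    by (field; lra).
  replace (nu ^ 2 / 2 * ((1 + / sg) / c * (q ^ 2 * x) + ((sg + 1) / c - 2) * x + c * x / t ^ 2)
     + 2 * D / c * (c * x / t ^ 2))
    with (nu ^ 2 / 2 * (x / c) * ((1 + / sg) * q ^ 2 + (sg + 1))
          + (nu ^ 2 / 2 * x * (c / t ^ 2 - 2) + 2 * D * x / t ^ 2)) by (field; lra).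
  lra.
Qed.

(** The means of (k+1)^2 / c and of c / (k+1)^2 are both at most 1 + O(1 / sqrt c), and
    ln_sq_le subtracts 2 from their sum: the mean square of the phases is O(1 / sqrt c). *)
Lemma weighted_phase_sum (nu s : R) : 0 <= s ->
  let c := exp s in let sg := exp (s / 2) in
  exists f : nat -> R,
    (forall k, bessel_weight c k * hyp_phase nu s k ^ 2 <= f k) /\
    exists S, is_series f S /\
      S <= 2 * (nu ^ 2 + ((2 + nu ^ 2) * nu) ^ 2) / sg * F_re 0 c.
Proof.
  intros Hs c sg. set (a := bessel_weight c). set (A := F_re 0 c).
  assert (Hc : 0 < c) by apply exp_pos. assert (Hsg : 0 < sg) by apply exp_pos.
  assert (Hsg1 : 1 <= sg) by (unfold sg; rewrite <- exp_0; apply exp_mono; lra).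
  assert (Ec : c = sg * sg) by (unfold c, sg; rewrite <- exp_plus; f_equal; field).
  assert (HA : 1 <= A) by (apply F_re_0_ge_1; lra).
  eexists. split; [intros k; now apply weighted_phase_bound|]. fold c sg a.
  eexists. split.
  - assert (H0 := is_series_bessel_weight c). assert (H1 := is_series_weight_square c).
    assert (H2 := is_series_weight_shift c). fold a A in H0, H1, H2.
    assert (H3 := is_series_lin ((1 + / sg) / c) ((sg + 1) / c - 2) _ _ _ _ H1 H0).
    assert (H4 := is_series_lin 1 1 _ _ _ _ H3 H2).
    assert (H5 := is_series_lin (nu ^ 2 / 2) (2 * ((2 + nu ^ 2) * nu) ^ 2 / c) _ _ _ _ H4 H2).
    revert H5. apply is_series_ext_R. intros k. cbv beta. ring.
  - set (D := ((2 + nu ^ 2) * nu) ^ 2). set (N := nu ^ 2).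
    assert (HD : 0 <= D) by apply pow2_ge_0. assert (HN : 0 <= N) by apply pow2_ge_0.
    assert (H1 : N / 2 * (1 * ((1 + / sg) / c * (c * A) + ((sg + 1) / c - 2) * A) + 1 * (A - 1))
      <= N / 2 * (4 / sg * A)).
    { apply Rmult_le_compat_l; [lra|].
      replace (1 * ((1 + / sg) / c * (c * A) + ((sg + 1) / c - 2) * A) + 1 * (A - 1))
        with ((2 / sg + / c) * A - 1) by (rewrite Ec; field; lra).
      assert (/ c <= / sg) by (rewrite Ec; apply Rinv_le_contravar; nra).
      assert (0 < / sg) by now apply Rinv_0_lt_compat.
      assert ((2 / sg + / c) * A <= 4 / sg * A) by (apply Rmult_le_compat_r; lra). lra. }
    assert (H2 : 2 * D / c * (A - 1) <= 2 * D / sg * A).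
    { apply Rmult_le_compat; try lra.
      - apply Rmult_le_pos; [lra|left; now apply Rinv_0_lt_compat].
      - apply Rmult_le_compat_l; [lra|]. rewrite Ec; apply Rinv_le_contravar; nra. }
    replace (2 * (N + D) / sg * A) with (N / 2 * (4 / sg * A) + 2 * D / sg * A) by (field; lra).
    lra.
Qed.

(** The phases of the terms of I_{i nu}(x) are small in mean square, so the sum is nearly as
    large as the sum of the moduli, and nearly real and positive. The weights carry the factor
    euler_mod, whose lower bound costs exp (2 V^2). The estimate is uniform in nu <= V. *)
Lemma cos_theta_lower (V nu s : R) : 0 < nu <= V -> 0 <= s ->
  concentration_rate V / exp (s / 2) <= 1 ->
  1 - concentration_rate V / exp (s / 2) <= cos (theta nu s).
Proof.
  intros Hnu Hs Hle.
  set (c := exp s). set (sg := exp (s / 2)) in *. set (delta := concentration_rate V / sg) in *.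
  assert (Hc : 0 < c) by apply exp_pos. assert (Hsg : 0 < sg) by apply exp_pos.
  set (W := fun k => bessel_weight c k * euler_mod k nu).
  assert (Ha : forall k, 0 < bessel_weight c k) by (intros; now apply bessel_weight_pos).
  assert (HW0 : forall k, 0 <= W k)
    by (intros k; apply Rmult_le_pos; left; [apply Ha|apply euler_mod_pos]).
  assert (HexA : ex_series (bessel_weight c)) by (eexists; apply is_series_bessel_weight).
  assert (HWle : forall k, W k <= bessel_weight c k).
  { intros k. unfold W. rewrite <- (Rmult_1_r (bessel_weight c k)) at 2.
    apply Rmult_le_compat_l; [left; apply Ha|apply euler_mod_le_1]. }
  assert (HexW : ex_series W).
  { apply (ex_series_le (V := R_CompleteNormedModule) W (bessel_weight c)); trivial.
    intros k. change (Rabs (W k) <= bessel_weight c k). now rewrite Rabs_pos_eq. }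
  assert (EA : Series (bessel_weight c) = F_re 0 c)
    by apply is_series_unique, is_series_bessel_weight.
  assert (Hm : modulus nu s <= Series W).
  { destruct (F_polar nu c ltac:(lra)) as [E1 E2].
    assert (HR := F_rotated nu c (- F_arg nu c)).
    rewrite cos_neg, sin_neg in HR.
    replace (F_re nu c * cos (F_arg nu c) - F_im nu c * - sin (F_arg nu c))
      with (modulus nu s) in HR.
    - apply is_series_unique in HR as HR'. rewrite <- HR'.
      assert (Hx : ex_series (fun k => W k * cos (- F_arg nu c - euler_arg k nu))) by (eexists; apply HR).
      assert (Hmin : 0 <= Series (fun k => W k - W k * cos (- F_arg nu c - euler_arg k nu))).
      { apply Series_nonneg.
        - intros k. generalize (HW0 k) (COS_bound (- F_arg nu c - euler_arg k nu)). nra.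
        - apply (ex_series_minus (K := R_AbsRing) (V := R_NormedModule) W _); trivial. }
      rewrite Series_minus in Hmin by trivial. unfold W in Hmin at 2. lra.
    - rewrite E1, E2. unfold modulus. fold c.
      assert (H1 := sin2_cos2 (F_arg nu c)). unfold Rsqr in H1.
      set (q := cos (F_arg nu c)) in *. set (p := sin (F_arg nu c)) in *.
      transitivity (sqrt (F_norm2 nu c) * (p * p + q * q)); [rewrite H1; ring|ring]. }
  assert (Hv : Series W * (1 - delta) <= modulus nu s * cos (theta nu s)).
  { rewrite cos_theta_eq by lra. fold c.
    assert (HR := F_rotated nu c (nu * s / 2 - gamma_arg nu)).
    apply is_series_unique in HR as HR'. rewrite <- HR'.
    destruct (weighted_phase_sum nu s Hs) as [f [Hf [S [HS HSle]]]]. fold c sg in Hf, HSle.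
    assert (HWlow : exp (- (2 * V ^ 2)) * F_re 0 c <= Series W).
    { rewrite <- EA, <- Series_scal_l. apply Series_le; trivial.
      intros k. split.
      - apply Rmult_le_pos; [left; apply exp_pos|left; apply Ha].
      - unfold W. rewrite Rmult_comm. apply Rmult_le_compat_l; [left; apply Ha|].
        eapply Rle_trans; [|apply euler_mod_lower]. apply exp_mono.
        assert (nu ^ 2 <= V ^ 2) by (apply pow_incr; lra). lra. }
    assert (HSW : S <= 2 * delta * Series W).
    { assert (HVn : nu ^ 2 + ((2 + nu ^ 2) * nu) ^ 2 <= V ^ 2 + ((2 + V ^ 2) * V) ^ 2).
      { assert (nu ^ 2 <= V ^ 2) by (apply pow_incr; lra).
        assert (0 <= nu ^ 2) by apply pow2_ge_0.
        assert (((2 + nu ^ 2) * nu) ^ 2 <= ((2 + V ^ 2) * V) ^ 2)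
          by (apply pow_incr; split; [nra|apply Rmult_le_compat; lra]). lra. }
      eapply Rle_trans; [exact HSle|].
      apply Rle_trans with (2 * delta * (exp (- (2 * V ^ 2)) * F_re 0 c)).
      - unfold delta, concentration_rate. rewrite exp_Ropp.
        assert (He := exp_pos (2 * V ^ 2)).
        replace (2 * ((V ^ 2 + ((2 + V ^ 2) * V) ^ 2) * exp (2 * V ^ 2) / sg) *
          (/ exp (2 * V ^ 2) * F_re 0 c)) with
          (2 * (V ^ 2 + ((2 + V ^ 2) * V) ^ 2) / sg * F_re 0 c) by (field; lra).
        assert (HA : 1 <= F_re 0 c) by (apply F_re_0_ge_1; lra).
        apply Rmult_le_compat_r; [lra|]. apply Rmult_le_compat_r; [left; now apply Rinv_0_lt_compat|].
        lra.
      - apply Rmult_le_compat_l; trivial. unfold delta, concentration_rate, Rdiv.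
        assert (0 < / sg) by now apply Rinv_0_lt_compat.
        assert (He := exp_pos (2 * V ^ 2)).
        assert (0 <= V ^ 2) by apply pow2_ge_0.
        assert (0 <= ((2 + V ^ 2) * V) ^ 2) by apply pow2_ge_0.
        apply Rmult_le_pos; [lra|]. apply Rmult_le_pos; [|lra]. apply Rmult_le_pos; lra. }
    assert (HexC : ex_series (fun k => W k * cos (nu * s / 2 - gamma_arg nu - euler_arg k nu)))
      by (eexists; apply HR).
    assert (Hexf : ex_series (fun k => / 2 * f k)).
    { apply (ex_series_scal_l (K := R_AbsRing) (/ 2) f). eexists; exact HS. }
    assert (Hnn : 0 <= Series (fun k => (W k * cos (nu * s / 2 - gamma_arg nu - euler_arg k nu)
                    + / 2 * f k) - W k)).
    { apply Series_nonneg.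
      - intros k. change (nu * s / 2 - gamma_arg nu - euler_arg k nu) with (hyp_phase nu s k).
        specialize (Hf k). assert (Hq := cos_ge_quadratic (hyp_phase nu s k)).
        assert (Hp := pow2_ge_0 (hyp_phase nu s k)).
        assert (HWk := HW0 k). assert (HWk' := HWle k).
        assert (W k * (1 - hyp_phase nu s k ^ 2 / 2) <= W k * cos (hyp_phase nu s k))
          by now apply Rmult_le_compat_l.
        assert (W k * hyp_phase nu s k ^ 2 <= bessel_weight c k * hyp_phase nu s k ^ 2)
          by now apply Rmult_le_compat_r. lra.
      - apply (ex_series_minus (K := R_AbsRing) (V := R_NormedModule)
          (fun k => W k * cos (nu * s / 2 - gamma_arg nu - euler_arg k nu) + / 2 * f k) W); trivial.
        apply (ex_series_plus (K := R_AbsRing) (V := R_NormedModule)); trivial. }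
    rewrite Series_minus, Series_plus, Series_scal_l in Hnn; trivial.
    - rewrite (is_series_unique _ _ HS) in Hnn. fold (W). unfold W in Hnn at 1. lra.
    - apply (ex_series_plus (K := R_AbsRing) (V := R_NormedModule)); trivial. }
  assert (Hmp := modulus_pos nu s ltac:(lra)).
  assert (Hfin : modulus nu s * (1 - delta) <= Series W * (1 - delta))
    by (apply Rmult_le_compat_r; lra).
  apply Rmult_le_reg_l with (modulus nu s); trivial. lra.
Qed.

(** * Sturm comparison in the order *)

Lemma concentration_rate_small (V eps : R) : 0 < eps ->
  exists s0, 0 <= s0 /\ forall s, s0 <= s -> concentration_rate V / exp (s / 2) < eps.
Proof.
  intros He. set (K := concentration_rate V).
  assert (HK : 0 <= K).
  { unfold K, concentration_rate. apply Rmult_le_pos; [|left; apply exp_pos].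
    generalize (pow2_ge_0 V) (pow2_ge_0 ((2 + V ^ 2) * V)). lra. }
  exists (2 * (K / eps)). assert (HKe : 0 <= K / eps) by (apply Rmult_le_pos; [lra|left; now apply Rinv_0_lt_compat]).
  split; [lra|]. intros s Hs.
  assert (Hx := exp_pos (s / 2)). assert (H1 := exp_ineq1_le (s / 2)).
  apply Rmult_lt_reg_r with (exp (s / 2)); trivial.
  replace (K / exp (s / 2) * exp (s / 2)) with K by (field; lra).
  apply Rlt_le_trans with (eps * (1 + s / 2)).
  - replace K with (eps * (K / eps)) at 1 by (field; lra). apply Rmult_lt_compat_l; lra.
  - apply Rmult_le_compat_l; lra.
Qed.

(** For s large, cos theta > 0 for all nu in (0, V]. As theta = 0 at nu = 0 and theta is
    continuous in nu, it cannot leave (- pi/2, pi/2). This fixes the branch of the phase. *)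
Lemma theta_bounded_far (V : R) : 0 < V ->
  exists s0, forall s nu, s0 <= s -> 0 <= nu <= V -> Rabs (theta nu s) < PI / 2.
Proof.
  intros HV. destruct (concentration_rate_small V 1 Rlt_0_1) as [s0 [Hs0 H]].
  exists s0. intros s nu Hs Hnu. specialize (H s Hs).
  assert (HP := PI_RGT_0).
  assert (Hne : forall v, 0 <= v <= V -> Rabs (theta v s) <> PI / 2).
  { intros v Hv E. destruct (proj1 Hv) as [Hv0|Hv0].
    - assert (H1 := cos_theta_lower V v s ltac:(lra) ltac:(lra) ltac:(lra)).
      assert (Hc : cos (theta v s) = cos (Rabs (theta v s)))
        by (unfold Rabs; destruct (Rcase_abs (theta v s)); trivial; now rewrite cos_neg).
      rewrite Hc, E, cos_PI2 in H1. lra.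
    - rewrite <- Hv0, theta_0, Rabs_R0 in E. lra. }
  destruct (Rlt_dec (Rabs (theta nu s)) (PI / 2)) as [Hd|Hd]; trivial. exfalso.
  assert (Hn := Hne nu Hnu).
  destruct (IVT_interv (fun v => Rabs (theta v s) - PI / 2) 0 nu) as [z [Hz Ez]].
  - intros a _. apply continuity_pt_minus; [|apply continuity_pt_const; now intros x y].
    apply (continuity_pt_comp (fun v => theta v s) Rabs); [apply theta_continuous|].
    apply Rcontinuity_abs.
  - destruct (proj1 Hnu) as [Hp|Hp]; trivial. rewrite <- Hp, theta_0, Rabs_R0 in Hd. lra.
  - rewrite theta_0, Rabs_R0. lra.
  - lra.
  - apply (Hne z); lra.
Qed.

Lemma theta_vanishes (nu eps : R) : 0 < nu -> 0 < eps ->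
  exists s0, forall s, s0 <= s -> Rabs (theta nu s) < eps.
Proof.
  intros Hnu Heps. assert (HP := PI_RGT_0).
  set (e := Rmin eps (PI / 4)).
  assert (He : 0 < e) by (apply Rmin_pos; lra).
  assert (He' : e <= PI / 4) by apply Rmin_r.
  assert (Hce : cos e < 1).
  { rewrite <- cos_0. apply cos_decreasing_1; lra. }
  destruct (theta_bounded_far nu Hnu) as [s1 H1].
  destruct (concentration_rate_small nu (1 - cos e) ltac:(lra)) as [s2 [Hs2 H2]].
  exists (Rmax s1 s2). intros s Hs.
  assert (Hs1 := Rle_trans _ _ _ (Rmax_l _ _) Hs). assert (Hs2' := Rle_trans _ _ _ (Rmax_r _ _) Hs).
  specialize (H1 s nu Hs1 ltac:(lra)). specialize (H2 s Hs2').
  assert (0 < cos e) by (apply cos_gt_0; lra).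
  assert (Hc := cos_theta_lower nu nu s ltac:(lra) ltac:(lra) ltac:(lra)).
  apply Rlt_le_trans with e; [|apply Rmin_l].
  destruct (Rlt_dec (Rabs (theta nu s)) e) as [Hd|Hd]; trivial. exfalso.
  assert (Hcos : cos (theta nu s) = cos (Rabs (theta nu s))).
  { unfold Rabs. destruct (Rcase_abs (theta nu s)); trivial. now rewrite cos_neg. }
  assert (cos (Rabs (theta nu s)) <= cos e) by (apply cos_decr_1; lra). lra.
Qed.

Lemma strict_decr_of_derive (f df : R -> R) (a b : R) :
  a < b -> (forall x, a <= x <= b -> is_derive f x (df x)) ->
  (forall x, a < x < b -> df x < 0) -> f b < f a.
Proof.
  intros Hab Hd Hneg.
  destruct (MVT_cor2 f df a b Hab) as [c [E Hc]].
  - intros x Hx. now apply is_derive_Reals, Hd.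
  - assert (df c < 0) by now apply Hneg. nra.
Qed.

Lemma theta_decreasing (nu s t : R) : 0 < nu -> s < t -> theta nu t < theta nu s.
Proof.
  intros Hnu Hst.
  apply strict_decr_of_derive with (df := fun x => - (nu / 2 / modulus nu x ^ 2)); trivial.
  - intros x _. apply theta_derive; lra.
  - intros x _. assert (Hm := modulus_pos nu x ltac:(lra)).
    assert (0 < nu / 2 / modulus nu x ^ 2)
      by (apply Rdiv_lt_0_compat; [lra|now apply pow_lt]). lra.
Qed.

Lemma theta_positive (nu s : R) : 0 < nu -> 0 < theta nu s.
Proof.
  intros Hnu. destruct (Rlt_dec 0 (theta nu s)) as [H|H]; trivial. exfalso.
  assert (H1 := theta_decreasing nu s (s + 1) Hnu ltac:(lra)).
  destruct (theta_vanishes nu (- theta nu (s + 1)) Hnu ltac:(lra)) as [s0 Hs0].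
  set (t := Rmax s0 (s + 2)). assert (Ht0 : s0 <= t) by apply Rmax_l.
  assert (Ht1 : s + 2 <= t) by apply Rmax_r.
  assert (H2 := theta_decreasing nu (s + 1) t Hnu ltac:(lra)).
  specialize (Hs0 t Ht0). rewrite Rabs_left in Hs0 by lra. lra.
Qed.

Lemma theta_onto (nu s y : R) : 0 < nu -> 0 < y < theta nu s ->
  exists t, s < t /\ theta nu t = y.
Proof.
  intros Hnu Hy.
  destruct (theta_vanishes nu y Hnu ltac:(lra)) as [s0 Hs0].
  set (b := Rmax s0 (s + 1)). assert (Hb0 : s0 <= b) by apply Rmax_l.
  assert (Hb1 : s + 1 <= b) by apply Rmax_r.
  specialize (Hs0 b Hb0). apply Rabs_lt_between in Hs0.
  destruct (IVT_interv (fun t => y - theta nu t) s b) as [z [Hz Ez]].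
  - intros a _. apply continuity_pt_minus.
    + apply continuity_pt_const. now intros u v.
    + apply derivable_continuous_pt. eexists. apply is_derive_Reals, theta_derive. lra.
  - lra.
  - lra.
  - lra.
  - exists z. split; [|lra].
    destruct (proj1 Hz) as [Hp|Hp]; trivial. rewrite <- Hp in Ez. lra.
Qed.

(** Lagrange's identity for u'' = a u and v'' = b v. *)
Lemma sturm_identity (u u' v v' : R -> R) (a b s : R) :
  is_derive u s (u' s) -> is_derive v s (v' s) ->
  is_derive u' s (a * u s) -> is_derive v' s (b * v s) ->
  is_derive (fun t => u t * v' t - u' t * v t) s ((b - a) * (u s * v s)).
Proof.
  intros Hu Hv Hu' Hv'.
  assert (E1 : Derive (fun y => u y) s = u' s) by exact (is_derive_unique _ _ _ Hu).
  assert (E2 : Derive (fun y => v y) s = v' s) by exact (is_derive_unique _ _ _ Hv).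
  assert (E3 : Derive (fun y => u' y) s = a * u s) by exact (is_derive_unique _ _ _ Hu').
  assert (E4 : Derive (fun y => v' y) s = b * v s) by exact (is_derive_unique _ _ _ Hv').
  auto_derive.
  - repeat split; eexists; eassumption.
  - rewrite E1, E2, E3, E4. ring.
Qed.

Lemma quotient_derive (u u' v v' : R -> R) (s : R) :
  is_derive u s (u' s) -> is_derive v s (v' s) -> u s <> 0 ->
  is_derive (fun t => v t / u t) s ((u s * v' s - u' s * v s) / u s ^ 2).
Proof.
  intros Hu Hv Hn.
  assert (E1 : Derive (fun y => u y) s = u' s) by exact (is_derive_unique _ _ _ Hu).
  assert (E2 : Derive (fun y => v y) s = v' s) by exact (is_derive_unique _ _ _ Hv).
  auto_derive.
  - repeat split; trivial; eexists; eassumption.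
  - rewrite E1, E2. field. trivial.
Qed.

Definition osc_wronskian (nu mu s : R) : R := osc nu s * osc' mu s - osc' nu s * osc mu s.

Lemma osc_wronskian_derive (nu mu s : R) : 0 < nu -> 0 < mu ->
  is_derive (osc_wronskian nu mu) s ((nu ^ 2 - mu ^ 2) / 4 * (osc nu s * osc mu s)).
Proof.
  intros Hnu Hmu.
  replace ((nu ^ 2 - mu ^ 2) / 4) with ((exp s - mu ^ 2 / 4) - (exp s - nu ^ 2 / 4)) by field.
  apply sturm_identity.
  - apply osc_derive; lra.
  - apply osc_derive; lra.
  - apply osc'_derive; lra.
  - apply osc'_derive; lra.
Qed.

Lemma osc_wronskian_decreasing (nu mu a b : R) : 0 < nu < mu -> a < b ->
  (forall s, a < s < b -> 0 < sin (theta nu s) * sin (theta mu s)) ->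
  osc_wronskian nu mu b < osc_wronskian nu mu a.
Proof.
  intros Hnu Hab Hs.
  apply strict_decr_of_derive with (df := fun s => (nu ^ 2 - mu ^ 2) / 4 * (osc nu s * osc mu s)); trivial.
  - intros x _. apply osc_wronskian_derive; lra.
  - intros x Hx. specialize (Hs x Hx).
    assert (H1 := modulus_pos nu x ltac:(lra)). assert (H2 := modulus_pos mu x ltac:(lra)).
    unfold osc.
    replace (modulus nu x * sin (theta nu x) * (modulus mu x * sin (theta mu x)))
      with ((modulus nu x * modulus mu x) * (sin (theta nu x) * sin (theta mu x))) by ring.
    assert (0 < modulus nu x * modulus mu x * (sin (theta nu x) * sin (theta mu x)))
      by (apply Rmult_lt_0_compat; trivial; nra).
    assert ((nu ^ 2 - mu ^ 2) / 4 < 0) by nra.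
    set (X := _ * _ * (_ * _)) in *. nra.
Qed.

Lemma osc_wronskian_at_zero (nu mu s : R) : 0 < nu -> 0 < mu -> sin (theta nu s) = 0 ->
  osc_wronskian nu mu s
  = nu / 2 * modulus mu s / modulus nu s * (cos (theta nu s) * sin (theta mu s)).
Proof.
  intros Hnu Hmu Hz. unfold osc_wronskian.
  assert (H := osc'_at_zero nu s ltac:(lra) Hz).
  assert (Hm := modulus_pos nu s ltac:(lra)).
  assert (H1 := sin2_cos2 (theta nu s)). unfold Rsqr in H1. rewrite Hz in H1.
  assert (E : osc' nu s = - (nu / 2 / modulus nu s) * cos (theta nu s)).
  { transitivity (osc' nu s * cos (theta nu s) * cos (theta nu s)).
    - transitivity (osc' nu s * (0 * 0 + cos (theta nu s) * cos (theta nu s))).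
      rewrite H1; ring. ring.
    - rewrite H. reflexivity. }
  rewrite E. unfold osc. rewrite Hz. field. lra.
Qed.

Lemma sin_sign_on_band (j : nat) (y : R) : INR j * PI < y < (INR j + 1) * PI ->
  0 < cos (INR j * PI) * sin y.
Proof.
  revert y. induction j as [|j IH]; intros y Hy.
  - simpl in *. rewrite Rmult_0_l, cos_0, Rmult_1_l. apply sin_gt_0; lra.
  - rewrite S_INR in *. specialize (IH (y - PI) ltac:(lra)).
    rewrite Rmult_plus_distr_r, Rmult_1_l, neg_cos.
    replace y with ((y - PI) + PI) by ring. rewrite neg_sin. lra.
Qed.

Lemma sin_nat_PI (j : nat) : sin (INR j * PI) = 0.
Proof.
  induction j as [|j IH]; [simpl; now rewrite Rmult_0_l, sin_0|].
  rewrite S_INR, Rmult_plus_distr_r, Rmult_1_l, neg_sin, IH. ring.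
Qed.

Lemma sin_same_sign (j : nat) (y z : R) :
  INR j * PI < y < (INR j + 1) * PI -> INR j * PI < z < (INR j + 1) * PI ->
  0 < sin y * sin z.
Proof.
  intros Hy Hz. apply sin_sign_on_band in Hy. apply sin_sign_on_band in Hz.
  assert (H1 := sin2_cos2 (INR j * PI)). unfold Rsqr in H1. rewrite sin_nat_PI in H1.
  assert (H := Rmult_lt_0_compat _ _ Hy Hz).
  replace (sin y * sin z) with ((0 * 0 + cos (INR j * PI) * cos (INR j * PI)) * (sin y * sin z))
    by (rewrite H1; ring). lra.
Qed.

(** Where e^s >= nu^2/4 and osc > 0, osc is convex, so that a positive slope would persist
    and osc would grow linearly. Then (cot theta)' = (nu/2) / osc^2 would be integrable and
    cot theta bounded, although theta tends to 0. So osc is the solution that decays. *)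
Lemma osc_eventually_decreasing (nu s : R) : 0 < nu ->
  theta nu s < PI / 2 -> nu ^ 2 / 4 <= exp s -> osc' nu s <= 0.
Proof.
  intros Hnu Hth Hs. destruct (Rle_dec (osc' nu s) 0) as [H|H]; trivial. exfalso.
  assert (HP := PI_RGT_0).
  assert (Hpos : forall t, s <= t -> 0 < theta nu t < PI / 2).
  { intros t [Ht|Ht]; [|rewrite <- Ht].
    - generalize (theta_decreasing nu s t Hnu Ht) (theta_positive nu t Hnu). lra.
    - generalize (theta_positive nu s Hnu). lra. }
  assert (Hosc : forall t, s <= t -> 0 < osc nu t).
  { intros t Ht. apply Rmult_lt_0_compat; [apply modulus_pos; lra|].
    apply sin_gt_0; generalize (Hpos t Ht); lra. }
  set (k := osc' nu s). set (a := osc nu s).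
  assert (Hk : 0 < k) by (unfold k; lra). assert (Ha : 0 < a) by (apply Hosc; lra).
  assert (Hslope : forall t, s <= t -> k <= osc' nu t).
  { intros t [Ht|Ht]; [|rewrite <- Ht; unfold k; lra].
    destruct (MVT_cor2 (osc' nu) (fun t => (exp t - nu ^ 2 / 4) * osc nu t) s t Ht) as [c [E Hc]].
    - intros x _. apply is_derive_Reals, osc'_derive. lra.
    - assert (0 < osc nu c) by (apply Hosc; lra).
      assert (exp s <= exp c) by (apply exp_mono; lra).
      assert (0 <= (exp c - nu ^ 2 / 4) * osc nu c) by (apply Rmult_le_pos; lra).
      unfold k. nra. }
  assert (Hgrow : forall t, s <= t -> a + k * (t - s) <= osc nu t).
  { intros t [Ht|Ht]; [|rewrite <- Ht; unfold a; lra].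
    destruct (MVT_cor2 (osc nu) (osc' nu) s t Ht) as [c [E Hc]].
    - intros x _. apply is_derive_Reals, osc_derive. lra.
    - specialize (Hslope c ltac:(lra)). unfold a. nra. }
  (* (cot theta)' = (nu/2) / osc^2 is at most the derivative of the negative of the
     second summand of G, by the linear lower bound for osc. *)
  set (G := fun t => cos (theta nu t) / sin (theta nu t) + nu / 2 / k * / (a + k * (t - s))).
  assert (HG : forall t, s <= t -> G t <= G s).
  { intros t [Ht|Ht]; [|rewrite <- Ht; lra].
    set (dG := fun t => nu / 2 * (/ osc nu t ^ 2 - / (a + k * (t - s)) ^ 2)).
    destruct (MVT_cor2 G dG s t Ht) as [c [E Hc]].
    - intros x Hx. apply is_derive_Reals. unfold G, dG.
      assert (Hx0 := Hosc x ltac:(lra)). assert (Hxp := Hpos x ltac:(lra)).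
      assert (Hsin : 0 < sin (theta nu x)) by (apply sin_gt_0; lra).
      assert (Hd := theta_derive nu x ltac:(lra)).
      assert (Hlin : 0 < a + k * (x - s)) by nra.
      auto_derive.
      + repeat split; try (eexists; exact Hd); lra.
      + replace (Derive (fun y : R => theta nu y) x) with (- (nu / 2 / modulus nu x ^ 2))
          by (symmetry; now apply is_derive_unique).
        unfold osc in Hx0 |- *. assert (Hm := modulus_pos nu x ltac:(lra)).
        assert (H1 := sin2_cos2 (theta nu x)). unfold Rsqr in H1.
        set (p := sin (theta nu x)) in *. set (q := cos (theta nu x)) in *.
        set (r := modulus nu x) in *. set (l := a + k * (x - s)) in *.
        change (a + k * (x + - s)) with l.
        transitivity (nu / 2 * ((p * p + q * q) / (r * p) ^ 2 - / l ^ 2)).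
        * field. lra.
        * rewrite H1. field. lra.
    - specialize (Hgrow c ltac:(lra)).
      assert (Hlin : 0 < a + k * (c - s)) by nra.
      assert (Hle : / osc nu c ^ 2 <= / (a + k * (c - s)) ^ 2).
      { apply Rinv_le_contravar; [now apply pow_lt|]. apply pow_incr. lra. }
      assert (dG c <= 0) by (unfold dG; nra). nra. }
  set (K := Rmax 1 (G s)). assert (HK1 : 1 <= K) by apply Rmax_l.
  assert (HK2 : G s <= K) by apply Rmax_r.
  destruct (theta_vanishes nu (/ (2 * K)) Hnu ltac:(apply Rinv_0_lt_compat; lra)) as [s0 Hs0].
  set (t := Rmax s s0). assert (Ht : s <= t) by apply Rmax_l.
  specialize (Hs0 t ltac:(apply Rmax_r)). specialize (HG t Ht). specialize (Hpos t Ht).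
  rewrite Rabs_pos_eq in Hs0 by lra.
  assert (Hsin : 0 < sin (theta nu t)) by (apply sin_gt_0; lra).
  assert (Hsin2 := sin_lt_x (theta nu t) ltac:(lra)).
  assert (HKi : / (2 * K) <= / 2) by (apply Rinv_le_contravar; lra).
  assert (Hcos : / 2 <= cos (theta nu t)).
  { assert (Hq := cos_ge_quadratic (theta nu t)). nra. }
  assert (Hl : 0 < nu / 2 / k * / (a + k * (t - s))).
  { apply Rmult_lt_0_compat; [apply Rdiv_lt_0_compat; lra|apply Rinv_0_lt_compat; nra]. }
  assert (Hbig : K < cos (theta nu t) / sin (theta nu t)).
  { apply Rmult_lt_reg_r with (sin (theta nu t)); trivial.
    replace (cos (theta nu t) / sin (theta nu t) * sin (theta nu t)) with (cos (theta nu t))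
      by (field; lra).
    apply Rlt_le_trans with (K * / (2 * K)); [apply Rmult_lt_compat_l; lra|].
    replace (K * / (2 * K)) with (/ 2) by (field; lra). lra. }
  unfold G in HG at 1. lra.
Qed.

(** Otherwise osc nu and osc mu are both positive beyond s. Their Wronskian is nonpositive
    at s and strictly decreasing, hence at most some - k < 0 further out, and osc nu is bounded.
    So osc mu / osc nu would decrease to - infinity. *)
Lemma sturm_first (nu mu s : R) : 0 < nu < mu ->
  theta nu s = PI -> PI < theta mu s.
Proof.
  intros Hnu Hs. destruct (Rlt_dec PI (theta mu s)) as [H|H]; trivial. exfalso.
  assert (HP := PI_RGT_0).
  assert (Hn : forall t, s < t -> 0 < theta nu t < PI).
  { intros t Ht. generalize (theta_decreasing nu s t ltac:(lra) Ht) (theta_positive nu t ltac:(lra)). lra. }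
  assert (Hm : forall t, s < t -> 0 < theta mu t < PI).
  { intros t Ht. generalize (theta_decreasing mu s t ltac:(lra) Ht) (theta_positive mu t ltac:(lra)). lra. }
  assert (Hprod : forall t, s < t -> 0 < sin (theta nu t) * sin (theta mu t)).
  { intros t Ht. apply Rmult_lt_0_compat; apply sin_gt_0; generalize (Hn t Ht) (Hm t Ht); lra. }
  assert (W0 : osc_wronskian nu mu s <= 0).
  { rewrite osc_wronskian_at_zero; [|lra|lra|rewrite Hs; apply sin_PI].
    rewrite Hs, cos_PI.
    assert (H1 := modulus_pos nu s ltac:(lra)). assert (H2 := modulus_pos mu s ltac:(lra)).
    assert (H3 : 0 <= sin (theta mu s))
      by (apply sin_ge_0; generalize (theta_positive mu s ltac:(lra)); lra).
    assert (0 < nu / 2 * modulus mu s / modulus nu s)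
      by (apply Rdiv_lt_0_compat; trivial; apply Rmult_lt_0_compat; lra). nra. }
  assert (W1 := osc_wronskian_decreasing nu mu s (s + 1) Hnu ltac:(lra)
                  ltac:(intros t Ht; apply Hprod; lra)).
  set (k := - osc_wronskian nu mu (s + 1)). assert (Hk : 0 < k) by (unfold k; lra).
  assert (Wk : forall t, s + 1 <= t -> osc_wronskian nu mu t <= - k).
  { intros t [Ht|Ht]; [|rewrite <- Ht; unfold k; lra].
    assert (W2 := osc_wronskian_decreasing nu mu (s + 1) t Hnu Ht
                  ltac:(intros u Hu; apply Hprod; lra)). unfold k; lra. }
  destruct (theta_vanishes nu (PI / 2) ltac:(lra) ltac:(lra)) as [s0 Hs0].
  set (b := Rmax (s + 1) (Rmax s0 (nu ^ 2 / 4))).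
  assert (Hb1 : s + 1 <= b) by apply Rmax_l.
  assert (Hb2 : s0 <= b) by (eapply Rle_trans; [apply Rmax_l|apply Rmax_r]).
  assert (Hb3 : nu ^ 2 / 4 <= b) by (eapply Rle_trans; [apply Rmax_r|apply Rmax_r]).
  assert (Hoscpos : forall v t, 0 < v -> 0 < theta v t < PI -> 0 < osc v t).
  { intros v t Hv Ht. apply Rmult_lt_0_compat; [apply modulus_pos; lra|apply sin_gt_0; lra]. }
  set (M := osc nu b). assert (HM : 0 < M) by (apply Hoscpos; [lra|apply Hn; lra]).
  assert (Hbd : forall t, b <= t -> osc nu t <= M).
  { intros t [Ht|Ht]; [|rewrite <- Ht; unfold M; lra].
    destruct (MVT_cor2 (osc nu) (osc' nu) b t Ht) as [c [E Hc]].
    - intros x _. apply is_derive_Reals, osc_derive. lra.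
    - assert (osc' nu c <= 0).
      { apply osc_eventually_decreasing; [lra| |].
        - specialize (Hs0 c ltac:(lra)). apply Rabs_lt_between in Hs0. lra.
        - generalize (exp_ineq1_le c). lra. }
      unfold M. nra. }
  (* The derivative of osc mu / osc nu is osc_wronskian / osc nu^2 <= - k / M^2, and t is
     chosen so far out that the quotient would have dropped below 0. *)
  set (t := b + (osc mu b / osc nu b + 1) * M ^ 2 / k).
  assert (Hq0 : 0 < osc mu b / osc nu b)
    by (apply Rdiv_lt_0_compat; apply Hoscpos; try lra; [apply Hm|apply Hn]; lra).
  assert (HM2 : 0 < M ^ 2) by now apply pow_lt.
  assert (Ht : b < t).
  { assert (0 < (osc mu b / osc nu b + 1) * M ^ 2 / k)
      by (apply Rdiv_lt_0_compat; trivial; apply Rmult_lt_0_compat; lra).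
    unfold t; lra. }
  destruct (MVT_cor2 (fun u => osc mu u / osc nu u)
     (fun u => osc_wronskian nu mu u / osc nu u ^ 2) b t Ht) as [c [E Hc]].
  { intros x Hx. apply is_derive_Reals.
    assert (0 < osc nu x) by (apply Hoscpos; [lra|apply Hn; lra]).
    apply quotient_derive; [apply osc_derive; lra|apply osc_derive; lra|lra]. }
  assert (Hqt : 0 < osc mu t / osc nu t)
    by (apply Rdiv_lt_0_compat; apply Hoscpos; try lra; [apply Hm|apply Hn]; lra).
  assert (Hcp : 0 < osc nu c) by (apply Hoscpos; [lra|apply Hn; lra]).
  assert (HcM : osc nu c ^ 2 <= M ^ 2) by (apply pow_incr; split; [lra|apply Hbd; lra]).
  assert (Hc2 : 0 < osc nu c ^ 2) by now apply pow_lt.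
  assert (HW : osc_wronskian nu mu c / osc nu c ^ 2 <= - (k / M ^ 2)).
  { specialize (Wk c ltac:(lra)).
    assert (/ M ^ 2 <= / osc nu c ^ 2) by (now apply Rinv_le_contravar).
    assert (0 < / M ^ 2) by now apply Rinv_0_lt_compat.
    unfold Rdiv. nra. }
  assert (Hfin : osc mu t / osc nu t - osc mu b / osc nu b <= - (k / M ^ 2) * (t - b))
    by (rewrite E; apply Rmult_le_compat_r; lra).
  replace (- (k / M ^ 2) * (t - b)) with (- (osc mu b / osc nu b + 1)) in Hfin
    by (unfold t; field; change (osc nu b) with M; lra).
  lra.
Qed.

(** Between two consecutive zeros of osc nu the Wronskian would change sign against its
    monotonicity if theta mu had not passed the multiple of pi. Induction on j starts from the
    decaying end, where the preceding lemma replaces the second zero. *)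
Lemma sturm (nu mu s : R) (j : nat) : 0 < nu < mu ->
  theta nu s = INR (S j) * PI -> INR (S j) * PI < theta mu s.
Proof.
  intros Hnu. revert s. induction j as [|j IH]; intros s Hs.
  { simpl INR in *. rewrite Rmult_1_l in *. now apply sturm_first with nu. }
  assert (HP := PI_RGT_0). assert (Hj := INR_S_pos j).
  rewrite (S_INR (S j)) in *.
  destruct (theta_onto nu s (INR (S j) * PI)) as [t [Hst Ht]]; [lra|nra|].
  specialize (IH t Ht).
  destruct (Rlt_dec ((INR (S j) + 1) * PI) (theta mu s)) as [H|H]; trivial. exfalso.
  assert (Hn : forall u, s < u < t -> INR (S j) * PI < theta nu u < (INR (S j) + 1) * PI).
  { intros u Hu. generalize (theta_decreasing nu s u ltac:(lra) ltac:(lra))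
      (theta_decreasing nu u t ltac:(lra) ltac:(lra)). lra. }
  assert (Hm : forall u, s < u <= t -> INR (S j) * PI < theta mu u < (INR (S j) + 1) * PI).
  { intros u [Hu1 [Hu2|Hu2]].
    - generalize (theta_decreasing mu s u ltac:(lra) ltac:(lra))
      (theta_decreasing mu u t ltac:(lra) ltac:(lra)). lra.
    - rewrite Hu2. generalize (theta_decreasing mu s t ltac:(lra) ltac:(lra)). lra. }
  assert (W := osc_wronskian_decreasing nu mu s t Hnu Hst
    ltac:(intros u Hu; apply sin_same_sign with (S j); [apply Hn|apply Hm]; lra)).
  assert (Hr : forall u, 0 < nu / 2 * modulus mu u / modulus nu u).
  { intros u. assert (H1 := modulus_pos nu u ltac:(lra)). assert (H2 := modulus_pos mu u ltac:(lra)).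
    apply Rdiv_lt_0_compat; trivial; apply Rmult_lt_0_compat; lra. }
  rewrite !osc_wronskian_at_zero in W; try lra.
  - rewrite Ht, Hs in W.
    assert (C1 := sin_sign_on_band (S j) (theta mu t) ltac:(apply Hm; lra)).
    assert (W1 := Rmult_lt_0_compat _ _ (Hr t) C1).
    assert (C2 : cos ((INR (S j) + 1) * PI) * sin (theta mu s) <= 0).
    { rewrite Rmult_plus_distr_r, Rmult_1_l, neg_cos.
      assert (Hms := theta_decreasing mu s t ltac:(lra) Hst).
      destruct (Req_dec (theta mu s) ((INR (S j) + 1) * PI)) as [E|E].
      - rewrite E, <- S_INR, sin_nat_PI. lra.
      - assert (C3 := sin_sign_on_band (S j) (theta mu s) ltac:(lra)). lra. }
    assert (W2 : nu / 2 * modulus mu s / modulus nu s * (cos ((INR (S j) + 1) * PI) * sin (theta mu s)) <= 0).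
    { specialize (Hr s). nra. }
    lra.
  - rewrite Hs, <- S_INR. apply sin_nat_PI.
  - rewrite Ht. apply sin_nat_PI.
Qed.

(** * Labelling of the zeros *)

Lemma sin_zero_pos (y : R) : 0 < y -> sin y = 0 ->
  exists j, (1 <= j)%nat /\ y = INR j * PI.
Proof.
  intros Hy Hs. destruct (sin_eq_0_0 y Hs) as [k Hk]. assert (HP := PI_RGT_0).
  assert (0 < k)%Z by (apply lt_IZR; nra).
  exists (Z.to_nat k). split; [lia|].
  rewrite INR_IZR_INZ, Z2Nat.id by lia. exact Hk.
Qed.

(** theta takes multiples of pi at the zeros. By Sturm comparison their indices increase
    strictly from one zero to the next, so the index of the zero number n is at least n. By the
    intermediate value theorem, starting from theta = 0 at nu = 0, no multiple of pi is skipped. *)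
Lemma theta_at_zeros (x : R) (nu : nat -> R) :
  0 < x -> positive_nu_zeros x nu ->
  forall n, (1 <= n)%nat -> theta (nu n) (2 * ln (x / 2)) = INR n * PI.
Proof.
  intros Hx [Hz [Hincr Hall]]. set (s := 2 * ln (x / 2)). assert (HP := PI_RGT_0).
  assert (Hmono : forall m n, (1 <= m)%nat -> (m < n)%nat -> nu m < nu n).
  { intros m n Hm Hmn. induction n as [|n IH]; [lia|].
    destruct (Nat.eq_dec m n) as [->|E]; [now apply Hincr|].
    apply Rlt_trans with (nu n); [apply IH; lia|apply Hincr; lia]. }
  assert (Hj : forall n, (1 <= n)%nat -> exists j, (1 <= j)%nat /\ theta (nu n) s = INR j * PI).
  { intros n Hn. destruct (Hz n Hn) as [Hp Hb]. apply sin_zero_pos.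
    - now apply theta_positive.
    - now apply BesselKi_zero_iff_sin_theta. }
  assert (Hge : forall n, (1 <= n)%nat -> INR n * PI <= theta (nu n) s).
  { intros n Hn. induction n as [|n IH]; [lia|].
    destruct (Hj (S n) Hn) as [j [Hj1 Ej]]. rewrite Ej.
    apply Rmult_le_compat_r; [lra|]. apply le_INR.
    destruct (Nat.eq_dec n 0) as [->|E]; trivial.
    assert (Hn1 : (1 <= n)%nat) by lia.
    destruct (Hj n Hn1) as [i [Hi1 Ei]]. destruct i as [|i]; [lia|].
    assert (Hst := sturm (nu n) (nu (S n)) s i (conj (proj1 (Hz n Hn1)) (Hincr n Hn1)) Ei).
    specialize (IH Hn1). rewrite Ei in IH. rewrite Ej in Hst.
    apply Rmult_le_reg_r in IH; trivial. apply Rmult_lt_reg_r in Hst; trivial.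
    apply INR_le in IH. apply INR_lt in Hst. lia. }
  intros n. induction n as [n IH] using lt_wf_ind. intros Hn.
  destruct (Rle_lt_or_eq_dec _ _ (Hge n Hn)) as [H|H]; [|now symmetry]. exfalso.
  destruct (IVT_interv (fun v => theta v s - INR n * PI) 0 (nu n)) as [v [Hv Ev]].
  - intros a _. apply continuity_pt_minus; [apply theta_continuous|].
    apply continuity_pt_const. now intros u w.
  - apply (Hz n Hn).
  - rewrite theta_0. assert (0 < INR n * PI) by (apply Rmult_lt_0_compat; trivial; apply lt_0_INR; lia). lra.
  - lra.
  - assert (Ev' : theta v s = INR n * PI) by lra.
    assert (Hv0 : 0 < v).
    { destruct (proj1 Hv) as [Hp|Hp]; trivial. rewrite <- Hp, theta_0 in Ev'.
      assert (0 < INR n * PI) by (apply Rmult_lt_0_compat; trivial; apply lt_0_INR; lia). lra. }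
    destruct (Hall v Hv0) as [i [Hi Ei]].
    { apply BesselKi_zero_iff_sin_theta; trivial. fold s. rewrite Ev'. apply sin_nat_PI. }
    assert (Hin : (i < n)%nat).
    { destruct (Nat.lt_trichotomy i n) as [L|[L|L]]; trivial.
      - subst i. rewrite <- Ei in Ev'. lra.
      - specialize (Hmono n i Hn L). lra. }
    specialize (IH i Hin Hi). rewrite Ei, Ev' in IH.
    apply Rmult_eq_reg_r in IH; [|lra]. apply INR_eq in IH. lia.
Qed.

Lemma zeros_unbounded (x : R) (nu : nat -> R) :
  0 < x -> positive_nu_zeros x nu ->
  forall V, eventually (fun n => V < nu n).
Proof.
  intros Hx Hnu V. assert (Ht := theta_at_zeros x nu Hx Hnu).
  destruct Hnu as [Hz _]. set (s := 2 * ln (x / 2)) in *. assert (HP := PI_RGT_0).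
  destruct (continuity_ab_maj (fun v => theta v s) 0 (Rmax 0 V)) as [vm [Hmax _]].
  { apply Rmax_l. }
  { intros c _. apply theta_continuous. }
  destruct (nfloor_ex (Rmax 0 (theta vm s / PI))) as [N HN]; [apply Rmax_l|].
  exists (S N). intros n Hn.
  destruct (Rlt_dec V (nu n)) as [H|H]; trivial. exfalso.
  assert (Hn1 : (1 <= n)%nat) by lia.
  specialize (Ht n Hn1). destruct (Hz n Hn1) as [Hp _].
  assert (HnV : nu n <= Rmax 0 V) by (apply Rle_trans with V; [lra|apply Rmax_r]).
  specialize (Hmax (nu n) (conj (Rlt_le _ _ Hp) HnV)).
  cbv beta in Hmax. rewrite Ht in Hmax.
  assert (theta vm s / PI < INR N + 1) by (eapply Rle_lt_trans; [apply Rmax_r|apply HN]).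
  assert (INR N + 1 <= INR n) by (rewrite <- S_INR; apply le_INR; lia).
  assert (INR n <= theta vm s / PI).
  { apply Rmult_le_reg_r with PI; trivial.
    replace (theta vm s / PI * PI) with (theta vm s) by (field; lra). exact Hmax. }
  lra.
Qed.

(** * Taylor expansion of the complex logarithm *)

Definition log1p_taylor (w : C) : C :=
  (w - w ^ 2 / 2 + w ^ 3 / 3 - w ^ 4 / 4 + w ^ 5 / 5 - w ^ 6 / 6 + w ^ 7 / 7 - w ^ 8 / 8)%C.

Lemma Cmod_lt_1_nz (u : C) : Cmod u <= / 2 -> / 2 <= Cmod (1 + u)%C.
Proof.
  intros H.
  assert (H1 := Cmod_triangle (1 + u) (- u)).
  replace (1 + u + - u)%C with (RtoC 1) in H1 by ring.
  rewrite Cmod_1, Cmod_opp in H1. lra.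
Qed.

Lemma nz_of_Cmod_pos (u : C) : 0 < Cmod u -> u <> 0%C.
Proof. apply Cmod_gt_0. Qed.

Lemma Cmod_1_plus_scaled (w : C) (s : R) :
  0 <= s <= 1 -> Cmod w <= / 2 -> / 2 <= Cmod (1 + RtoC s * w)%C.
Proof.
  intros Hs Hw. apply Cmod_lt_1_nz. rewrite Cmod_mult, Cmod_R, Rabs_pos_eq by lra.
  generalize (Cmod_ge_0 w). nra.
Qed.

Lemma geometric_remainder (w : C) (s : R) :
  (1 + RtoC s * w)%C <> 0%C ->
  (w / (1 + RtoC s * w)
   - (w - RtoC s * w ^ 2 + RtoC (s ^ 2) * w ^ 3 - RtoC (s ^ 3) * w ^ 4 + RtoC (s ^ 4) * w ^ 5
      - RtoC (s ^ 5) * w ^ 6 + RtoC (s ^ 6) * w ^ 7 - RtoC (s ^ 7) * w ^ 8))%C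
  = (w ^ 9 * RtoC (s ^ 8) / (1 + RtoC s * w))%C.
Proof.
  intros H. rewrite !RtoC_pow. field. exact H.
Qed.

(** Used with p = Re and p = Im, and f the corresponding part of log (z + s). Following the
    logarithm along the segment from z to z + 1 avoids any addition formula for arctangents. The
    derivative of the difference is p (w^9 s^8 / (1 + s w)) with w = 1/z. *)
Lemma log_increment_taylor (p : C -> R) (f : R -> R) (z : C) :
  (forall u v, p (u + v)%C = p u + p v) ->
  (forall (r : R) u, p (RtoC r * u)%C = r * p u) ->
  (forall u, Rabs (p u) <= Cmod u) ->
  2 <= Cmod z ->
  (forall s, 0 <= s <= 1 -> is_derive f s (p (/ (z + RtoC s))%C)) ->
  Rabs (f 1 - f 0 - p (log1p_taylor (/ z))) <= 2 * Cmod (/ z) ^ 9.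
Proof.
  intros Hadd Hscal Hle Hz Hf. set (w := (/ z)%C).
  assert (Hz0 : z <> 0%C) by (apply nz_of_Cmod_pos; lra).
  assert (Hw : Cmod w <= / 2).
  { unfold w. rewrite Cmod_inv by trivial. apply Rinv_le_contravar; lra. }
  assert (Hsub : forall u v, p (u - v)%C = p u - p v).
  { intros u v. replace (u - v)%C with (u + RtoC (-1) * v)%C by ring.
    rewrite Hadd, Hscal. ring. }
  remember (p (w ^ 2)%C) as p2 eqn:P2.
  remember (p (w ^ 3)%C) as p3 eqn:P3.
  remember (p (w ^ 4)%C) as p4 eqn:P4.
  remember (p (w ^ 5)%C) as p5 eqn:P5.
  remember (p (w ^ 6)%C) as p6 eqn:P6.
  remember (p (w ^ 7)%C) as p7 eqn:P7.
  remember (p (w ^ 8)%C) as p8 eqn:P8.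
  set (g := fun s => f s - (s * p w - s ^ 2 / 2 * p2 + s ^ 3 / 3 * p3 - s ^ 4 / 4 * p4
     + s ^ 5 / 5 * p5 - s ^ 6 / 6 * p6 + s ^ 7 / 7 * p7 - s ^ 8 / 8 * p8)).
  assert (E : f 1 - f 0 - p (log1p_taylor w) = g 1 - g 0).
  { unfold g, log1p_taylor.
    assert (Hdiv : forall u (n : positive), p (u / IZR (Zpos n))%C = p u / IZR (Zpos n)).
    { intros u n. assert (Hn : IZR (Zpos n) <> 0) by now apply not_0_IZR.
      unfold Cdiv. rewrite <- RtoC_inv by trivial. rewrite Cmult_comm, Hscal. field. trivial. }
    rewrite !Hsub, !Hadd, !Hsub, !Hadd, !Hsub, !Hadd, !Hsub, !Hdiv,
      <- P2, <- P3, <- P4, <- P5, <- P6, <- P7, <- P8. field. }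
  rewrite E.
  enough (Hl : Rabs (g 1 - g 0) <= 2 * Cmod w ^ 9 * Rabs (1 - 0))
    by (rewrite (Rminus_0_r 1), Rabs_R1, Rmult_1_r in Hl; exact Hl).
  apply lipschitz_of_derive with
    (df := fun s => p (w ^ 9 * RtoC (s ^ 8) / (1 + RtoC s * w))%C).
  - intros s Hs. rewrite Rmin_left, Rmax_right in Hs by lra.
    assert (Hnz : (1 + RtoC s * w)%C <> 0%C).
    { apply nz_of_Cmod_pos. generalize (Cmod_1_plus_scaled w s Hs Hw). lra. }
    rewrite <- geometric_remainder by trivial.
    specialize (Hf s Hs). unfold g. auto_derive.
    + eexists; exact Hf.
    + replace (Derive (fun x => f x) s) with (p (/ (z + RtoC s))%C)
        by (symmetry; apply is_derive_unique, Hf).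
      replace (/ (z + RtoC s))%C with (w / (1 + RtoC s * w))%C.
      * rewrite !Hsub, !Hadd, !Hsub, !Hadd, !Hsub, !Hadd, !Hsub, !Hscal,
          <- P2, <- P3, <- P4, <- P5, <- P6, <- P7, <- P8. field.
      * assert (Hzs : (z + RtoC s)%C <> 0%C).
        { intros E0. apply Hnz. unfold w.
          replace (1 + RtoC s * / z)%C with ((z + RtoC s) / z)%C by (field; trivial).
          rewrite E0. unfold Cdiv. ring. }
        unfold w. field. repeat split; trivial.
  - intros s Hs. rewrite Rmin_left, Rmax_right in Hs by lra.
    assert (Hm := Cmod_1_plus_scaled w s Hs Hw).
    eapply Rle_trans; [apply Hle|].
    rewrite Cmod_div by (apply nz_of_Cmod_pos; lra).
    rewrite Cmod_mult, Cmod_R, Rabs_pos_eq by (apply pow_le; lra). rewrite Cmod_pow.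
    assert (Hs8 : s ^ 8 <= 1) by (rewrite <- (pow1 8); apply pow_incr; lra).
    assert (Hs80 : 0 <= s ^ 8) by (apply pow_le; lra).
    assert (Hw9 : 0 <= Cmod w ^ 9) by (apply pow_le, Cmod_ge_0).
    apply Rmult_le_reg_r with (Cmod (1 + RtoC s * w)%C); [lra|].
    unfold Rdiv. rewrite Rmult_assoc, Rinv_l by lra. nra.
Qed.

(** The coefficients 1/12, -1/360 and 1/1260 make all powers of w below w^8 cancel. *)
Lemma stirling_remainder_algebra (w : C) :
  w <> 0%C -> (1 + w)%C <> 0%C ->
  ((/ w + / 2) * log1p_taylor w - 1 + (w / (1 + w) - w) / 12
   - ((w / (1 + w)) ^ 3 - w ^ 3) / 360 + ((w / (1 + w)) ^ 5 - w ^ 5) / 1260)%C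
  = (- w ^ 8 * (83 / 720 + 371 / 720 * w + 67 / 72 * w ^ 2 + 5 / 6 * w ^ 3
       + 41 / 112 * w ^ 4 + 1 / 16 * w ^ 5) / (1 + w) ^ 5)%C.
Proof.
  intros Hw H1. unfold log1p_taylor. field. split; trivial.
Qed.

(** * Stirling's formula for the argument of Gamma *)

Lemma Rabs_Im_le_Cmod (u : C) : Rabs (Im u) <= Cmod u.
Proof. eapply Rle_trans; [apply Rmax_r|apply Rmax_Cmod]. Qed.

Lemma stirling_remainder_bound (w : C) :
  w <> 0%C -> Cmod w <= / 2 ->
  Cmod ((/ w + / 2) * log1p_taylor w - 1 + (w / (1 + w) - w) / 12
   - ((w / (1 + w)) ^ 3 - w ^ 3) / 360 + ((w / (1 + w)) ^ 5 - w ^ 5) / 1260)%C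
  <= 32 * Cmod w ^ 8.
Proof.
  intros Hw Hle. assert (Hm := Cmod_lt_1_nz w Hle).
  assert (Hnz : (1 + w)%C <> 0%C) by (apply nz_of_Cmod_pos; lra).
  rewrite stirling_remainder_algebra by trivial.
  rewrite Cmod_div by (now apply Cpow_nz). rewrite Cmod_mult, Cmod_opp, !Cmod_pow.
  set (q := (83 / 720 + 371 / 720 * w + 67 / 72 * w ^ 2 + 5 / 6 * w ^ 3
       + 41 / 112 * w ^ 4 + 1 / 16 * w ^ 5)%C).
  assert (Hq : Cmod q <= 1).
  { unfold q.
    replace (83 / 720)%C with (RtoC (83 / 720)) by (rewrite RtoC_div; [trivial|lra]).
    replace (371 / 720)%C with (RtoC (371 / 720)) by (rewrite RtoC_div; [trivial|lra]).
    replace (67 / 72)%C with (RtoC (67 / 72)) by (rewrite RtoC_div; [trivial|lra]).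
    replace (5 / 6)%C with (RtoC (5 / 6)) by (rewrite RtoC_div; [trivial|lra]).
    replace (41 / 112)%C with (RtoC (41 / 112)) by (rewrite RtoC_div; [trivial|lra]).
    replace (1 / 16)%C with (RtoC (1 / 16)) by (rewrite RtoC_div; [trivial|lra]).
    assert (Hr := Cmod_ge_0 w). set (r := Cmod w) in *.
    assert (T : forall (A : C) (a c : R) (k : nat), 0 <= c -> Cmod A <= a ->
        Cmod (A + RtoC c * w ^ k)%C <= a + c * (/ 2) ^ k).
    { intros A a c k Hc HA. eapply Rle_trans; [apply Cmod_triangle|].
      rewrite Cmod_mult, Cmod_R, Cmod_pow, Rabs_pos_eq by trivial.
      apply Rplus_le_compat; trivial. apply Rmult_le_compat_l; trivial.
      apply pow_incr. split; trivial. }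
    assert (H0 : Cmod (RtoC (83 / 720)) <= 83 / 720) by (rewrite Cmod_R, Rabs_pos_eq; lra).
    assert (H1 := T _ _ (371 / 720) 1%nat ltac:(lra) H0). rewrite Cpow_1_r in H1.
    assert (H2 := T _ _ (67 / 72) 2%nat ltac:(lra) H1).
    assert (H3 := T _ _ (5 / 6) 3%nat ltac:(lra) H2).
    assert (H4 := T _ _ (41 / 112) 4%nat ltac:(lra) H3).
    assert (H5 := T _ _ (1 / 16) 5%nat ltac:(lra) H4).
    eapply Rle_trans; [exact H5|]. lra. }
  assert (H8 : 0 <= Cmod w ^ 8) by (apply pow_le, Cmod_ge_0).
  assert (H5 : / 32 <= Cmod (1 + w)%C ^ 5).
  { replace (/ 32) with ((/ 2) ^ 5) by field. apply pow_incr. lra. }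
  assert (Hq0 := Cmod_ge_0 q).
  apply Rmult_le_reg_r with (Cmod (1 + w)%C ^ 5); [lra|].
  unfold Rdiv. rewrite Rmult_assoc, Rinv_l by lra. nra.
Qed.

(** Real and imaginary part of log (t + i nu), continuous for t >= 0 and nu > 0. *)
Definition log_mod (nu t : R) : R := ln (t ^ 2 + nu ^ 2) / 2.
Definition log_arg (nu t : R) : R := PI / 2 - atan (t / nu).

Lemma log_parts_derive (nu t : R) : 0 < nu ->
  is_derive (log_mod nu) t (Re (/ (t, nu))%C) /\
  is_derive (log_arg nu) t (Im (/ (t, nu))%C).
Proof.
  intros Hnu. assert (H : 0 < t ^ 2 + nu ^ 2) by (generalize (pow2_ge_0 t); nra).
  split.
  - unfold log_mod. auto_derive; [simpl in H; lra|].
    unfold Cinv, Re; simpl. field. simpl in H. lra.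
  - unfold log_arg. auto_derive; [lra|].
    unfold Cinv, Im; simpl. field. simpl in H. split; lra.
Qed.

(** Stirling's approximation of log Gamma(z + 1) at z = t + i nu, without its additive
    constant, which is real. *)
Definition stirling_log (nu t : R) : C :=
  let z : C := (t, nu) in
  ((z + / 2) * (log_mod nu t, log_arg nu t) - z
   + / z / 12 - (/ z) ^ 3 / 360 + (/ z) ^ 5 / 1260)%C.

Lemma Cmod_pair_sqr (t nu : R) : Cmod (t, nu) ^ 2 = t ^ 2 + nu ^ 2.
Proof. apply Cmod2_alt. Qed.

Lemma Cmod_ge_Im (t nu : R) : 0 <= nu -> nu <= Cmod (t, nu).
Proof.
  intros H. assert (H1 := Rabs_Im_le_Cmod (t, nu)). simpl in H1.
  rewrite Rabs_pos_eq in H1; trivial.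
Qed.

(** The increment of the approximation is log (z + 1) up to O(|z|^-8). *)
Lemma stirling_log_step (nu t : R) : 2 <= nu -> 0 <= t ->
  Rabs (Im (stirling_log nu (t + 1)) - Im (stirling_log nu t) - log_arg nu (t + 1))
  <= 40 / (t ^ 2 + nu ^ 2) ^ 4.
Proof.
  intros Hnu Ht. set (z := ((t, nu) : C)).
  assert (Hz2 : 2 <= Cmod z) by (generalize (Cmod_ge_Im t nu ltac:(lra)); unfold z; lra).
  assert (Hz : z <> 0%C) by (apply nz_of_Cmod_pos; lra).
  set (w := (/ z)%C).
  assert (Hw : Cmod w = / Cmod z) by now apply Cmod_inv.
  assert (Hw2 : Cmod w <= / 2) by (rewrite Hw; apply Rinv_le_contravar; lra).
  assert (Hw0 : 0 < Cmod w) by (rewrite Hw; apply Rinv_0_lt_compat; lra).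
  assert (Hwn : w <> 0%C) by now apply nz_of_Cmod_pos.
  assert (H1w : (1 + w)%C <> 0%C).
  { apply nz_of_Cmod_pos. generalize (Cmod_lt_1_nz w Hw2). lra. }
  assert (Hadd : forall s, (z + RtoC s)%C = (t + s, nu))
    by (intros s; unfold z, Cplus, RtoC; simpl; f_equal; ring).
  assert (E1 : Rabs (log_mod nu (t + 1) - log_mod nu t - Re (log1p_taylor w)) <= 2 * Cmod w ^ 9).
  { replace (log_mod nu t) with (log_mod nu (t + 0)) by (f_equal; ring).
    apply (log_increment_taylor Re (fun s => log_mod nu (t + s)) z); trivial.
    - intros r u. destruct u as [u1 u2]. unfold Cmult, RtoC; simpl. ring.
    - apply re_le_Cmod.
    - intros s Hs. rewrite Hadd.
      assert (Hd := proj1 (log_parts_derive nu (t + s) ltac:(lra))).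
      assert (Hc := is_derive_comp (V := R_NormedModule) (log_mod nu) (fun s => t + s) s _ 1 Hd).
      rewrite <- (Rmult_1_l (Re _)). apply Hc. auto_derive; trivial. }
  assert (E2 : Rabs (log_arg nu (t + 1) - log_arg nu t - Im (log1p_taylor w)) <= 2 * Cmod w ^ 9).
  { replace (log_arg nu t) with (log_arg nu (t + 0)) by (f_equal; ring).
    apply (log_increment_taylor Im (fun s => log_arg nu (t + s)) z); trivial.
    - intros r u. destruct u as [u1 u2]. unfold Cmult, RtoC; simpl. ring.
    - apply Rabs_Im_le_Cmod.
    - intros s Hs. rewrite Hadd.
      assert (Hd := proj2 (log_parts_derive nu (t + s) ltac:(lra))).
      assert (Hc := is_derive_comp (V := R_NormedModule) (log_arg nu) (fun s => t + s) s _ 1 Hd).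
      rewrite <- (Rmult_1_l (Im _)). apply Hc. auto_derive; trivial. }
  set (L1 := ((log_mod nu (t + 1), log_arg nu (t + 1)) : C)).
  set (L0 := ((log_mod nu t, log_arg nu t) : C)).
  set (E := (L1 - L0 - log1p_taylor w)%C).
  assert (HE : Cmod E <= 4 * Cmod w ^ 9).
  { eapply Rle_trans; [apply Cmod_2Rmax|].
    assert (Rmax (Rabs (fst E)) (Rabs (snd E)) <= 2 * Cmod w ^ 9).
    { apply Rmax_lub.
      - unfold E, L1, L0, Cminus, Cplus, Copp; simpl. exact E1.
      - unfold E, L1, L0, Cminus, Cplus, Copp; simpl. exact E2. }
    assert (Hs2 : sqrt 2 <= 2).
    { rewrite <- (sqrt_square 2) at 2 by lra. apply sqrt_le_1_alt. lra. }
    assert (0 <= Rmax (Rabs (fst E)) (Rabs (snd E)))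
      by (eapply Rle_trans; [apply Rabs_pos|apply Rmax_l]).
    assert (0 <= sqrt 2) by apply sqrt_pos. nra. }
  assert (EQ : (stirling_log nu (t + 1) - stirling_log nu t - L1
     = ((/ w + / 2) * log1p_taylor w - 1 + (w / (1 + w) - w) / 12
   - ((w / (1 + w)) ^ 3 - w ^ 3) / 360 + ((w / (1 + w)) ^ 5 - w ^ 5) / 1260)
       + (/ w + / 2) * E)%C).
  { unfold stirling_log. rewrite <- Hadd. fold z L1 L0.
    assert (Hz1 : (z + 1)%C <> 0%C).
    { intros E0. apply H1w. unfold w. replace (1 + / z)%C with ((z + 1) / z)%C by (field; trivial).
      rewrite E0. unfold Cdiv. ring. }
    assert (Ew : (w / (1 + w) = / (z + 1))%C) by (unfold w; field; repeat split; trivial).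
    rewrite Ew. unfold E. replace (/ w)%C with z by (unfold w; field; trivial).
    fold w. set (v := (/ (z + 1))%C). field. }
  replace (Im (stirling_log nu (t + 1)) - Im (stirling_log nu t) - log_arg nu (t + 1))
    with (Im (stirling_log nu (t + 1) - stirling_log nu t - L1)%C)
    by (unfold L1, Cminus, Cplus, Copp; simpl; ring).
  eapply Rle_trans; [apply Rabs_Im_le_Cmod|]. rewrite EQ.
  eapply Rle_trans; [apply Cmod_triangle|].
  assert (B1 := stirling_remainder_bound w Hwn Hw2).
  assert (B2 : Cmod ((/ w + / 2) * E)%C <= 8 * Cmod w ^ 8).
  { rewrite Cmod_mult.
    assert (B3 : Cmod (/ w + / 2)%C <= 2 * / Cmod w).
    { eapply Rle_trans; [apply Cmod_triangle|]. rewrite !Cmod_inv by (trivial; intros E0; injection E0; lra).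
      rewrite Cmod_R, (Rabs_pos_eq 2) by lra.
      assert (/ / 2 <= / Cmod w) by (apply Rinv_le_contravar; trivial). lra. }
    eapply Rle_trans; [apply Rmult_le_compat; [apply Cmod_ge_0|apply Cmod_ge_0|exact B3|exact HE]|].
    right. field. lra. }
  assert (B4 : Cmod w ^ 8 = / (t ^ 2 + nu ^ 2) ^ 4).
  { rewrite Hw, pow_inv. f_equal. rewrite <- Cmod_pair_sqr, <- pow_mult. reflexivity. }
  unfold Rdiv. rewrite <- B4. lra.
Qed.

Lemma inv_sqr_le_atan (nu : R) (n : nat) : 0 < nu ->
  / (INR (S n) ^ 2 + nu ^ 2) <= (atan (INR (S n) / nu) - atan (INR n / nu)) / nu.
Proof.
  intros Hnu.
  destruct (MVT_cor2 (fun t => atan (t / nu)) (fun t => nu / (t ^ 2 + nu ^ 2)) (INR n) (INR (S n)))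
    as [c [E Hc]].
  - rewrite S_INR; lra.
  - intros c _. apply is_derive_Reals.
    assert (0 < c ^ 2 + nu ^ 2) by (generalize (pow2_ge_0 c); nra).
    auto_derive; [lra|]. field. simpl in H. split; lra.
  - rewrite E, S_INR. replace (INR n + 1 - INR n) with 1 by ring.
    assert (Hn := pos_INR n). rewrite S_INR in Hc.
    replace (nu / (c ^ 2 + nu ^ 2) * 1 / nu) with (/ (c ^ 2 + nu ^ 2))
      by (assert (0 < c ^ 2 + nu ^ 2) by nra; field; lra).
    apply Rinv_le_contravar; [nra|]. assert (c ^ 2 <= (INR n + 1) ^ 2) by (apply pow_incr; lra). lra.
Qed.

(** Of the eight powers of 1/|z| in each error term, six give nu^-6 and the other two are
    summed against the integral of 1/(t^2 + nu^2). *)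
Lemma stirling_sum (nu : R) (N : nat) : 2 <= nu ->
  Rabs (Im (stirling_log nu (INR (S N))) - Im (stirling_log nu 0) - euler_arg (S N) nu)
  <= 40 / nu ^ 6 * (/ nu + atan (INR N / nu) / nu).
Proof.
  intros Hnu.
  assert (Hb : forall n, / (INR n ^ 2 + nu ^ 2) ^ 4 <= / nu ^ 6 * / (INR n ^ 2 + nu ^ 2)).
  { intros n. rewrite <- Rinv_mult. assert (0 < nu ^ 6) by (apply pow_lt; lra).
    assert (Hn := pow2_ge_0 (INR n)). set (q := INR n ^ 2 + nu ^ 2).
    assert (Hq : nu ^ 2 <= q) by (unfold q; lra).
    assert (H3 : (nu ^ 2) ^ 3 <= q ^ 3) by (apply pow_incr; split; [apply pow2_ge_0|trivial]).
    rewrite <- pow_mult in H3. simpl (2 * 3)%nat in H3.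
    assert (0 < q) by nra.
    apply Rinv_le_contravar; [nra|]. replace (q ^ 4) with (q ^ 3 * q) by ring.
    apply Rmult_le_compat_r; lra. }
  assert (H6 : 0 < / nu ^ 6) by (apply Rinv_0_lt_compat, pow_lt; lra).
  assert (Hnu0 : 0 < / nu) by (apply Rinv_0_lt_compat; lra).
  assert (Hstep : forall n,
    Rabs (Im (stirling_log nu (INR (S n))) - Im (stirling_log nu 0) - euler_arg (S n) nu)
    <= Rabs (Im (stirling_log nu (INR n)) - Im (stirling_log nu 0) - euler_arg n nu)
       + 40 * / (INR n ^ 2 + nu ^ 2) ^ 4).
  { intros n. assert (H := stirling_log_step nu (INR n) Hnu (pos_INR n)).
    rewrite <- S_INR in H.
    assert (Ea : log_arg nu (INR (S n)) = atan (nu / INR (S n))).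
    { unfold log_arg. assert (Hk := INR_S_pos n).
      rewrite <- atan_inv by (apply Rdiv_lt_0_compat; lra). f_equal. field. lra. }
    rewrite Ea in H.
    rewrite euler_arg_S.
    eapply Rle_trans; [|apply Rplus_le_compat_l, H].
    eapply Rle_trans; [|apply Rabs_triang]. right. f_equal. ring. }
  induction N as [|N IH].
  - eapply Rle_trans; [apply Hstep|]. simpl (euler_arg 0 nu). simpl (INR 0).
    rewrite Rminus_diag, Rminus_0_r, Rabs_R0.
    assert (H := Hb 0%nat). simpl (INR 0) in H.
    assert (Hsq : / (0 ^ 2 + nu ^ 2) <= / nu) by (apply Rinv_le_contravar; nra).
    replace (0 / nu) with 0 by (unfold Rdiv; ring). rewrite atan_0.
    assert (H2 := Rmult_le_compat_l _ _ _ (Rlt_le _ _ H6) Hsq).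
    unfold Rdiv. lra.
  - eapply Rle_trans; [apply Hstep|].
    eapply Rle_trans; [apply Rplus_le_compat_r, IH|].
    assert (H := Hb (S N)).
    assert (H2 := Rmult_le_compat_l _ _ _ (Rlt_le _ _ H6) (inv_sqr_le_atan nu N ltac:(lra))).
    replace (40 / nu ^ 6 * (/ nu + atan (INR (S N) / nu) / nu)) with
      (40 / nu ^ 6 * (/ nu + atan (INR N / nu) / nu)
       + 40 * (/ nu ^ 6 * ((atan (INR (S N) / nu) - atan (INR N / nu)) / nu)))
      by (field; lra).
    lra.
Qed.

Lemma stirling_log_at_0 (nu : R) : 0 < nu ->
  Im (stirling_log nu 0)
  = nu * ln nu - nu + PI / 4 - / (12 * nu) - / (360 * nu ^ 3) - / (1260 * nu ^ 5).
Proof.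
  intros Hnu. unfold stirling_log, log_mod, log_arg.
  replace (0 / nu) with 0 by (unfold Rdiv; ring). rewrite atan_0.
  replace (ln (0 ^ 2 + nu ^ 2) / 2) with (ln nu)
    by (rewrite pow_i, Rplus_0_l, ln_pow by (trivial; lia); simpl; field).
  assert (E : (/ (0, nu))%C = ((0, - / nu) : C)).
  { unfold Cinv; simpl. f_equal; field; lra. }
  rewrite E. simpl. field. lra.
Qed.

Lemma stirling_log_at_infinity (nu : R) (n : nat) : 1 <= nu ->
  Rabs (nu * ln (INR (S n)) - Im (stirling_log nu (INR (S n)))) <= (nu ^ 3 + nu ^ 3 + nu + 3) * / INR (S n).
Proof.
  intros Hnu. set (t := INR (S n)).
  assert (Ht : 1 <= t) by (apply (le_INR 1); lia).
  set (z := ((t, nu) : C)).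
  assert (Hzt : t <= Cmod z).
  { assert (H1 := re_le_Cmod z). simpl in H1. rewrite Rabs_pos_eq in H1; lra. }
  assert (Hz : z <> 0%C) by (apply nz_of_Cmod_pos; lra).
  set (w := (/ z)%C).
  assert (Hw : Cmod w <= / t) by (unfold w; rewrite Cmod_inv by trivial; apply Rinv_le_contravar; lra).
  assert (Ht1 : / t <= 1) by (rewrite <- Rinv_1; apply Rinv_le_contravar; lra).
  assert (Ht0 : 0 < / t) by (apply Rinv_0_lt_compat; lra).
  assert (Hw0 := Cmod_ge_0 w).
  assert (Hwk : forall k, Rabs (Im (w ^ S k)%C) <= / t).
  { intros k. eapply Rle_trans; [apply Rabs_Im_le_Cmod|]. rewrite Cmod_pow.
    assert (Cmod w ^ k <= 1) by (rewrite <- (pow1 k); apply pow_incr; lra).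
    assert (0 <= Cmod w ^ k) by now apply pow_le. simpl. nra. }
  assert (K1 := Hwk 0%nat). assert (K3 := Hwk 2%nat). assert (K5 := Hwk 4%nat).
  rewrite Cpow_1_r in K1.
  assert (Es : Im (stirling_log nu t)
    = (t + / 2) * log_arg nu t + nu * log_mod nu t - nu
      + Im w / 12 - Im (w ^ 3)%C / 360 + Im (w ^ 5)%C / 1260).
  { unfold stirling_log. fold z w.
    generalize (w ^ 3)%C (w ^ 5)%C. intros [x3 y3] [x5 y5]. destruct w as [x1 y1].
    unfold z. simpl. field. }
  rewrite Es. unfold log_arg.
  rewrite <- atan_inv by (apply Rdiv_lt_0_compat; lra).
  replace (/ (t / nu)) with (nu / t) by (field; lra).
  assert (Hx0 : 0 < nu / t) by (apply Rdiv_lt_0_compat; lra).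
  assert (D := atan_defect_lipschitz (nu / t) 0 (nu / t)
     ltac:(rewrite Rabs_R0; lra) ltac:(rewrite Rabs_pos_eq; lra)).
  rewrite atan_0, !Rminus_0_r in D.
  rewrite (Rabs_pos_eq (nu / t)) in D by lra.
  assert (D2 : Rabs (nu - t * atan (nu / t)) <= nu ^ 3 * / t).
  { replace (nu - t * atan (nu / t)) with (t * (nu / t - atan (nu / t))) by (field; lra).
    rewrite Rabs_mult, (Rabs_pos_eq t) by lra.
    apply Rle_trans with (t * ((nu / t) ^ 2 * (nu / t))); [apply Rmult_le_compat_l; lra|].
    replace (t * ((nu / t) ^ 2 * (nu / t))) with (nu ^ 3 * (/ t * / t)) by (field; lra).
    apply Rmult_le_compat_l; [apply pow_le; lra|nra]. }
  assert (D3 : Rabs (atan (nu / t)) <= nu * / t).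
  { assert (H := atan_lipschitz 0 (nu / t)). rewrite atan_0, !Rminus_0_r in H.
    rewrite (Rabs_pos_eq (nu / t)) in H by lra. exact H. }
  assert (D4 : Rabs (nu * (log_mod nu t - ln t)) <= nu ^ 3 * / t).
  { unfold log_mod.
    assert (Hq : 0 < 1 + (nu / t) ^ 2) by (generalize (pow2_ge_0 (nu / t)); lra).
    replace (t ^ 2 + nu ^ 2) with (t ^ 2 * (1 + (nu / t) ^ 2)) by (field; lra).
    rewrite ln_mult, ln_pow by (trivial; try apply pow_lt; lra).
    replace (nu * ((INR 2 * ln t + ln (1 + (nu / t) ^ 2)) / 2 - ln t))
      with (nu / 2 * ln (1 + (nu / t) ^ 2)) by (simpl INR; field).
    assert (H1 := ln_le_minus1 _ Hq).
    assert (H0 : 0 <= ln (1 + (nu / t) ^ 2)).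
    { rewrite <- ln_1. apply ln_le; [lra|]. generalize (pow2_ge_0 (nu / t)); lra. }
    rewrite Rabs_pos_eq by (apply Rmult_le_pos; lra).
    apply Rle_trans with (nu / 2 * (nu / t) ^ 2); [apply Rmult_le_compat_l; lra|].
    replace (nu / 2 * (nu / t) ^ 2) with (nu ^ 3 * (/ 2 * (/ t * / t))) by (field; lra).
    apply Rmult_le_compat_l; [apply pow_le; lra|nra]. }
  apply Rabs_le_between in K1. apply Rabs_le_between in K3. apply Rabs_le_between in K5.
  apply Rabs_le_between in D2. apply Rabs_le_between in D3. apply Rabs_le_between in D4.
  apply Rabs_le. lra.
Qed.

(** The approximation summed from t = 0 to infinity gives gamma_arg, up to the value at
    t = 0, which is Stirling's formula; there log z has imaginary part pi/2, whence pi/4. *)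
Lemma gamma_arg_asymptotic (nu : R) : 2 <= nu ->
  Rabs (gamma_arg nu - (nu * ln nu - nu + PI / 4
          - / (12 * nu) - / (360 * nu ^ 3) - / (1260 * nu ^ 5))) <= 120 / nu ^ 7.
Proof.
  intros Hnu. rewrite <- stirling_log_at_0 by lra.
  set (D0 := Im (stirling_log nu 0)).
  set (K := nu ^ 3 + nu ^ 3 + nu + 3).
  apply (is_lim_seq_le (fun n => Rabs (gamma_arg_seq n nu - D0))
           (fun n => 120 / nu ^ 7 + K * / INR (S n))
           (Rabs (gamma_arg nu - D0)) (Finite (120 / nu ^ 7))).
  - intros n. unfold gamma_arg_seq.
    assert (H1 := stirling_sum nu n Hnu). assert (H2 := stirling_log_at_infinity nu n ltac:(lra)).
    fold D0 in H1. fold K in H2.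
    assert (Hat : atan (INR n / nu) <= 2).
    { assert (HB := atan_bound (INR n / nu)). assert (HP := PI_4). lra. }
    assert (H7 : 0 < / nu ^ 7) by (apply Rinv_0_lt_compat, pow_lt; lra).
    assert (H3 : 40 / nu ^ 6 * (/ nu + atan (INR n / nu) / nu) <= 120 / nu ^ 7).
    { replace (40 / nu ^ 6 * (/ nu + atan (INR n / nu) / nu))
        with (40 * / nu ^ 7 * (1 + atan (INR n / nu))) by (field; lra).
      unfold Rdiv. nra. }
    replace (_ - _) with ((nu * ln (INR (S n)) - Im (stirling_log nu (INR (S n))))
      + (Im (stirling_log nu (INR (S n))) - D0 - euler_arg (S n) nu)) by ring.
    eapply Rle_trans; [apply Rabs_triang|]. lra.
  - apply (is_lim_seq_abs _ (gamma_arg nu - D0)).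
    apply (is_lim_seq_minus' _ (fun _ => D0) (gamma_arg nu) D0).
    apply is_lim_gamma_arg_seq. apply is_lim_seq_const.
  - replace (Finite (120 / nu ^ 7)) with (Finite (120 / nu ^ 7 + K * 0)) by (f_equal; ring).
    apply is_lim_seq_plus'. apply is_lim_seq_const.
    apply (is_lim_seq_scal_l _ K 0), is_lim_seq_inv_S.
Qed.

(** * The hypergeometric series for large order *)

(** The product of 1 / (j + i nu) for j <= k, written in v = 1 / (i nu). *)
Fixpoint hyp_term (v : C) (k : nat) : C :=
  match k with
  | O => 1%C
  | S k' => (hyp_term v k' * v / (1 + RtoC (INR k) * v))%C
  end.

Lemma hyp_term_S (v : C) (k : nat) :
  hyp_term v (S k) = (hyp_term v k * v / (1 + RtoC (INR (S k)) * v))%C.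
Proof. reflexivity. Qed.

Lemma imaginary_shift_ge_1 (a h : R) : 1 <= Cmod (1 + RtoC a * (0%R, (- h)%R))%C.
Proof.
  eapply Rle_trans; [|apply re_le_Cmod].
  unfold Cplus, Cmult, RtoC, Re; simpl. rewrite Rabs_pos_eq; lra.
Qed.

Lemma hyp_coef_eq (nu : R) (k : nat) : 0 < nu ->
  ((hyp_re nu k, hyp_im nu k) : C) = (RtoC (/ INR (fact k)) * hyp_term (0%R, (- / nu)%R) k)%C.
Proof.
  intros Hnu. set (v := ((0, - / nu) : C)).
  induction k as [|k IH].
  - unfold hyp_re, hyp_im. simpl. rewrite cos_0, sin_0, Rinv_1.
    unfold Cmult, RtoC; simpl. f_equal; field.
  - destruct (hyp_recurrence nu k) as [E1 E2].
    assert (Hk := INR_S_pos k).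
    assert (Hnz : (1 + RtoC (INR (S k)) * v)%C <> 0%C).
    { apply nz_of_Cmod_pos. generalize (imaginary_shift_ge_1 (INR (S k)) (/ nu)). fold v. lra. }
    assert (Hm : ((hyp_re nu (S k), hyp_im nu (S k)) * (RtoC (INR (S k)) * (1 + RtoC (INR (S k)) * v))
       = (hyp_re nu k, hyp_im nu k) * v)%C).
    { rewrite <- E1, <- E2. unfold v, Cmult, Cplus, RtoC; simpl fst; simpl snd. f_equal; field; lra. }
    rewrite hyp_term_S. fold v.
    apply Cmult_cancel_r with (RtoC (INR (S k)) * (1 + RtoC (INR (S k)) * v))%C.
    + intros E. assert (H1 : Cmod (RtoC (INR (S k)) * (1 + RtoC (INR (S k)) * v))%C = 0)
        by (rewrite E; apply Cmod_0).
      rewrite Cmod_mult, Cmod_R, Rabs_pos_eq in H1 by lra.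
      assert (H2 := imaginary_shift_ge_1 (INR (S k)) (/ nu)). fold v in H2. nra.
    + rewrite Hm, IH. replace (fact (S k)) with (S k * fact k)%nat by reflexivity.
      rewrite mult_INR, Rinv_mult. rewrite !RtoC_mult.
      assert (Hf := INR_fact_lt_0 k).
      rewrite !RtoC_inv by lra.
      assert (RtoC (INR (S k)) <> 0%C) by (intros E; apply RtoC_inj in E; lra).
      assert (RtoC (INR (fact k)) <> 0%C) by (intros E; apply RtoC_inj in E; lra).
      field. repeat split; trivial.
Qed.

Lemma hyp_term_bound (h : R) (k : nat) : 0 <= h -> Cmod (hyp_term (0, - h) k) <= h ^ k.
Proof.
  intros Hh. induction k as [|k IH].
  - simpl. rewrite Cmod_1. lra.
  - assert (Hm := imaginary_shift_ge_1 (INR (S k)) h).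
    rewrite hyp_term_S.
    rewrite Cmod_div by (apply nz_of_Cmod_pos; lra). rewrite Cmod_mult.
    assert (Hv : Cmod (0, - h) = h).
    { replace ((0, - h) : C) with (RtoC (- h) * Ci)%C
        by (unfold Ci, RtoC, Cmult; simpl; f_equal; ring).
      rewrite Cmod_mult, Cmod_Ci, Cmod_R, Rabs_Ropp, Rabs_pos_eq; lra. }
    rewrite Hv. assert (Hp := Cmod_ge_0 (hyp_term (0, - h) k)).
    apply Rmult_le_reg_r with (Cmod (1 + RtoC (INR (S k)) * (0%R, (- h)%R))%C); [lra|].
    rewrite div_mul_cancel by lra. simpl pow.
    assert (Hk : 0 <= h * h ^ k) by (apply Rmult_le_pos; trivial; now apply pow_le).
    apply Rle_trans with (h * h ^ k * 1); [nra|]. now apply Rmult_le_compat_l.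
Qed.

(** With G_k for hyp_term v k, (1 + (k+1) v) (G_(k+1) - V) = v (G_k - U) + d v^7, and
    |1 + (k+1) v| >= 1 because v is imaginary: the errors only add up. *)
Lemma hyp_term_next (h b b' d : R) (k : nat) (U V : C) :
  let v := ((0, - h) : C) in
  0 <= h <= 1 ->
  Cmod (hyp_term v k - U)%C <= b * h ^ 7 -> 0 <= b ->
  (v * U - (1 + RtoC (INR (S k)) * v) * V)%C = (RtoC d * v ^ 7)%C ->
  b + Rabs d <= b' ->
  Cmod (hyp_term v (S k) - V)%C <= b' * h ^ 7.
Proof.
  intros v Hh HU Hb Ed Hb'.
  assert (Hm := imaginary_shift_ge_1 (INR (S k)) h). fold v in Hm.
  set (D := (1 + RtoC (INR (S k)) * v)%C) in *.
  assert (HD : D <> 0%C) by (apply nz_of_Cmod_pos; lra).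
  assert (Hv : Cmod v = h).
  { replace v with (RtoC (- h) * Ci)%C
      by (unfold v, Ci, RtoC, Cmult; simpl; f_equal; ring).
    rewrite Cmod_mult, Cmod_Ci, Cmod_R, Rabs_Ropp, Rabs_pos_eq; lra. }
  assert (E : (hyp_term v (S k) - V = (v * (hyp_term v k - U) + RtoC d * v ^ 7) / D)%C).
  { rewrite hyp_term_S.
    fold D. rewrite <- Ed. field. exact HD. }
  rewrite E, Cmod_div by trivial.
  apply Rmult_le_reg_r with (Cmod D); [lra|].
  rewrite div_mul_cancel by lra.
  eapply Rle_trans; [apply Cmod_triangle|].
  rewrite !Cmod_mult, Cmod_pow, Cmod_R, Hv.
  assert (Hh7 : 0 <= h ^ 7) by (apply pow_le; lra).
  assert (Hg := Cmod_ge_0 (hyp_term v k - U)%C).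
  assert (H1 : h * Cmod (hyp_term v k - U)%C <= b * h ^ 7) by nra.
  assert (H2 : (b + Rabs d) * h ^ 7 <= b' * h ^ 7) by (now apply Rmult_le_compat_r).
  assert (H3 : b' * h ^ 7 * 1 <= b' * h ^ 7 * Cmod D).
  { apply Rmult_le_compat_l; trivial. generalize (Rabs_pos d). nra. }
  lra.
Qed.

(** The coefficients are Stirling numbers of the second kind, with alternating signs. *)
Lemma hyp_term_expansions (h : R) : 0 <= h <= 1 ->
  let v := ((0, - h) : C) in
  Cmod (hyp_term v 1 - (v - v ^ 2 + v ^ 3 - v ^ 4 + v ^ 5 - v ^ 6))%C <= 1 * h ^ 7 /\
  Cmod (hyp_term v 2 - (v ^ 2 - 3 * v ^ 3 + 7 * v ^ 4 - 15 * v ^ 5 + 31 * v ^ 6))%C <= 64 * h ^ 7 /\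
  Cmod (hyp_term v 3 - (v ^ 3 - 6 * v ^ 4 + 25 * v ^ 5 - 90 * v ^ 6))%C <= 365 * h ^ 7 /\
  Cmod (hyp_term v 4 - (v ^ 4 - 10 * v ^ 5 + 65 * v ^ 6))%C <= 715 * h ^ 7 /\
  Cmod (hyp_term v 5 - (v ^ 5 - 15 * v ^ 6))%C <= 855 * h ^ 7 /\
  Cmod (hyp_term v 6 - v ^ 6)%C <= 876 * h ^ 7.
Proof.
  intros Hh v.
  assert (H0 : Cmod (hyp_term v 0 - 1)%C <= 0 * h ^ 7).
  { simpl. replace (1 - 1)%C with (RtoC 0) by ring. rewrite Cmod_0. lra. }
  assert (H1 : Cmod (hyp_term v 1 - (v - v ^ 2 + v ^ 3 - v ^ 4 + v ^ 5 - v ^ 6))%C <= 1 * h ^ 7).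
  { apply (hyp_term_next h 0 1 1 0 _ _ Hh H0); [lra| |rewrite Rabs_pos_eq; lra].
    fold v. simpl INR. ring. }
  assert (H2 : Cmod (hyp_term v 2 - (v ^ 2 - 3 * v ^ 3 + 7 * v ^ 4 - 15 * v ^ 5 + 31 * v ^ 6))%C <= 64 * h ^ 7).
  { apply (hyp_term_next h _ 64 (-63) _ _ _ Hh H1); [lra| |rewrite Rabs_left; lra].
    fold v. replace (INR 2) with 2 by (simpl; ring). ring. }
  assert (H3 : Cmod (hyp_term v 3 - (v ^ 3 - 6 * v ^ 4 + 25 * v ^ 5 - 90 * v ^ 6))%C <= 365 * h ^ 7).
  { apply (hyp_term_next h _ 365 301 _ _ _ Hh H2); [lra| |rewrite Rabs_pos_eq; lra].
    fold v. replace (INR 3) with 3 by (simpl; ring). ring. }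
  assert (H4 : Cmod (hyp_term v 4 - (v ^ 4 - 10 * v ^ 5 + 65 * v ^ 6))%C <= 715 * h ^ 7).
  { apply (hyp_term_next h _ 715 (-350) _ _ _ Hh H3); [lra| |rewrite Rabs_left; lra].
    fold v. replace (INR 4) with 4 by (simpl; ring). ring. }
  assert (H5 : Cmod (hyp_term v 5 - (v ^ 5 - 15 * v ^ 6))%C <= 855 * h ^ 7).
  { apply (hyp_term_next h _ 855 140 _ _ _ Hh H4); [lra| |rewrite Rabs_pos_eq; lra].
    fold v. replace (INR 5) with 5 by (simpl; ring). ring. }
  assert (H6 : Cmod (hyp_term v 6 - v ^ 6)%C <= 876 * h ^ 7).
  { apply (hyp_term_next h _ 876 (-21) _ _ _ Hh H5); [lra| |rewrite Rabs_left; lra].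
    fold v. replace (INR 6) with 6 by (simpl; ring). ring. }
  tauto.
Qed.

Lemma hyp_coef_decay (nu : R) (k : nat) : 1 <= nu ->
  Rabs (hyp_re nu k) <= (/ nu) ^ k * / INR (fact k) /\
  Rabs (hyp_im nu k) <= (/ nu) ^ k * / INR (fact k).
Proof.
  intros Hnu. assert (E := hyp_coef_eq nu k ltac:(lra)).
  assert (Hh : 0 <= / nu) by (left; apply Rinv_0_lt_compat; lra).
  assert (Hb := hyp_term_bound (/ nu) k Hh).
  assert (Hm : Cmod (hyp_re nu k, hyp_im nu k) <= (/ nu) ^ k * / INR (fact k)).
  { rewrite E, Cmod_mult, Cmod_R, Rabs_pos_eq by (left; apply inv_fact_le).
    rewrite Rmult_comm. apply Rmult_le_compat_r; trivial. left; apply inv_fact_le. }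
  split; eapply Rle_trans; try exact Hm.
  - apply (re_le_Cmod (hyp_re nu k, hyp_im nu k)).
  - apply (Rabs_Im_le_Cmod (hyp_re nu k, hyp_im nu k)).
Qed.

Lemma PSeries_tail_bound (a : nat -> R) (h x : R) (n : nat) :
  0 <= h <= 1 -> 0 <= x -> (forall x, Rbar_lt (Rabs x) (CV_radius a)) ->
  (forall k, Rabs (a k) <= h ^ k * / INR (fact k)) ->
  Rabs (PSeries a x - sum_f_R0 (fun k => a k * x ^ k) n) <= x ^ S n * exp x * h ^ S n.
Proof.
  intros Hh Hx Hr Ha.
  rewrite (PSeries_decr_n a n x) by (apply CV_radius_inside, Hr).
  replace (_ + _ - _) with (x ^ S n * PSeries (PS_decr_n a (S n)) x) by ring.
  rewrite Rabs_mult, Rabs_pos_eq by now apply pow_le.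
  rewrite Rmult_assoc. apply Rmult_le_compat_l; [now apply pow_le|].
  rewrite Rmult_comm. rewrite <- (Rabs_pos_eq x) at 2 by trivial.
  apply PSeries_le_exp. intros k. unfold PS_decr_n.
  eapply Rle_trans; [apply Ha|].
  apply Rmult_le_compat.
  - apply pow_le; lra.
  - left; apply inv_fact_le.
  - rewrite pow_add. rewrite <- (Rmult_1_r (h ^ S n)) at 2.
    apply Rmult_le_compat_l; [apply pow_le; lra|]. rewrite <- (pow1 k). apply pow_incr; lra.
  - apply Rinv_le_contravar; [apply INR_fact_lt_0|]. apply le_INR, fact_le. lia.
Qed.

(** Terms of index k >= 7 are O(h^7) together; the others are expanded in v = - i h, even
    powers of v being real and odd ones imaginary. The constant c6 is the coefficient of h^6 in
    the real part, which is absorbed in the error. *)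
Lemma F_expansion (c : R) : 0 <= c ->
  exists K, forall nu, 1 <= nu ->
    let h := / nu in
    Rabs (F_im nu c - (- polyC 1 c * h + polyC 3 c * h ^ 3 - polyC 5 c * h ^ 5)) <= K * h ^ 7 /\
    Rabs (F_re nu c - (1 - polyC 2 c * h ^ 2 + polyC 4 c * h ^ 4)) <= K * h ^ 6.
Proof.
  intros Hc.
  set (K1 := c ^ 7 * exp c + (c * 1 + c ^ 2 / 2 * 64 + c ^ 3 / 6 * 365 + c ^ 4 / 24 * 715
             + c ^ 5 / 120 * 855 + c ^ 6 / 720 * 876)).
  set (c6 := c - 31 * c ^ 2 / 2 + 90 * c ^ 3 / 6 - 65 * c ^ 4 / 24 + 15 * c ^ 5 / 120 - c ^ 6 / 720).
  exists (K1 + Rabs c6). intros nu Hnu h.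
  assert (Hh : 0 <= h <= 1).
  { unfold h. split; [left; apply Rinv_0_lt_compat; lra|].
    rewrite <- Rinv_1. apply Rinv_le_contravar; lra. }
  set (v := ((0, - h) : C)).
  destruct (hyp_term_expansions h Hh) as [H1 [H2 [H3 [H4 [H5 H6]]]]]. fold v in H1, H2, H3, H4, H5, H6.
  assert (Hre : forall k, hyp_re nu k = / INR (fact k) * Re (hyp_term v k)).
  { intros k. assert (E := hyp_coef_eq nu k ltac:(lra)). fold h v in E.
    apply (f_equal Re) in E. simpl in E. rewrite E. unfold Re; simpl; ring. }
  assert (Him : forall k, hyp_im nu k = / INR (fact k) * Im (hyp_term v k)).
  { intros k. assert (E := hyp_coef_eq nu k ltac:(lra)). fold h v in E.
    apply (f_equal Im) in E. simpl in E. rewrite E. unfold Im; simpl; ring. }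
  assert (Tre := PSeries_tail_bound (hyp_re nu) h c 6 Hh Hc (hyp_re_radius nu)
                   (fun k => proj1 (hyp_coef_decay nu k Hnu))).
  assert (Tim := PSeries_tail_bound (hyp_im nu) h c 6 Hh Hc (hyp_im_radius nu)
                   (fun k => proj2 (hyp_coef_decay nu k Hnu))).
  fold (F_re nu c) in Tre. fold (F_im nu c) in Tim.
  assert (Sum : forall p : C -> R, p (hyp_term v 0) = p 1%C ->
     sum_f_R0 (fun k => / INR (fact k) * p (hyp_term v k) * c ^ k) 6
     = p 1%C + c * p (hyp_term v 1) + c ^ 2 / 2 * p (hyp_term v 2) + c ^ 3 / 6 * p (hyp_term v 3)
       + c ^ 4 / 24 * p (hyp_term v 4) + c ^ 5 / 120 * p (hyp_term v 5) + c ^ 6 / 720 * p (hyp_term v 6)).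
  { intros p E0. unfold sum_f_R0. rewrite E0.
    replace (INR (fact 0)) with 1 by reflexivity. replace (INR (fact 1)) with 1 by reflexivity.
    replace (INR (fact 2)) with 2 by (simpl; ring). replace (INR (fact 3)) with 6 by (simpl; ring).
    replace (INR (fact 4)) with 24 by (simpl; ring). replace (INR (fact 5)) with 120 by (simpl; ring).
    replace (INR (fact 6)) with 720 by (simpl; ring). field. }
  rewrite (sum_eq _ (fun k => / INR (fact k) * Re (hyp_term v k) * c ^ k)) in Tre
    by (intros k _; rewrite Hre; ring).
  rewrite (sum_eq _ (fun k => / INR (fact k) * Im (hyp_term v k) * c ^ k)) in Tim
    by (intros k _; rewrite Him; ring).
  rewrite (Sum Re eq_refl) in Tre. rewrite (Sum Im eq_refl) in Tim. clear Sum.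
  assert (Comp : forall (G U : C) b, Cmod (G - U)%C <= b ->
     Rabs (Re G - Re U) <= b /\ Rabs (Im G - Im U) <= b).
  { intros G U b Hb. split; eapply Rle_trans; try exact Hb.
    - apply (re_le_Cmod (G - U)). - apply (Rabs_Im_le_Cmod (G - U)). }
  apply Comp in H1. apply Comp in H2. apply Comp in H3.
  apply Comp in H4. apply Comp in H5. apply Comp in H6. clear Comp Hre Him.
  revert H1 H2 H3 H4 H5 H6 Tre Tim.
  generalize (hyp_term v 1) (hyp_term v 2) (hyp_term v 3) (hyp_term v 4) (hyp_term v 5) (hyp_term v 6).
  intros G1 G2 G3 G4 G5 G6 H1 H2 H3 H4 H5 H6 Tre Tim.
  assert (Scale : forall w y b : R, 0 <= w -> Rabs y <= b -> Rabs (w * y) <= w * b).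
  { intros w y b Hw Hy. rewrite Rabs_mult, (Rabs_pos_eq w) by trivial.
    now apply Rmult_le_compat_l. }
  assert (W2 : 0 <= c ^ 2 / 2) by (generalize (pow_le c 2 Hc); lra).
  assert (W3 : 0 <= c ^ 3 / 6) by (generalize (pow_le c 3 Hc); lra).
  assert (W4 : 0 <= c ^ 4 / 24) by (generalize (pow_le c 4 Hc); lra).
  assert (W5 : 0 <= c ^ 5 / 120) by (generalize (pow_le c 5 Hc); lra).
  assert (W6 : 0 <= c ^ 6 / 720) by (generalize (pow_le c 6 Hc); lra).
  assert (Hh7 : 0 <= h ^ 7) by (apply pow_le; lra).
  destruct H1 as [R1 I1], H2 as [R2 I2], H3 as [R3 I3], H4 as [R4 I4], H5 as [R5 I5], H6 as [R6 I6].
  apply (Scale c) in R1; trivial. apply (Scale c) in I1; trivial.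
  apply (Scale _ _ _ W2) in R2. apply (Scale _ _ _ W2) in I2.
  apply (Scale _ _ _ W3) in R3. apply (Scale _ _ _ W3) in I3.
  apply (Scale _ _ _ W4) in R4. apply (Scale _ _ _ W4) in I4.
  apply (Scale _ _ _ W5) in R5. apply (Scale _ _ _ W5) in I5.
  apply (Scale _ _ _ W6) in R6. apply (Scale _ _ _ W6) in I6.
  simpl Re in R1, R2, R3, R4, R5, R6, Tre. simpl Im in I1, I2, I3, I4, I5, I6, Tim.
  apply Rabs_le_between in R1, R2, R3, R4, R5, R6, Tre, I1, I2, I3, I4, I5, I6, Tim.
  assert (HK : (K1 + Rabs c6) * h ^ 7 = K1 * h ^ 7 + Rabs c6 * h ^ 7) by ring.
  assert (Hc6 := Rabs_pos c6).
  unfold polyC. split.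
  - apply Rle_trans with (K1 * h ^ 7); [|nra].
    unfold K1. apply Rabs_le. split; lra.
  - assert (H67 : h ^ 7 <= h ^ 6).
    { replace (h ^ 7) with (h ^ 6 * h) by ring.
      assert (0 <= h ^ 6) by (apply pow_le; lra). nra. }
    assert (Hc6' : Rabs (c6 * h ^ 6) <= Rabs c6 * h ^ 6).
    { rewrite Rabs_mult, (Rabs_pos_eq (h ^ 6)); [lra|apply pow_le; lra]. }
    assert (HK1 : 0 <= K1).
    { unfold K1. assert (0 <= c ^ 7 * exp c)
        by (apply Rmult_le_pos; [now apply pow_le|left; apply exp_pos]). lra. }
    assert (HK2 : K1 * h ^ 7 <= K1 * h ^ 6) by (now apply Rmult_le_compat_l).
    apply Rle_trans with (K1 * h ^ 7 + Rabs (c6 * h ^ 6)); [|lra].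
    apply Rle_trans with (Rabs (F_re nu c - (1 - c / 2 * (-2 + c) * h ^ 2
        + c / 24 * (-24 + 84 * c - 24 * c ^ 2 + c ^ 3) * h ^ 4) - c6 * h ^ 6) + Rabs (c6 * h ^ 6)).
    + eapply Rle_trans; [|apply Rabs_triang]. right; f_equal; ring.
    + apply Rplus_le_compat_r. unfold K1, c6. apply Rabs_le. split; lra.
Qed.

(** * Expansion of the phase for large order *)

Lemma F_re_near_1 (nu c : R) : 1 <= nu -> 0 <= c -> 2 * c * exp c <= nu -> / 2 <= F_re nu c.
Proof.
  intros Hnu Hc Hle.
  assert (Hh : 0 <= / nu <= 1).
  { split; [left; apply Rinv_0_lt_compat; lra|]. rewrite <- Rinv_1. apply Rinv_le_contravar; lra. }
  assert (T := PSeries_tail_bound (hyp_re nu) (/ nu) c 0 Hh Hc (hyp_re_radius nu)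
                   (fun k => proj1 (hyp_coef_decay nu k Hnu))).
  fold (F_re nu c) in T. simpl in T.
  assert (E : hyp_re nu 0 = 1) by (unfold hyp_re; simpl; rewrite cos_0; field).
  rewrite E in T. apply Rabs_le_between in T.
  assert (c * exp c * / nu <= / 2).
  { apply Rmult_le_reg_r with (2 * nu); [lra|].
    replace (c * exp c * / nu * (2 * nu)) with (2 * c * exp c) by (field; lra).
    replace (/ 2 * (2 * nu)) with nu by field. exact Hle. }
  rewrite !Rmult_1_r in T. lra.
Qed.

(** For large nu, F stays in the right half-plane along [0, c], so that the continued
    argument is the principal one. *)
Lemma F_arg_eq_atan (nu c : R) : 1 <= nu -> 0 <= c -> 2 * c * exp c <= nu ->
  F_arg nu c = atan (F_im nu c / F_re nu c).
Proof.
  intros Hnu Hc Hle.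
  enough (H : F_arg nu c - atan (F_im nu c / F_re nu c)
              = F_arg nu 0 - atan (F_im nu 0 / F_re nu 0)).
  { rewrite F_arg_at_0, F_im_at_0 in H. unfold Rdiv in H at 2. rewrite Rmult_0_l, atan_0 in H. lra. }
  apply (constant_of_derive_0 (fun t => F_arg nu t - atan (F_im nu t / F_re nu t))).
  intros t Ht. rewrite Rmin_left, Rmax_right in Ht by trivial.
  assert (HP : / 2 <= F_re nu t).
  { apply F_re_near_1; [trivial|lra|]. apply Rle_trans with (2 * c * exp c); trivial.
    assert (exp t <= exp c) by (apply exp_mono; lra).
    apply Rmult_le_compat; try lra. left; apply exp_pos. }
  assert (Ha := F_arg_derive nu t ltac:(lra)).
  assert (H1 := F_re_derive nu t). assert (H2 := F_im_derive nu t).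
  auto_derive.
  - repeat split; try (eexists; eassumption); lra.
  - rewrite_F_derivatives nu t.
    replace (Derive (fun y : R => F_arg nu y) t) with (F_cross nu t / F_norm2 nu t)
      by (symmetry; apply is_derive_unique, Ha).
    assert (HM := F_norm2_pos nu t ltac:(lra)).
    unfold F_cross. unfold F_norm2 in *. field. repeat split; simpl in *; lra.
Qed.

(** The derivatives differ by - s^6 / (1 + s^2). *)
Lemma atan_taylor (t : R) : Rabs (atan t - (t - t ^ 3 / 3 + t ^ 5 / 5)) <= Rabs t ^ 7.
Proof.
  assert (H := lipschitz_of_derive (fun s => atan s - (s - s ^ 3 / 3 + s ^ 5 / 5))
    (fun s => - (s ^ 6 / (1 + s ^ 2))) 0 t (Rabs t ^ 6)).
  cbv beta in H. rewrite atan_0 in H.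
  replace (atan t - (t - t ^ 3 / 3 + t ^ 5 / 5) - (0 - (0 - 0 ^ 3 / 3 + 0 ^ 5 / 5)))
    with (atan t - (t - t ^ 3 / 3 + t ^ 5 / 5)) in H by field.
  rewrite Rminus_0_r in H. replace (Rabs t ^ 6 * Rabs t) with (Rabs t ^ 7) in H by ring.
  apply H.
  - intros s _. assert (0 <= s ^ 2) by apply pow2_ge_0.
    auto_derive; trivial. field. simpl in *. lra.
  - intros s Hs. assert (0 <= s ^ 2) by apply pow2_ge_0.
    assert (Hst : Rabs s <= Rabs t).
    { apply Rabs_le. unfold Rmin, Rmax in Hs. destruct (Rle_dec 0 t).
      - rewrite Rabs_pos_eq by trivial. lra.
      - rewrite Rabs_left by lra. lra. }
    rewrite Rabs_Ropp, Rabs_div, (Rabs_pos_eq (1 + s ^ 2)) by lra.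
    rewrite <- RPow_abs.
    assert (Rabs s ^ 6 <= Rabs t ^ 6) by (apply pow_incr; split; [apply Rabs_pos|trivial]).
    assert (0 <= Rabs s ^ 6) by (apply pow_le, Rabs_pos).
    apply Rmult_le_reg_r with (1 + s ^ 2); [lra|]. rewrite div_mul_cancel by lra. nra.
Qed.

(** u = O(h^k) along the sequence. The constant is taken nonnegative so that bounds multiply. *)
Definition ord (h : nat -> R) (k : nat) (u : nat -> R) : Prop :=
  exists K, 0 <= K /\ eventually (fun n => Rabs (u n) <= K * h n ^ k).

Definition small_pos (h : nat -> R) : Prop := eventually (fun n => 0 < h n <= 1).

Lemma small_pos_inv (nu : nat -> R) :
  (forall V, eventually (fun n => V < nu n)) -> small_pos (fun n => / nu n).
Proof.
  intros Hinf. unfold small_pos. generalize (Hinf 1). apply filter_imp. intros n Hn. split.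
  - apply Rinv_0_lt_compat; lra.
  - rewrite <- Rinv_1. apply Rinv_le_contravar; lra.
Qed.

Lemma ord_bound (h : nat -> R) (k : nat) (u : nat -> R) (K : R) :
  small_pos h -> eventually (fun n => Rabs (u n) <= K * h n ^ k) -> ord h k u.
Proof.
  intros Hh H. exists (Rabs K). split; [apply Rabs_pos|].
  generalize (filter_and _ _ Hh H). apply filter_imp. intros n [Hn Hu].
  eapply Rle_trans; [exact Hu|]. apply Rmult_le_compat_r; [apply pow_le; lra|apply Rle_abs].
Qed.

Lemma ord_le (h : nat -> R) (k : nat) (u v : nat -> R) :
  eventually (fun n => Rabs (u n) <= Rabs (v n)) -> ord h k v -> ord h k u.
Proof.
  intros H [K [HK Hv]]. exists K. split; trivial.
  generalize (filter_and _ _ H Hv). apply filter_imp. intros n [H1 H2]. lra.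
Qed.

Lemma ord_ext (h : nat -> R) (k : nat) (u v : nat -> R) :
  eventually (fun n => u n = v n) -> ord h k v -> ord h k u.
Proof.
  intros H. apply ord_le. revert H. apply filter_imp. intros n ->. lra.
Qed.

Lemma ord_plus (h : nat -> R) (k : nat) (u v : nat -> R) :
  ord h k u -> ord h k v -> ord h k (fun n => u n + v n).
Proof.
  intros [K [HK Hu]] [L [HL Hv]]. exists (K + L). split; [lra|].
  generalize (filter_and _ _ Hu Hv). apply filter_imp. intros n [H1 H2].
  eapply Rle_trans; [apply Rabs_triang|]. lra.
Qed.

Lemma ord_opp (h : nat -> R) (k : nat) (u : nat -> R) :
  ord h k u -> ord h k (fun n => - u n).
Proof.
  apply ord_le. apply filter_forall. intros n. rewrite Rabs_Ropp. lra.
Qed.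

Lemma ord_minus (h : nat -> R) (k : nat) (u v : nat -> R) :
  ord h k u -> ord h k v -> ord h k (fun n => u n - v n).
Proof. intros Hu Hv. apply (ord_plus h k u (fun n => - v n)); trivial. now apply ord_opp. Qed.

Lemma ord_mult (h : nat -> R) (k l : nat) (u v : nat -> R) :
  ord h k u -> ord h l v -> ord h (k + l) (fun n => u n * v n).
Proof.
  intros [K [HK Hu]] [L [HL Hv]]. exists (K * L). split; [now apply Rmult_le_pos|].
  generalize (filter_and _ _ Hu Hv). apply filter_imp. intros n [H1 H2].
  rewrite Rabs_mult, pow_add.
  replace (K * L * (h n ^ k * h n ^ l)) with ((K * h n ^ k) * (L * h n ^ l)) by ring.
  apply Rmult_le_compat; trivial; apply Rabs_pos.
Qed.

Lemma ord_const (h : nat -> R) (c : R) : ord h 0 (fun _ => c).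
Proof.
  exists (Rabs c). split; [apply Rabs_pos|]. apply filter_forall. intros n. simpl. lra.
Qed.

Lemma ord_weaken (h : nat -> R) (k l : nat) (u : nat -> R) :
  small_pos h -> (l <= k)%nat -> ord h k u -> ord h l u.
Proof.
  intros Hh Hl [K [HK Hu]]. exists K. split; trivial.
  generalize (filter_and _ _ Hh Hu). apply filter_imp. intros n [H1 H2].
  eapply Rle_trans; [exact H2|]. apply Rmult_le_compat_l; trivial.
  replace k with (l + (k - l))%nat by lia. rewrite pow_add.
  rewrite <- (Rmult_1_r (h n ^ l)) at 2. apply Rmult_le_compat_l; [apply pow_le; lra|].
  rewrite <- (pow1 (k - l)). apply pow_incr. lra.
Qed.

Lemma ord_pow_h (h : nat -> R) (k : nat) : small_pos h -> ord h k (fun n => h n ^ k).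
Proof.
  intros Hh. exists 1. split; [lra|]. unfold small_pos in Hh. revert Hh. apply filter_imp. intros n Hn.
  rewrite Rabs_pos_eq by (apply pow_le; lra). lra.
Qed.

Lemma ord_h (h : nat -> R) : small_pos h -> ord h 0 h.
Proof.
  intros Hh. apply ord_weaken with 1%nat; trivial; [lia|].
  generalize (ord_pow_h h 1 Hh). apply ord_ext. apply filter_forall. intros n; ring.
Qed.

Lemma ord0_mult (h u v : nat -> R) : ord h 0 u -> ord h 0 v -> ord h 0 (fun n => u n * v n).
Proof. apply (ord_mult h 0 0). Qed.

Lemma ord0_pow (h u : nat -> R) (k : nat) : ord h 0 u -> ord h 0 (fun n => u n ^ k).
Proof.
  intros Hu. induction k as [|k IH]; simpl.
  - apply ord_const.
  - now apply ord0_mult.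
Qed.

Lemma ord_pow (h u : nat -> R) (k l : nat) : ord h k u -> ord h (l * k) (fun n => u n ^ l).
Proof.
  intros Hu. induction l as [|l IH]; simpl.
  - apply ord_const.
  - now apply ord_mult.
Qed.

Lemma ord_factor (h : nat -> R) (k : nat) (u v : nat -> R) :
  small_pos h -> ord h 0 v -> eventually (fun n => u n = h n ^ k * v n) -> ord h k u.
Proof.
  intros Hh Hv He. apply ord_ext with (fun n => h n ^ k * v n); trivial.
  replace k with (k + 0)%nat at 1 by lia. apply ord_mult; trivial. now apply ord_pow_h.
Qed.

(** Closes goals ord h 0 u where u is a polynomial in bounded sequences. *)
Ltac bounded :=
  repeat first
    [ assumption
    | apply ord_const
    | apply ord_plus
    | apply ord_minus
    | apply ord_opp
    | apply ord0_mult
    | apply ord0_pow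
    | apply ord_h; assumption
    | apply (fun h c Hh => ord_weaken h c 0 _ Hh (Nat.le_0_l c)); assumption ].

(** q1, q3, q5 are the coefficients of the quotient of the expansions of Im F and Re F; the
    coefficients in the conclusion come from atan y = y - y^3/3 + y^5/5 + O(y^7). *)
Lemma F_arg_expansion (c : R) (nu : nat -> R) : 0 <= c ->
  (forall V, eventually (fun n => V < nu n)) ->
  let C1 := polyC 1 c in let C2 := polyC 2 c in let C3 := polyC 3 c in
  let C4 := polyC 4 c in let C5 := polyC 5 c in
  let q1 := - C1 in let q3 := C3 + C2 * q1 in let q5 := - C5 + C2 * q3 - C4 * q1 in
  let h := fun n => / nu n in
  ord h 7 (fun n => F_arg (nu n) c
    - (q1 * h n + (q3 - q1 ^ 3 / 3) * h n ^ 3 + (q5 - q1 ^ 2 * q3 + q1 ^ 5 / 5) * h n ^ 5)).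
Proof.
  intros Hc Hinf. cbv zeta.
  destruct (F_expansion c Hc) as [K HK].
  set (C1 := polyC 1 c) in *. set (C2 := polyC 2 c) in *. set (C3 := polyC 3 c) in *.
  set (C4 := polyC 4 c) in *. set (C5 := polyC 5 c) in *.
  set (q1 := - C1). set (q3 := C3 + C2 * q1). set (q5 := - C5 + C2 * q3 - C4 * q1).
  set (h := fun n => / nu n).
  assert (Hh : small_pos h) by now apply small_pos_inv.
  set (P := fun n => F_re (nu n) c). set (Q := fun n => F_im (nu n) c).
  set (tau := fun n => q1 * h n + q3 * h n ^ 3 + q5 * h n ^ 5).
  assert (Htau0 : ord h 0 tau) by (unfold tau; bounded).
  assert (Htau : ord h 1 tau).
  { apply ord_factor with (fun n => q1 + q3 * h n ^ 2 + q5 * h n ^ 4); trivial; [bounded|].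
    apply filter_forall. intros n. unfold tau. ring. }
  assert (HQ : ord h 7 (fun n => Q n - (- C1 * h n + C3 * h n ^ 3 - C5 * h n ^ 5))).
  { apply ord_bound with K; trivial. generalize (Hinf 1). apply filter_imp.
    intros n Hn. apply (HK (nu n)). lra. }
  assert (HP : ord h 6 (fun n => P n - (1 - C2 * h n ^ 2 + C4 * h n ^ 4))).
  { apply ord_bound with K; trivial. generalize (Hinf 1). apply filter_imp.
    intros n Hn. apply (HK (nu n)). lra. }
  assert (HPlow : eventually (fun n => / 2 <= P n)).
  { generalize (filter_and _ _ (Hinf 1) (Hinf (2 * c * exp c))). apply filter_imp.
    intros n [H1 H2]. apply F_re_near_1; lra. }
  assert (HPinv : ord h 0 (fun n => / P n)).
  { apply ord_bound with 2; trivial. revert HPlow. apply filter_imp. intros n Hn.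
    rewrite Rabs_pos_eq by (left; apply Rinv_0_lt_compat; lra). simpl.
    rewrite Rmult_1_r. rewrite <- (Rinv_inv 2). apply Rinv_le_contravar; lra. }
  assert (Hquot : ord h 7 (fun n => Q n / P n - tau n)).
  { apply ord_ext with (fun n =>
      ((Q n - (- C1 * h n + C3 * h n ^ 3 - C5 * h n ^ 5))
       - (P n - (1 - C2 * h n ^ 2 + C4 * h n ^ 4)) * tau n
       + h n ^ 7 * ((C2 * q5 - C4 * q3) - C4 * q5 * h n ^ 2)) * / P n).
    - revert HPlow. apply filter_imp. intros n Hn. unfold tau, q5, q3, q1. field. lra.
    - apply (ord_mult h 7 0); trivial. apply ord_plus; [apply ord_minus; trivial|].
      + now apply (ord_mult h 6 1).
      + apply (ord_mult h 7 0); [now apply ord_pow_h|bounded]. }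
  assert (Hatan : ord h 7 (fun n => atan (Q n / P n) - atan (tau n))).
  { revert Hquot. apply ord_le. apply filter_forall. intros n. apply atan_lipschitz. }
  assert (Htay : ord h 7 (fun n => atan (tau n) - (tau n - tau n ^ 3 / 3 + tau n ^ 5 / 5))).
  { apply ord_le with (fun n => tau n ^ 7).
    - apply filter_forall. intros n. rewrite <- RPow_abs. apply atan_taylor.
    - now apply (ord_pow h tau 1 7). }
  set (w := fun n => q3 + q5 * h n ^ 2). set (sg := fun n => q1 + h n ^ 2 * w n).
  assert (Hw : ord h 0 w) by (unfold w; bounded).
  assert (Hsg : ord h 0 sg) by (unfold sg; bounded).
  assert (Hpoly : ord h 7 (fun n => (tau n - tau n ^ 3 / 3 + tau n ^ 5 / 5)
     - (q1 * h n + (q3 - q1 ^ 3 / 3) * h n ^ 3 + (q5 - q1 ^ 2 * q3 + q1 ^ 5 / 5) * h n ^ 5))).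
  { apply ord_factor with (fun n =>
       / 5 * (w n * (sg n ^ 4 + sg n ^ 3 * q1 + sg n ^ 2 * q1 ^ 2 + sg n * q1 ^ 3 + q1 ^ 4))
       - / 3 * (3 * q1 ^ 2 * q5 + 3 * q1 * w n ^ 2 + h n ^ 2 * w n ^ 3)); trivial; [bounded|].
    apply filter_forall. intros n. unfold tau, sg, w. field. }
  apply ord_ext with (fun n =>
    (atan (Q n / P n) - atan (tau n))
    + (atan (tau n) - (tau n - tau n ^ 3 / 3 + tau n ^ 5 / 5))
    + ((tau n - tau n ^ 3 / 3 + tau n ^ 5 / 5)
     - (q1 * h n + (q3 - q1 ^ 3 / 3) * h n ^ 3 + (q5 - q1 ^ 2 * q3 + q1 ^ 5 / 5) * h n ^ 5))).
  - generalize (filter_and _ _ (Hinf 1) (Hinf (2 * c * exp c))). apply filter_imp.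
    intros n [H1 H2]. rewrite F_arg_eq_atan by lra. unfold P, Q. change (/ nu n) with (h n). field.
  - apply ord_plus; [apply ord_plus|]; trivial.
Qed.

Lemma ln_lambda (x v : R) : 0 < x -> 0 < v -> ln (lambda x * v) = ln v - 1 - ln (x / 2).
Proof.
  intros Hx Hv. unfold lambda. assert (He := exp_pos 1).
  replace (2 / (exp 1 * x) * v) with (v * (/ exp 1 * / (x / 2))) by (field; lra).
  rewrite !ln_mult, !ln_Rinv, ln_exp; try (apply Rinv_0_lt_compat); try lra.
  apply Rmult_lt_0_compat; apply Rinv_0_lt_compat; lra.
Qed.

(** The A_k separate into a part from F and a part from Stirling's series, as they are the
    coefficients of the logarithm of the product of both series. *)
Lemma A_coef_values (x : R) :
  let c := x ^ 2 / 4 in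
  A0 x = c - 1 / 12 /\
  Defs.A1 x = - (c - c ^ 2 / 2 + 1 / 360) /\
  A2 x = polyC 5 c + polyC 2 c ^ 2 * polyC 1 c - polyC 2 c * polyC 3 c - polyC 4 c * polyC 1 c
         + polyC 1 c ^ 2 * (polyC 3 c - polyC 2 c * polyC 1 c) + polyC 1 c ^ 5 / 5 - 1 / 1260.
Proof.
  intros c.
  assert (H1 : a_coef x 1 = polyC 1 c + gam 1).
  { unfold a_coef. fold c. rewrite sum_n_n. simpl. ring. }
  assert (H2 : a_coef x 2 = polyC 2 c + (gam 1 * polyC 1 c + gam 2)).
  { unfold a_coef. fold c. rewrite sum_n_Sm by lia. rewrite sum_n_n.
    change plus with Rplus. simpl. ring. }
  assert (H3 : a_coef x 3 = polyC 3 c + (gam 1 * polyC 2 c + gam 2 * polyC 1 c + gam 3)).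
  { unfold a_coef. fold c. rewrite !sum_n_Sm by lia. rewrite sum_n_m_zero by lia.
    change plus with Rplus. change zero with 0. simpl. ring. }
  assert (H4 : a_coef x 4 = polyC 4 c
     + (gam 1 * polyC 3 c + gam 2 * polyC 2 c + gam 3 * polyC 1 c + gam 4)).
  { unfold a_coef. fold c. rewrite !sum_n_Sm by lia. rewrite sum_n_m_zero by lia.
    change plus with Rplus. change zero with 0. simpl. ring. }
  assert (H5 : a_coef x 5 = polyC 5 c
     + (gam 1 * polyC 4 c + gam 2 * polyC 3 c + gam 3 * polyC 2 c + gam 4 * polyC 1 c + gam 5)).
  { unfold a_coef. fold c. rewrite !sum_n_Sm by lia. rewrite sum_n_m_zero by lia.
    change plus with Rplus. change zero with 0. simpl. ring. }
  unfold A0, Defs.A1, A2. rewrite H1, H2, H3, H4, H5. unfold polyC, gam.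
  repeat split; field.
Qed.

(** ln (lambda nu) = ln nu - 1 - ln (x/2) collects the leading terms of gamma_arg and theta. *)
Lemma phase_expansion (x : R) (nu : nat -> R) : 0 < x ->
  (forall V, eventually (fun n => V < nu n)) ->
  let h := fun n => / nu n in
  ord h 7 (fun n => theta (nu n) (2 * ln (x / 2))
    - (nu n * ln (lambda x * nu n) + PI / 4 + A0 x * h n + Defs.A1 x * h n ^ 3 + A2 x * h n ^ 5)).
Proof.
  intros Hx Hinf h.
  assert (Hh : small_pos h) by now apply small_pos_inv.
  set (c := x ^ 2 / 4).
  assert (Hc : 0 <= c) by (unfold c; generalize (pow2_ge_0 x); lra).
  assert (Ec : exp (2 * ln (x / 2)) = c).
  { replace (2 * ln (x / 2)) with (ln (x / 2) + ln (x / 2)) by ring.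
    rewrite exp_plus, exp_ln by lra. unfold c. field. }
  assert (HF := F_arg_expansion c nu Hc Hinf). cbv zeta in HF. fold h in HF.
  assert (HG : ord h 7 (fun n => gamma_arg (nu n) - (nu n * ln (nu n) - nu n + PI / 4
      - / (12 * nu n) - / (360 * nu n ^ 3) - / (1260 * nu n ^ 5)))).
  { apply ord_bound with 120; trivial. generalize (Hinf 2). apply filter_imp. intros n Hn.
    eapply Rle_trans; [apply gamma_arg_asymptotic; lra|].
    unfold h, Rdiv. rewrite pow_inv. lra. }
  generalize (ord_minus _ _ _ _ HG HF). apply ord_ext.
  generalize (Hinf 0). apply filter_imp. intros n Hn.
  unfold theta. rewrite Ec, ln_lambda by lra.
  destruct (A_coef_values x) as [E0 [E1 E2]]. fold c in E0, E1, E2. rewrite E0, E1, E2.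
  fold (h n). replace (/ (12 * nu n)) with (h n / 12) by (unfold h; field; lra).
  replace (/ (360 * nu n ^ 3)) with (h n ^ 3 / 360) by (unfold h; field; lra).
  replace (/ (1260 * nu n ^ 5)) with (h n ^ 5 / 1260) by (unfold h; field; lra).
  unfold polyC. field.
Qed.

(** * Inversion of the phase equation *)

Lemma xlogx_taylor (d : R) : Rabs d <= / 2 ->
  Rabs ((1 + d) * ln (1 + d) - (d + d ^ 2 / 2 - d ^ 3 / 6)) <= 2 * Rabs d ^ 4.
Proof.
  intros Hd.
  assert (Hrange : forall t, Rmin 0 d <= t <= Rmax 0 d -> Rabs t <= Rabs d /\ / 2 <= 1 + t).
  { intros t Ht. assert (Ht' : Rabs t <= Rabs d).
    { apply Rabs_le. unfold Rmin, Rmax in Ht. destruct (Rle_dec 0 d).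
      - rewrite Rabs_pos_eq by trivial. lra.
      - rewrite Rabs_left by lra. lra. }
    split; trivial. assert (Rabs t <= / 2) by lra. apply Rabs_le_between in H. lra. }
  assert (Hsub : forall t s, Rmin 0 d <= t <= Rmax 0 d -> Rmin 0 t <= s <= Rmax 0 t ->
      Rmin 0 d <= s <= Rmax 0 d).
  { intros t s. unfold Rmin, Rmax. destruct (Rle_dec 0 d), (Rle_dec 0 t); lra. }
  assert (H1 : forall t, Rmin 0 d <= t <= Rmax 0 d ->
     Rabs (ln (1 + t) - t + t ^ 2 / 2) <= 2 * Rabs d ^ 3).
  { intros t Ht.
    assert (H := lipschitz_of_derive (fun s => ln (1 + s) - s + s ^ 2 / 2)
       (fun s => s ^ 2 / (1 + s)) 0 t (2 * Rabs d ^ 2)).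
    cbv beta in H. rewrite Rplus_0_r, ln_1 in H.
    replace (ln (1 + t) - t + t ^ 2 / 2 - (0 - 0 + 0 ^ 2 / 2))
      with (ln (1 + t) - t + t ^ 2 / 2) in H by field.
    rewrite Rminus_0_r in H. eapply Rle_trans; [apply H|].
    - intros s Hs. destruct (Hrange s (Hsub t s Ht Hs)) as [_ Hs2].
      auto_derive; [lra|]. field. lra.
    - intros s Hs. destruct (Hrange s (Hsub t s Ht Hs)) as [Hs1 Hs2].
      rewrite Rabs_div, <- RPow_abs, (Rabs_pos_eq (1 + s)) by lra.
      assert (Rabs s ^ 2 <= Rabs d ^ 2) by (apply pow_incr; split; [apply Rabs_pos|trivial]).
      assert (0 <= Rabs s ^ 2) by (apply pow_le, Rabs_pos).
      apply Rmult_le_reg_r with (1 + s); [lra|]. rewrite div_mul_cancel by lra. nra.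
    - destruct (Hrange t Ht) as [Ht1 _]. assert (H0 := pow_le _ 2 (Rabs_pos d)).
      replace (2 * Rabs d ^ 3) with (2 * Rabs d ^ 2 * Rabs d) by ring.
      apply Rmult_le_compat_l; lra. }
  assert (H := lipschitz_of_derive (fun s => (1 + s) * ln (1 + s) - (s + s ^ 2 / 2 - s ^ 3 / 6))
       (fun s => ln (1 + s) - s + s ^ 2 / 2) 0 d (2 * Rabs d ^ 3)).
  cbv beta in H. rewrite Rplus_0_r, ln_1 in H.
  replace ((1 + d) * ln (1 + d) - (d + d ^ 2 / 2 - d ^ 3 / 6) - (1 * 0 - (0 + 0 ^ 2 / 2 - 0 ^ 3 / 6)))
    with ((1 + d) * ln (1 + d) - (d + d ^ 2 / 2 - d ^ 3 / 6)) in H by field.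
  rewrite Rminus_0_r in H. replace (2 * Rabs d ^ 4) with (2 * Rabs d ^ 3 * Rabs d) by ring.
  apply H; trivial.
  intros s Hs. destruct (Hrange s Hs) as [_ Hs2]. auto_derive; [lra|]. field. lra.
Qed.

(** The expanded phase without pi/4 and its error term; its value at the zero number n is
    m_minus n up to O(1/nu^7). *)
Definition phase_model (lam a0 a1 a2 t : R) : R :=
  t * ln (lam * t) + a0 * / t + a1 * (/ t) ^ 3 + a2 * (/ t) ^ 5.

(** The derivative is 1 + ln (lam t) + O(1/t^2), hence at least 1/2 far out: the distance of
    two arguments is at most twice that of the values, so an approximate root is close to the root. *)
Lemma phase_model_expanding (lam a0 a1 a2 : R) : 0 < lam ->
  exists T, 0 < T /\ forall s t, T <= s -> T <= t ->
    Rabs (t - s) <= 2 * Rabs (phase_model lam a0 a1 a2 t - phase_model lam a0 a1 a2 s).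
Proof.
  intros Hlam. set (N := Rabs a0 + 3 * Rabs a1 + 5 * Rabs a2).
  assert (H0 := Rabs_pos a0). assert (H1 := Rabs_pos a1). assert (H2 := Rabs_pos a2).
  set (T := Rmax 1 (Rmax (2 * N) (/ lam))).
  assert (HT1 : 1 <= T) by apply Rmax_l.
  assert (HT2 : 2 * N <= T) by (eapply Rle_trans; [apply Rmax_l|apply Rmax_r]).
  assert (HT3 : / lam <= T) by (eapply Rle_trans; [apply Rmax_r|apply Rmax_r]).
  exists T. split; [lra|]. intros s t Hs Ht.
  set (df := fun u => ln (lam * u) + 1 - a0 * (/ u) ^ 2 - 3 * a1 * (/ u) ^ 4 - 5 * a2 * (/ u) ^ 6).
  assert (Hdf : forall u, T <= u -> / 2 <= df u).
  { intros u Hu. unfold df.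
    assert (Hln : 0 <= ln (lam * u)).
    { rewrite <- ln_1. apply ln_le; [lra|].
      replace 1 with (lam * / lam) by (field; lra). apply Rmult_le_compat_l; lra. }
    set (h := / u).
    assert (Hh0 : 0 < h) by (apply Rinv_0_lt_compat; lra).
    assert (Hh1 : h <= 1) by (unfold h; rewrite <- Rinv_1; apply Rinv_le_contravar; lra).
    assert (HhS : N * h <= / 2).
    { apply Rmult_le_reg_r with u; [lra|]. unfold h. rewrite Rmult_assoc, Rinv_l by lra. lra. }
    assert (Hp : forall k, 0 <= h ^ k <= 1).
    { intros k. split; [apply pow_le; lra|]. rewrite <- (pow1 k). apply pow_incr; lra. }
    assert (Hb : forall a k, Rabs (a * h ^ S k) <= Rabs a * h).
    { intros a k. rewrite Rabs_mult. apply Rmult_le_compat_l; [apply Rabs_pos|].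
      rewrite Rabs_pos_eq by apply Hp. simpl. specialize (Hp k). nra. }
    assert (B0 := Hb a0 1%nat). assert (B1 := Hb a1 3%nat). assert (B2 := Hb a2 5%nat).
    apply Rabs_le_between in B0. apply Rabs_le_between in B1. apply Rabs_le_between in B2.
    unfold N in HhS. lra. }
  destruct (MVT_gen (phase_model lam a0 a1 a2) s t df) as [u [Hu E]].
  - intros u Hu.
    assert (Hu0 : T <= u) by (unfold Rmin, Rmax in Hu; destruct (Rle_dec s t); lra).
    unfold phase_model, df. auto_derive; [repeat split; try lra; nra|]. field. split; nra.
  - intros u Hu.
    assert (Hu0 : T <= u) by (unfold Rmin, Rmax in Hu; destruct (Rle_dec s t); lra).
    apply continuity_pt_filterlim. apply (ex_derive_continuous (V := R_NormedModule)).
    unfold phase_model. auto_derive. repeat split; try lra; nra.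
  - assert (Hu0 : T <= u) by (unfold Rmin, Rmax in Hu; destruct (Rle_dec s t); lra).
    rewrite E, Rabs_mult. specialize (Hdf u Hu0). rewrite (Rabs_pos_eq (df u)) by lra.
    generalize (Rabs_pos (t - s)). nra.
Qed.

Lemma ord_eventually_le (h u : nat -> R) (eps : R) :
  0 < eps -> (forall V, eventually (fun n => V < h n)) ->
  ord (fun n => / h n) 1 u -> eventually (fun n => Rabs (u n) <= eps).
Proof.
  intros He Hinf [K [HK Hu]].
  generalize (filter_and _ _ Hu (filter_and _ _ (Hinf 0) (Hinf (K / eps)))).
  apply filter_imp. intros n [H1 [H2 H3]]. eapply Rle_trans; [exact H1|].
  apply Rmult_le_reg_r with (h n); [lra|].
  replace (K * (/ h n) ^ 1 * h n) with (eps * (K / eps)) by (field; lra).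
  apply Rmult_le_compat_l; lra.
Qed.

(** A first crude inversion: both v and X nearly solve t ln (lam t) = m, so they differ by at
    most 1, and error terms in 1/v may be read in 1/X. *)
Lemma inverse_comparable (lam a0 a1 a2 : R) (v X m : nat -> R) :
  0 < lam ->
  (forall V, eventually (fun n => V < v n)) ->
  (forall V, eventually (fun n => V < X n)) ->
  eventually (fun n => X n * ln (lam * X n) = m n) ->
  ord (fun n => / v n) 7 (fun n => phase_model lam a0 a1 a2 (v n) - m n) ->
  eventually (fun n => / v n <= 2 * / X n).
Proof.
  intros lam_pos v_inf X_inf X_eq v_eq.
  set (h := fun n => / v n).
  assert (Hh : small_pos h) by now apply small_pos_inv.
  destruct (phase_model_expanding lam 0 0 0 lam_pos) as [T [HT Hexp]].
  assert (Hd : ord h 1 (fun n => phase_model lam 0 0 0 (v n) - m n)).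
  { apply ord_ext with (fun n => (phase_model lam a0 a1 a2 (v n) - m n)
       - h n ^ 1 * (a0 + a1 * h n ^ 2 + a2 * h n ^ 4)).
    - apply filter_forall. intros n. unfold phase_model. fold (h n). ring.
    - apply ord_minus.
      + apply ord_weaken with 7%nat; trivial. lia.
      + apply (ord_mult h 1 0); [now apply ord_pow_h|bounded]. }
  assert (H := ord_eventually_le v _ (/ 2) ltac:(lra) v_inf Hd).
  generalize (filter_and _ _ (filter_and _ _ H X_eq)
    (filter_and _ _ (filter_and _ _ (v_inf T) (X_inf T)) (X_inf 2))).
  apply filter_imp. intros n [[H1 H2] [[H3 H4] H5]].
  specialize (Hexp (X n) (v n) ltac:(lra) ltac:(lra)).
  replace (phase_model lam 0 0 0 (X n)) with (m n) in Hexp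
    by (rewrite <- H2; unfold phase_model; ring).
  assert (H6 : Rabs (v n - X n) <= 1) by lra.
  apply Rabs_le_between in H6.
  replace (2 * / X n) with (/ (X n / 2)) by (field; lra).
  apply Rinv_le_contravar; lra.
Qed.

Lemma ord_change_scale (g h : nat -> R) (k : nat) (M : R) (u : nat -> R) :
  0 <= M -> eventually (fun n => 0 <= h n <= M * g n) -> ord h k u -> ord g k u.
Proof.
  intros HM Hgh [K [HK H]]. exists (K * M ^ k).
  split; [apply Rmult_le_pos; trivial; now apply pow_le|].
  generalize (filter_and _ _ H Hgh). apply filter_imp. intros n [H1 H2].
  eapply Rle_trans; [exact H1|].
  rewrite Rmult_assoc, <- Rpow_mult_distr. apply Rmult_le_compat_l; trivial.
  now apply pow_incr.
Qed.

(** Insert X (1 + d) with d = O(g^2) into the phase. Since X ln (lam X) = m, the terms of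
    order g, g^3 and g^5 of the difference with m are L c_i minus the stated right sides. *)
Lemma approximate_root (lam a0 a1 a2 : R) (X m c0 c1 c2 : nat -> R) :
  let g := fun n => / X n in
  let L := fun n => 1 + ln (lam * X n) in
  0 < lam ->
  (forall V, eventually (fun n => V < X n)) ->
  eventually (fun n => X n * ln (lam * X n) = m n) ->
  eventually (fun n => L n * c0 n = - a0) ->
  eventually (fun n => L n * c1 n = a0 * c0 n - a1 - / 2 * c0 n ^ 2) ->
  eventually (fun n => L n * c2 n =
    3 * a1 * c0 n - a0 * (c0 n ^ 2 - c1 n) - a2 - c0 n * c1 n + / 6 * c0 n ^ 3) ->
  ord g 0 c0 -> ord g 0 c1 -> ord g 0 c2 ->
  let approx := fun n => X n + c0 n * g n + c1 n * g n ^ 3 + c2 n * g n ^ 5 in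
  (forall V, eventually (fun n => V < approx n)) /\
  ord g 7 (fun n => phase_model lam a0 a1 a2 (approx n) - m n).
Proof.
  intros g L lam_pos X_inf X_eq c0_eq c1_eq c2_eq c0_bdd c1_bdd c2_bdd approx.
  assert (Hg : small_pos g) by now apply small_pos_inv.
  set (D := fun n => c0 n + c1 n * g n ^ 2 + c2 n * g n ^ 4).
  set (d := fun n => g n ^ 2 * D n).
  assert (HD : ord g 0 D) by (unfold D; bounded).
  assert (Hd : ord g 2 d) by (apply (ord_mult g 2 0); trivial; now apply ord_pow_h).
  assert (d_small : eventually (fun n => Rabs (d n) <= / 2)).
  { apply (ord_eventually_le X); [lra|trivial|].
    apply ord_weaken with 2%nat; trivial. lia. }
  assert (Eapprox : eventually (fun n => approx n = X n * (1 + d n))).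
  { generalize (X_inf 0). apply filter_imp. intros n Hn. unfold approx, d, D, g. field. lra. }
  split.
  { intros V. generalize (filter_and _ _ (filter_and _ _ d_small Eapprox)
      (filter_and _ _ (X_inf 0) (X_inf (2 * V)))).
    apply filter_imp. intros n [[H1 H0] [H2 H3]]. apply Rabs_le_between in H1. rewrite H0. nra. }
  assert (He : ord g 0 (fun n => / (1 + d n))).
  { apply ord_bound with 2; trivial. generalize d_small. apply filter_imp.
    intros n Hn. apply Rabs_le_between in Hn.
    rewrite Rabs_pos_eq by (left; apply Rinv_0_lt_compat; lra).
    simpl. rewrite Rmult_1_r, <- (Rinv_inv 2). apply Rinv_le_contravar; lra. }
  assert (Hd0 : ord g 0 d) by (apply ord_weaken with 2%nat; trivial; lia).
  set (e := fun n => / (1 + d n)) in *.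
  set (r1 := fun n => (1 + d n) * ln (1 + d n) - (d n + d n ^ 2 / 2 - d n ^ 3 / 6)).
  assert (H1 : ord g 7 (fun n => X n * r1 n)).
  { assert (Hr : ord g 8 r1).
    { apply ord_le with (fun n => 2 * d n ^ 4).
      - generalize d_small. apply filter_imp. intros n Hn.
        rewrite Rabs_mult, (Rabs_pos_eq 2), <- RPow_abs by lra. now apply xlogx_taylor.
      - apply (ord_mult g 0 8); [apply ord_const|]. now apply (ord_pow g d 2 4). }
    destruct Hr as [K [HK Hr]]. exists K. split; trivial.
    generalize (filter_and _ _ Hr (X_inf 0)). apply filter_imp. intros n [Hn Hx].
    rewrite Rabs_mult, (Rabs_pos_eq (X n)) by lra.
    apply Rle_trans with (X n * (K * g n ^ 8)); [apply Rmult_le_compat_l; lra|].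
    right. unfold g. field. lra. }
  set (E := fun n => c1 n + g n ^ 2 * c2 n).
  assert (HE : ord g 0 E) by (unfold E; bounded).
  assert (H2 : ord g 7 (fun n => g n ^ 7 * (- 3 * a1 * E n + a0 * E n * (D n + c0 n) - a0 * c2 n
      + c1 n * E n / 2 + c2 n * c0 n + g n ^ 2 * c2 n * E n / 2
      - E n * (D n ^ 2 + D n * c0 n + c0 n ^ 2) / 6))).
  { apply (ord_mult g 7 0); [now apply ord_pow_h|]. unfold Rdiv. bounded. }
  assert (H3 : ord g 7 (fun n => a0 * g n ^ 1 * (- (d n ^ 3 * e n)))).
  { apply (ord_mult g 1 6).
    - apply (ord_mult g 0 1); [apply ord_const|now apply ord_pow_h].
    - apply ord_opp, (ord_mult g 6 0); trivial. now apply (ord_pow g d 2 3). }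
  assert (H4 : ord g 7 (fun n => a1 * g n ^ 3 * (d n ^ 2 * ((6 + 8 * d n + 3 * d n ^ 2) * e n ^ 3)))).
  { apply (ord_mult g 3 4).
    - apply (ord_mult g 0 3); [apply ord_const|now apply ord_pow_h].
    - apply (ord_mult g 4 0); [now apply (ord_pow g d 2 2)|bounded]. }
  assert (H5 : ord g 7 (fun n => a2 * g n ^ 5 * (d n *
      (- ((5 + 10 * d n + 10 * d n ^ 2 + 5 * d n ^ 3 + d n ^ 4) * e n ^ 5))))).
  { apply (ord_mult g 5 2).
    - apply (ord_mult g 0 5); [apply ord_const|now apply ord_pow_h].
    - apply (ord_mult g 2 0); [trivial|bounded]. }
  generalize (ord_plus _ _ _ _ H1 (ord_plus _ _ _ _ H2 (ord_plus _ _ _ _ H3 (ord_plus _ _ _ _ H4 H5)))).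
  apply ord_ext.
  generalize (filter_and _ _ (filter_and _ _ d_small (filter_and _ _ Eapprox (X_inf 0)))
    (filter_and _ _ X_eq (filter_and _ _ c0_eq (filter_and _ _ c1_eq c2_eq)))).
  apply filter_imp. intros n [[Hdn [Hap HX]] [HXe [E0 [E1 E2]]]].
  apply Rabs_le_between in Hdn.
  rewrite Hap. unfold phase_model.
  replace (lam * (X n * (1 + d n))) with ((lam * X n) * (1 + d n)) by ring.
  rewrite ln_mult by (try apply Rmult_lt_0_compat; lra).
  replace (/ (X n * (1 + d n))) with (g n * e n) by (unfold g, e; field; lra).
  rewrite <- HXe.
  assert (Ee : e n * (1 + d n) = 1) by (unfold e; field; lra).
  assert (Eg : X n * g n = 1) by (unfold g; field; lra).
  (* With X d = g D the three equations for L c_i remove the powers g, g^3 and g^5. *)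
  assert (Emain : X n * d n * L n + X n * (d n ^ 2 / 2 - d n ^ 3 / 6)
     + a0 * g n * (1 - d n + d n ^ 2) + a1 * g n ^ 3 * (1 - 3 * d n) + a2 * g n ^ 5
     = g n ^ 7 * (- 3 * a1 * E n + a0 * E n * (D n + c0 n) - a0 * c2 n
      + c1 n * E n / 2 + c2 n * c0 n + g n ^ 2 * c2 n * E n / 2
      - E n * (D n ^ 2 + D n * c0 n + c0 n ^ 2) / 6)).
  { assert (EXd : X n * d n = g n * D n).
    { unfold d. replace (X n * (g n ^ 2 * D n)) with ((X n * g n) * g n * D n) by ring.
      rewrite Eg; ring. }
    assert (ELD : D n * L n = - a0 + g n ^ 2 * (a0 * c0 n - a1 - / 2 * c0 n ^ 2)
       + g n ^ 4 * (3 * a1 * c0 n - a0 * (c0 n ^ 2 - c1 n) - a2 - c0 n * c1 n + / 6 * c0 n ^ 3)).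
    { rewrite <- E0, <- E1, <- E2. unfold D. ring. }
    replace (X n * d n * L n) with (g n * (D n * L n)) by (rewrite EXd; ring).
    replace (X n * (d n ^ 2 / 2 - d n ^ 3 / 6)) with ((X n * d n) * (d n / 2 - d n ^ 2 / 6))
      by field.
    rewrite ELD, EXd. unfold d. unfold D, E. field. }
  assert (R2 : e n - (1 - d n + d n ^ 2) = - (d n ^ 3 * e n)).
  { replace (1 - d n + d n ^ 2) with ((1 - d n + d n ^ 2) * (e n * (1 + d n))) by (rewrite Ee; ring). ring. }
  assert (R3 : e n ^ 3 - (1 - 3 * d n) = d n ^ 2 * ((6 + 8 * d n + 3 * d n ^ 2) * e n ^ 3)).
  { replace (1 - 3 * d n) with ((1 - 3 * d n) * (e n * (1 + d n)) ^ 3) by (rewrite Ee; ring). ring. }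
  assert (R4 : e n ^ 5 - 1 = d n * (- ((5 + 10 * d n + 10 * d n ^ 2 + 5 * d n ^ 3 + d n ^ 4) * e n ^ 5))).
  { replace 1 with ((e n * (1 + d n)) ^ 5) at 1 by (rewrite Ee; ring). ring. }
  rewrite <- Emain, <- R2, <- R3, <- R4. unfold L, r1. field.
Qed.

(** The sequence v and the approximate root have phases that differ by O(g^7), and the phase
    expands distances. *)
Lemma inversion_expansion (lam a0 a1 a2 : R) (v X m c0 c1 c2 : nat -> R) :
  let g := fun n => / X n in
  let L := fun n => 1 + ln (lam * X n) in
  0 < lam ->
  (forall V, eventually (fun n => V < v n)) ->
  (forall V, eventually (fun n => V < X n)) ->
  eventually (fun n => X n * ln (lam * X n) = m n) ->
  ord (fun n => / v n) 7 (fun n => phase_model lam a0 a1 a2 (v n) - m n) ->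
  eventually (fun n => L n * c0 n = - a0) ->
  eventually (fun n => L n * c1 n = a0 * c0 n - a1 - / 2 * c0 n ^ 2) ->
  eventually (fun n => L n * c2 n =
    3 * a1 * c0 n - a0 * (c0 n ^ 2 - c1 n) - a2 - c0 n * c1 n + / 6 * c0 n ^ 3) ->
  ord g 0 c0 -> ord g 0 c1 -> ord g 0 c2 ->
  ord g 7 (fun n => v n - (X n + c0 n * g n + c1 n * g n ^ 3 + c2 n * g n ^ 5)).
Proof.
  intros g L lam_pos v_inf X_inf X_eq v_eq E0 E1 E2 B0 B1 B2.
  destruct (approximate_root lam a0 a1 a2 X m c0 c1 c2 lam_pos X_inf X_eq E0 E1 E2 B0 B1 B2)
    as [approx_inf approx_res].
  destruct (phase_model_expanding lam a0 a1 a2 lam_pos) as [T [HT Hexp]].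
  assert (v_res : ord g 7 (fun n => phase_model lam a0 a1 a2 (v n) - m n)).
  { apply ord_change_scale with (fun n => / v n) 2; trivial; [lra|].
    generalize (filter_and _ _ (v_inf 0) (inverse_comparable lam a0 a1 a2 v X m lam_pos v_inf X_inf X_eq v_eq)).
    apply filter_imp. intros n [H1 H2]. split; trivial. left. now apply Rinv_0_lt_compat. }
  set (approx := fun n => X n + c0 n * g n + c1 n * g n ^ 3 + c2 n * g n ^ 5) in *.
  change (ord g 7 (fun n => phase_model lam a0 a1 a2 (approx n) - m n)) in approx_res.
  apply ord_le with (fun n => 2 * ((phase_model lam a0 a1 a2 (v n) - m n)
       - (phase_model lam a0 a1 a2 (approx n) - m n))).
  - generalize (filter_and _ _ (v_inf T) (approx_inf T)).
    apply filter_imp. intros n [H2 H3].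
    change (Rabs (v n - approx n) <= Rabs (2 * ((phase_model lam a0 a1 a2 (v n) - m n)
       - (phase_model lam a0 a1 a2 (approx n) - m n)))).
    change (T < approx n) in H3.
    specialize (Hexp (approx n) (v n) ltac:(lra) ltac:(lra)).
    rewrite Rabs_mult, (Rabs_pos_eq 2) by lra.
    eapply Rle_trans; [exact Hexp|]. right. do 2 f_equal. ring.
  - apply (ord_mult g 0 7); [apply ord_const|]. now apply ord_minus.
Qed.

(** * Lambert's function and the expansion of the zeros *)

Lemma LambertW_spec (z : R) : 0 < z -> 0 < LambertW z /\ LambertW z * exp (LambertW z) = z.
Proof.
  intros Hz. unfold LambertW.
  apply (iota_correct (V := R_CompleteNormedModule) (fun w : R => 0 < w /\ w * exp w = z)).
  assert (Hlt : forall a b, 0 < a -> a < b -> a * exp a < b * exp b).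
  { intros a b Ha Hab. assert (exp a < exp b) by now apply exp_increasing.
    assert (Hp := exp_pos a). apply Rmult_le_0_lt_compat; lra. }
  destruct (IVT_interv (fun w => w * exp w - z) 0 (z + 1)) as [w [Hw E]].
  - intros a _. apply continuity_pt_filterlim.
    apply (ex_derive_continuous (V := R_NormedModule) (fun w => w * exp w - z)). auto_derive; trivial.
  - lra.
  - lra.
  - generalize (exp_ineq1_le (z + 1)). nra.
  - assert (Hw0 : 0 < w).
    { destruct (proj1 Hw) as [H|H]; trivial. rewrite <- H in E. lra. }
    exists w. split; [split; [trivial|lra]|].
    intros y [Hy Ey]. destruct (Rtotal_order w y) as [H|[H|H]]; trivial; exfalso.
    + generalize (Hlt w y Hw0 H). lra.
    + generalize (Hlt y w Hy H). lra.
Qed.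

Lemma lambda_pos (x : R) : 0 < x -> 0 < lambda x.
Proof. intros H. unfold lambda. apply Rdiv_lt_0_compat; [lra|]. generalize (exp_pos 1). nra. Qed.

Lemma xi_spec (x m : R) : 0 < x -> 0 < m ->
  0 < xi x m /\ xi x m * ln (lambda x * xi x m) = m.
Proof.
  intros Hx Hm. assert (Hl := lambda_pos x Hx).
  destruct (LambertW_spec (lambda x * m) ltac:(nra)) as [HW E].
  unfold xi. set (W := LambertW (lambda x * m)) in *. split.
  - now apply Rdiv_lt_0_compat.
  - replace (lambda x * (m / W)) with (exp W).
    + rewrite ln_exp. field. lra.
    + apply Rmult_eq_reg_r with W; [|lra]. rewrite Rmult_comm, E. field. lra.
Qed.

Lemma m_minus_inf : forall V, eventually (fun n => V < m_minus n).
Proof.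
  intros V. destruct (nfloor_ex (Rabs V + 1)) as [N HN]; [generalize (Rabs_pos V); lra|].
  exists (S N). intros n Hn. assert (H := le_INR _ _ Hn). rewrite S_INR in H.
  assert (HP : 1 < PI) by (generalize PI2_1; lra).
  unfold m_minus. generalize (Rle_abs V) (Rabs_pos V). nra.
Qed.

Lemma xi_inf (x : R) : 0 < x -> forall V, eventually (fun n => V < xi x (m_minus n)).
Proof.
  intros Hx V. set (U := Rmax 1 V).
  assert (HU1 : 1 <= U) by apply Rmax_l. assert (HU2 : V <= U) by apply Rmax_r.
  assert (Hl := lambda_pos x Hx).
  generalize (filter_and _ _ (m_minus_inf 0) (m_minus_inf (U * Rabs (ln (lambda x * U))))).
  apply filter_imp. intros n [Hm0 Hm].
  destruct (xi_spec x (m_minus n) Hx Hm0) as [H1 H2].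
  destruct (Rlt_dec V (xi x (m_minus n))) as [H|H]; trivial. exfalso.
  set (X := xi x (m_minus n)) in *.
  assert (Hln : ln (lambda x * X) <= Rabs (ln (lambda x * U))).
  { apply Rle_trans with (ln (lambda x * U)); [|apply Rle_abs].
    apply ln_le; [nra|]. apply Rmult_le_compat_l; lra. }
  assert (Ha := Rabs_pos (ln (lambda x * U))). nra.
Qed.

(** The next coefficient after b0 and b1: the one that B2 expresses in powers of m. *)
Definition b2 (x m : R) : R :=
  (3 * Defs.A1 x * b0 x m - A0 x * (b0 x m ^ 2 - b1 x m) - A2 x
   - b0 x m * b1 x m + 1 / 6 * b0 x m ^ 3) / (1 + ln (lambda x * xi x m)).

(** From xi ln (lambda xi) = m one gets 1 + ln (lambda xi) = (1 + rho) / rho, and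
    xi = rho m; hence B_k / m^(2k+1) is b_k / xi^(2k+1). *)
Lemma B_over_m (x m : R) : 0 < x -> 0 < m ->
  0 < 1 + ln (lambda x * xi x m) ->
  B0 x m / m = b0 x m * / xi x m /\
  Defs.B1 x m / m ^ 3 = b1 x m * (/ xi x m) ^ 3 /\
  B2 x m / m ^ 5 = b2 x m * (/ xi x m) ^ 5.
Proof.
  intros Hx Hm HL. destruct (xi_spec x m Hx Hm) as [HX E].
  unfold B0, Defs.B1, B2, b2, rho.
  assert (El : 1 + ln (lambda x * xi x m) = (m + xi x m) / xi x m).
  { rewrite <- E at 2. field. lra. }
  set (N1 := A0 x * b0 x m - Defs.A1 x - 1 / 2 * b0 x m ^ 2).
  set (N2 := 3 * Defs.A1 x * b0 x m - A0 x * (b0 x m ^ 2 - b1 x m) - A2 x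
     - b0 x m * b1 x m + 1 / 6 * b0 x m ^ 3).
  unfold b0 at 1, b1 at 1. fold N1. rewrite El.
  set (X := xi x m) in *.
  repeat split; field; repeat split; lra.
Qed.

Lemma zeros_expansion (x : R) (nu : nat -> R) :
  0 < x -> positive_nu_zeros x nu ->
  let X := fun n => xi x (m_minus n) in
  let g := fun n => / X n in
  ord g 0 (fun n => b0 x (m_minus n)) /\ ord g 0 (fun n => b1 x (m_minus n)) /\
  ord g 0 (fun n => b2 x (m_minus n)) /\
  ord g 7 (fun n => nu n - (X n + b0 x (m_minus n) * g n + b1 x (m_minus n) * g n ^ 3
                            + b2 x (m_minus n) * g n ^ 5)).
Proof.
  intros Hx Hnu X g. set (m := m_minus).
  assert (Hl := lambda_pos x Hx).
  assert (X_inf : forall V, eventually (fun n => V < X n)) by now apply xi_inf.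
  assert (Hg : small_pos g) by now apply small_pos_inv.
  assert (nu_inf := zeros_unbounded x nu Hx Hnu).
  assert (Hinv : ord g 0 (fun n => / (1 + ln (lambda x * X n)))).
  { apply ord_bound with 1; trivial. generalize (X_inf (/ lambda x)). apply filter_imp.
    intros n Hn.
    assert (0 <= ln (lambda x * X n)).
    { rewrite <- ln_1. apply ln_le; [lra|].
      replace 1 with (lambda x * / lambda x) by (field; lra). apply Rmult_le_compat_l; lra. }
    rewrite Rabs_pos_eq by (left; apply Rinv_0_lt_compat; lra).
    simpl. rewrite Rmult_1_r, <- Rinv_1. apply Rinv_le_contravar; lra. }
  assert (L_pos : eventually (fun n => 0 < 1 + ln (lambda x * X n))).
  { generalize (X_inf (/ lambda x)). apply filter_imp. intros n Hn.
    assert (0 <= ln (lambda x * X n)).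
    { rewrite <- ln_1. apply ln_le; [lra|].
      replace 1 with (lambda x * / lambda x) by (field; lra). apply Rmult_le_compat_l; lra. }
    lra. }
  assert (Hb0 : ord g 0 (fun n => b0 x (m n))) by (unfold b0, Rdiv; bounded).
  assert (Hb1 : ord g 0 (fun n => b1 x (m n))) by (unfold b1, Rdiv; bounded).
  assert (Hb2 : ord g 0 (fun n => b2 x (m n))) by (unfold b2, Rdiv; bounded).
  repeat split; trivial.
  apply (inversion_expansion (lambda x) (A0 x) (Defs.A1 x) (A2 x) nu X m); trivial.
  - generalize (m_minus_inf 0). apply filter_imp. intros n Hn. now apply (xi_spec x (m_minus n)).
  - apply ord_ext with (fun n => - (theta (nu n) (2 * ln (x / 2))
      - (nu n * ln (lambda x * nu n) + PI / 4 + A0 x * / nu n + Defs.A1 x * (/ nu n) ^ 3 + A2 x * (/ nu n) ^ 5))).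
    + exists 1%nat. intros n Hn. rewrite (theta_at_zeros x nu Hx Hnu n Hn).
      unfold phase_model, m, m_minus. field.
      destruct Hnu as [Hz _]. destruct (Hz n Hn). lra.
    + apply ord_opp. now apply phase_expansion.
  - revert L_pos. apply filter_imp. intros n Hn. unfold b0. change (xi x (m n)) with (X n). field. lra.
  - revert L_pos. apply filter_imp. intros n Hn. unfold b1. change (xi x (m n)) with (X n). field. lra.
  - revert L_pos. apply filter_imp. intros n Hn. unfold b2. change (xi x (m n)) with (X n). field. lra.
Qed.

Lemma bigO_of_ord (X u : nat -> R) (k : nat) :
  (forall V, eventually (fun n => V < X n)) ->
  ord (fun n => / X n) k u -> bigO u (fun n => / X n ^ k).
Proof.
  intros HX [K [HK H]]. exists K. generalize (filter_and _ _ H (HX 0)). apply filter_imp.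
  intros n [H1 H2].
  rewrite (Rabs_pos_eq (/ X n ^ k)) by (left; apply Rinv_0_lt_compat, pow_lt; lra).
  now rewrite <- pow_inv.
Qed.

Theorem theorem2 :
  forall (x : R) (nu : nat -> R),
    0 < x ->
    positive_nu_zeros x nu ->
    forall K : nat, (K <= 2)%nat ->
      bigO
        (fun n => nu n
                  - (xi x (m_minus n)
                     + sum_n (fun k => B k x (m_minus n)
                                       / m_minus n ^ (2 * k + 1)) K))
        (fun n => / xi x (m_minus n) ^ (2 * K + 3)).
Proof.
  intros x nu Hx Hnu K HK.
  destruct (zeros_expansion x nu Hx Hnu) as [Hb0 [Hb1 [Hb2 H]]]. cbv zeta in *.
  set (X := fun n => xi x (m_minus n)) in *. set (g := fun n => / X n).
  change (fun n => / xi x (m_minus n)) with g in *.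
  assert (X_inf : forall V, eventually (fun n => V < X n)) by now apply xi_inf.
  assert (Hg : small_pos g) by now apply small_pos_inv.
  apply (bigO_of_ord X); trivial. fold g.
  assert (Hl := lambda_pos x Hx).
  assert (HB : eventually (fun n =>
     B0 x (m_minus n) / m_minus n = b0 x (m_minus n) * g n /\
     Defs.B1 x (m_minus n) / m_minus n ^ 3 = b1 x (m_minus n) * g n ^ 3 /\
     B2 x (m_minus n) / m_minus n ^ 5 = b2 x (m_minus n) * g n ^ 5)).
  { generalize (filter_and _ _ (m_minus_inf 0) (X_inf (/ lambda x))). apply filter_imp.
    intros n [Hm HX]. apply B_over_m; trivial.
    assert (0 <= ln (lambda x * X n)).
    { rewrite <- ln_1. apply ln_le; [lra|].
      replace 1 with (lambda x * / lambda x) by (field; lra). apply Rmult_le_compat_l; lra. }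
    unfold X in *. lra. }
  assert (T1 : ord g 3 (fun n => b1 x (m_minus n) * g n ^ 3))
    by (apply (ord_mult g 0 3); trivial; now apply ord_pow_h).
  assert (T2 : ord g 5 (fun n => b2 x (m_minus n) * g n ^ 5))
    by (apply (ord_mult g 0 5); trivial; now apply ord_pow_h).
  destruct K as [|[|[|K]]]; [| | |lia].
  - apply ord_ext with (fun n =>
      (nu n - (X n + b0 x (m_minus n) * g n + b1 x (m_minus n) * g n ^ 3 + b2 x (m_minus n) * g n ^ 5))
      + b1 x (m_minus n) * g n ^ 3 + b2 x (m_minus n) * g n ^ 5).
    + revert HB. apply filter_imp. intros n [E0 [E1 E2]].
      rewrite sum_O. simpl (2 * 0 + 1)%nat. rewrite pow_1. simpl B. rewrite E0. unfold g, X. ring.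
    + apply ord_plus; [apply ord_plus|].
      * apply ord_weaken with 7%nat; trivial; lia.
      * exact T1.
      * apply ord_weaken with 5%nat; trivial; lia.
  - apply ord_ext with (fun n =>
      (nu n - (X n + b0 x (m_minus n) * g n + b1 x (m_minus n) * g n ^ 3 + b2 x (m_minus n) * g n ^ 5))
      + b2 x (m_minus n) * g n ^ 5).
    + revert HB. apply filter_imp. intros n [E0 [E1 E2]].
      rewrite sum_Sn, sum_O. change plus with Rplus.
      simpl (2 * 0 + 1)%nat. simpl (2 * 1 + 1)%nat. rewrite pow_1. simpl B. rewrite E0, E1. unfold g, X. ring.
    + apply ord_plus.
      * apply ord_weaken with 7%nat; trivial; lia.
      * exact T2.
  - revert H. apply ord_ext.
    revert HB. apply filter_imp. intros n [E0 [E1 E2]].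
    rewrite !sum_Sn, sum_O. change plus with Rplus.
    simpl (2 * 0 + 1)%nat. simpl (2 * 1 + 1)%nat. simpl (2 * 2 + 1)%nat.
    rewrite pow_1. simpl B. rewrite E0, E1, E2. unfold g, X. ring.
Qed.
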